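(* Consider the streamline diffusion finite element method with bilinear form $a_{SD}$ on the space $V^N$ of continuous piecewise linear functions on the Shishkin triangular mesh $\mathcal{T}_N$, as defined in the context, and let the weight $\omega$ be defined with $$\sigma_\beta = kN^{-1}\ln N,\qquad \sigma_\eta = kN^{-1/2}.$$ There is a constant $k_0>1$, independent of $N$, $\varepsilon$ and $\boldsymbol{x}^*$, such that for every fixed $k\ge k_0$ (independent of $N$ and $\varepsilon$) there is a constant $C>0$, independent of $N$, $\varepsilon$ and $\boldsymbol{x}^*$, with the following property. For all admissible $N$ and $\varepsilon$ and every mesh node $\boldsymbol{x}^*\in\Omega\setminus\Omega_{xy}$, the discrete Green's function $G\in V^N$ associated with $\boldsymbol{x}^*$, i.e. the function satisfying $a_{SD}(v^N,G)=v^N(\boldsymbol{x}^* )$ for all $v^N\in V^N$, satisfies $$|||G|||\;\le\;\sqrt{8}\,|||G|||_\omega\;\le\; C N^{1/2}\ln^{1/2}N .$$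
   Context: **Problem data.** $\Omega=(0,1)^2$; $\boldsymbol{b}=(b_1,b_2)^T$ is a constant vector with $b_1,b_2>0$; $c>0$ is a constant; $\varepsilon>0$ is a small parameter. The underlying boundary value problem is $-\varepsilon\Delta u+\boldsymbol{b}\cdot\nabla u+cu=f$ in $\Omega$, $u=0$ on $\partial\Omega$. Here $(\cdot,\cdot)_D$ and $\|\cdot\|_D$ are the $L^2(D)$ inner product and norm (subscript omitted when $D=\Omega$), and $|\cdot|_1$ is the $H^1(\Omega)$ seminorm. **Shishkin mesh.** $N\ge 2$ is an even integer, $\rho=2.5$, and $\beta_1,\beta_2>0$ are fixed constants. Put $\lambda_x=\min\{1/2,\rho\varepsilon\beta_1^{-1}\ln N\}$ and $\lambda_y=\min\{1/2,\rho\varepsilon\beta_2^{-1}\ln N\}$. Standing assumption (''admissible $N$ and $\varepsilon$''): $\varepsilon\le N^{-1}$, $\lambda_x=\rho\varepsilon\beta_1^{-1}\ln N$ and $\lambda_y=\rho\varepsilon\beta_2^{-1}\ln N$. Let - $\Omega_s=[0,1-\lambda_x]\times[0,1-\lambda_y]$, - $\Omega_x=[1-\lambda_x,1]\times[0,1-\lambda_y]$, - $\Omega_y=[0,1-\lambda_x]\times[1-\lambda_y,1]$, - $\Omega_{xy}=[1-\lambda_x,1]\times[1-\lambda_y,1]$. The mesh points are $(x_i,y_j)$, $0\le i,j\le N$, with $x_i=2i(1-\lambda_x)/N$ for $i\le N/2$ and $x_i=1-2(N-i)\lambda_x/N$ for $i>N/2$; $y_j=2j(1-\lambda_y)/N$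 for $j\le N/2$ and $y_j=1-2(N-j)\lambda_y/N$ for $j>N/2$. Each rectangle $[x_i,x_{i+1}]\times[y_j,y_{j+1}]$ is split by the diagonal joining $(x_i,y_{j+1})$ and $(x_{i+1},y_j)$ into two triangles. The resulting triangulation is $\mathcal{T}_N$. **Finite element space and method.** $V=H^1_0(\Omega)$; $V^N=\{v\in C(\bar\Omega): v|_{\partial\Omega}=0,\ v|_K\in P_1(K)\ \forall K\in\mathcal{T}_N\}$; $H^2(\mathcal{T}_N)=\{v\in L^2(\Omega): v|_K\in H^2(K)\ \forall K\in\mathcal{T}_N\}$. For $v\in V\cap H^2(\mathcal{T}_N)$ and $w\in V$, $$a_{SD}(v,w)=\varepsilon(\nabla v,\nabla w)+(\boldsymbol{b}\cdot\nabla v,w)+(cv,w)+\sum_{K\in\mathcal{T}_N}(-\varepsilon\Delta v+\boldsymbol{b}\cdot\nabla v+cv,\ \delta_K\,\boldsymbol{b}\cdot\nabla w)_K ,$$ where $\delta_K=C^*N^{-1}$ if $K\subset\Omega_s$ and $\delta_K=0$ otherwise. The norm $|||\cdot|||$ is $$|||v|||^2=\varepsilon|v|_1^2+\|v\|^2+\sum_{K\in\mathcal{T}_N}\delta_K\|\boldsymbol{b}\cdot\nabla v\|_K^2 .$$ Standing assumption: $C^*>0$ is a fixed constant (independent of $N,\varepsilon$) chosen so that the coercivity $a_{SD}(v^N,v^N)\ge\frac12|||v^N|||^2$ holds for all $v^N\in V^N$ (for all admissible $N,\varepsilon$). In particular $G$ exists and is unique. **Weight and weighted norm.** Let $b=\sqrt{b_1^2+b_2^2}$,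 $\boldsymbol{\beta}=(b_1,b_2)^T/b$, $\boldsymbol{\eta}=(-b_2,b_1)^T/b$. Subscripts $\beta,\eta$ on functions denote directional derivatives: $v_\beta=\boldsymbol{\beta}\cdot\nabla v$, $v_\eta=\boldsymbol{\eta}\cdot\nabla v$. With $g(r)=2/(1+e^r)$, $$\omega(\boldsymbol{x})=g\!\left(\tfrac{(\boldsymbol{x}-\boldsymbol{x}^* )\cdot\boldsymbol{\beta}}{\sigma_\beta}\right)g\!\left(\tfrac{(\boldsymbol{x}-\boldsymbol{x}^* )\cdot\boldsymbol{\eta}}{\sigma_\eta}\right)g\!\left(-\tfrac{(\boldsymbol{x}-\boldsymbol{x}^* )\cdot\boldsymbol{\eta}}{\sigma_\eta}\right),$$ so that $(\omega^{-1})_\beta>0$, and $$|||G|||_\omega^2=\varepsilon\|\omega^{-1/2}G_\beta\|^2+\varepsilon\|\omega^{-1/2}G_\eta\|^2+\tfrac b2\big\|((\omega^{-1})_\beta)^{1/2}G\big\|^2+c\|\omega^{-1/2}G\|^2+\sum_{K\in\mathcal{T}_N}b^2\delta_K\|\omega^{-1/2}G_\beta\|_K^2 .$$ Constants ''independent of $N,\varepsilon,\boldsymbol{x}^*$'' may depend on $\boldsymbol{b},c,\beta_1,\beta_2,C^*$ (and $C$ may depend on $k$). *)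

(* Defs.v *)
From mathcomp Require Import all_boot all_order all_algebra.
From mathcomp Require Import all_classical all_reals all_analysis.

Set Implicit Arguments.
Unset Strict Implicit.
Unset Printing Implicit Defensive.

Import Order.TTheory GRing.Theory Num.Theory.
Import numFieldNormedType.Exports.

Local Open Scope classical_set_scope.
Local Open Scope ring_scope.

(* The constants that do not vary with the mesh size and with epsilon. *)
Record sd_data (R : realType) := SDData {
  b1 : R; b2 : R; creact : R; beta1 : R; beta2 : R; Cstar : R }.

Definition sd_data_pos (R : realType) (P : sd_data R) : Prop :=
  [/\ 0 < b1 P, 0 < b2 P & 0 < creact P] /\
  [/\ 0 < beta1 P, 0 < beta2 P & 0 < Cstar P].

Definition Omega (R : realType) : set (R * R) := `]0, 1[ `*` `]0, 1[.

(* The factor 5 / 2 is rho. *)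
Definition transition (R : realType) (beta : R) (N : nat) (eps : R) : R :=
  Num.min (1 / 2) (5 / 2 * eps * beta^-1 * ln N%:R).

Definition lambda_x (R : realType) (P : sd_data R) (N : nat) (eps : R) : R :=
  transition (beta1 P) N eps.

Definition lambda_y (R : realType) (P : sd_data R) (N : nat) (eps : R) : R :=
  transition (beta2 P) N eps.

Definition admissible (R : realType) (P : sd_data R) (N : nat) (eps : R) :
    Prop :=
  [/\ (2 <= N)%N, ~~ odd N, 0 < eps & eps <= N%:R^-1] /\
  (lambda_x P N eps = 5 / 2 * eps * (beta1 P)^-1 * ln N%:R /\
   lambda_y P N eps = 5 / 2 * eps * (beta2 P)^-1 * ln N%:R).

Definition Omega_s (R : realType) (P : sd_data R) (N : nat) (eps : R) :
    set (R * R) :=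
  `[0, 1 - lambda_x P N eps] `*` `[0, 1 - lambda_y P N eps].

Definition Omega_xy (R : realType) (P : sd_data R) (N : nat) (eps : R) :
    set (R * R) :=
  `[1 - lambda_x P N eps, 1] `*` `[1 - lambda_y P N eps, 1].

Definition mesh_pt (R : realType) (lambda : R) (N i : nat) : R :=
  if (i <= N./2)%N then 2 * i%:R * (1 - lambda) / N%:R
  else 1 - 2 * (N - i)%:R * lambda / N%:R.

Definition mesh_x (R : realType) (P : sd_data R) (N : nat) (eps : R)
    (i : nat) : R := mesh_pt (lambda_x P N eps) N i.

Definition mesh_y (R : realType) (P : sd_data R) (N : nat) (eps : R)
    (j : nat) : R := mesh_pt (lambda_y P N eps) N j.

Definition mesh_node (R : realType) (P : sd_data R) (N : nat) (eps : R)
    (p : R * R) : Prop :=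
  exists i j : nat, [/\ (i <= N)%N, (j <= N)%N &
    p = (mesh_x P N eps i, mesh_y P N eps j)].

(* (i, j, false) and (i, j, true) index the triangles below and above the
   diagonal of the cell [x_i, x_(i+1)] x [y_j, y_(j+1)]; the diagonal joining
   (x_i, y_(j+1)) and (x_(i+1), y_j) is the level set cell_coord = 1. *)
Definition tri (N : nat) : finType := ('I_N * 'I_N * bool)%type.

Definition cell (R : realType) (P : sd_data R) (N : nat) (eps : R)
    (i j : nat) : set (R * R) :=
  `[mesh_x P N eps i, mesh_x P N eps i.+1] `*`
  `[mesh_y P N eps j, mesh_y P N eps j.+1].

Definition cell_coord (R : realType) (P : sd_data R) (N : nat) (eps : R)
    (i j : nat) (p : R * R) : R :=
  (p.1 - mesh_x P N eps i) / (mesh_x P N eps i.+1 - mesh_x P N eps i) +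
  (p.2 - mesh_y P N eps j) / (mesh_y P N eps j.+1 - mesh_y P N eps j).

Definition triangle (R : realType) (P : sd_data R) (N : nat) (eps : R)
    (K : tri N) : set (R * R) :=
  let: (i, j, above) := K in
  cell P N eps i j `&`
  [set p | if above then 1 <= cell_coord P N eps i j p
           else cell_coord P N eps i j p <= 1].

(* A function on the closure of Omega that vanishes on the boundary is
   represented by its extension by zero to the plane, so the second clause
   contains the boundary condition. *)
Definition VN (R : realType) (P : sd_data R) (N : nat) (eps : R)
    (v : R * R -> R) : Prop :=
  [/\ {within closure (@Omega R), continuous v},
      forall p, ~ Omega p -> v p = 0 &
      forall K : tri N, exists a0 a1 a2 : R,
        forall p, triangle P eps K p -> v p = a0 + a1 * p.1 + a2 * p.2].

(* Derivatives are classical pointwise ones.  For v in V^N they exist off the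
   triangle edges, a null set, and agree there with the weak gradient and with the
   elementwise Laplacian. *)
Definition dx (R : realType) (v : R * R -> R) : R * R -> R :=
  fun p => 'D_((1, 0) : R * R) v p.

Definition dy (R : realType) (v : R * R -> R) : R * R -> R :=
  fun p => 'D_((0, 1) : R * R) v p.

Definition ddir (R : realType) (d : R * R) (v : R * R -> R) : R * R -> R :=
  fun p => d.1 * dx v p + d.2 * dy v p.

Definition laplacian (R : realType) (v : R * R -> R) : R * R -> R :=
  fun p => dx (dx v) p + dy (dy v) p.

Definition L2ip (R : realType) (D : set (R * R)) (u w : R * R -> R) : R :=
  \int[(@lebesgue_measure R \x @lebesgue_measure R)%E]_(p in D) (u p * w p).

Definition L2norm (R : realType) (D : set (R * R)) (u : R * R -> R) : R :=
  Num.sqrt (L2ip D u u).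

Definition bvec (R : realType) (P : sd_data R) : R * R := (b1 P, b2 P).

Definition delta (R : realType) (P : sd_data R) (N : nat) (eps : R)
    (K : tri N) : R :=
  if `[< triangle P eps K `<=` Omega_s P N eps >] then Cstar P * N%:R^-1
  else 0.

Definition a_SD (R : realType) (P : sd_data R) (N : nat) (eps : R)
    (v w : R * R -> R) : R :=
  eps * (L2ip (@Omega R) (dx v) (dx w) + L2ip (@Omega R) (dy v) (dy w))
  + L2ip (@Omega R) (ddir (bvec P) v) w
  + L2ip (@Omega R) (fun p => creact P * v p) w
  + \sum_(K : tri N)
      L2ip (triangle P eps K)
        (fun p => - eps * laplacian v p + ddir (bvec P) v p + creact P * v p)
        (fun p => delta P eps K * ddir (bvec P) w p).

Definition SDnorm (R : realType) (P : sd_data R) (N : nat) (eps : R)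
    (v : R * R -> R) : R :=
  Num.sqrt (
    eps * (L2norm (@Omega R) (dx v) ^+ 2 + L2norm (@Omega R) (dy v) ^+ 2)
    + L2norm (@Omega R) v ^+ 2
    + \sum_(K : tri N)
        delta P eps K * L2norm (triangle P eps K) (ddir (bvec P) v) ^+ 2).

Definition SDcoercive (R : realType) (P : sd_data R) : Prop :=
  forall (N : nat) (eps : R), admissible P N eps ->
  forall v : R * R -> R, VN P N eps v ->
    1 / 2 * SDnorm P N eps v ^+ 2 <= a_SD P N eps v v.

Definition discrete_green (R : realType) (P : sd_data R) (N : nat) (eps : R)
    (xstar : R * R) (G : R * R -> R) : Prop :=
  VN P N eps G /\
  forall v : R * R -> R, VN P N eps v -> a_SD P N eps v G = v xstar.

Definition bnorm (R : realType) (P : sd_data R) : R :=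
  Num.sqrt (b1 P ^+ 2 + b2 P ^+ 2).

Definition beta_dir (R : realType) (P : sd_data R) : R * R :=
  (b1 P / bnorm P, b2 P / bnorm P).

Definition eta_dir (R : realType) (P : sd_data R) : R * R :=
  (- b2 P / bnorm P, b1 P / bnorm P).

Definition dot (R : realType) (p q : R * R) : R := p.1 * q.1 + p.2 * q.2.

Definition gfun (R : realType) (r : R) : R := 2 / (1 + expR r).

Definition sigma_beta (R : realType) (N : nat) (k : R) : R :=
  k * N%:R^-1 * ln N%:R.

Definition sigma_eta (R : realType) (N : nat) (k : R) : R :=
  k * (Num.sqrt N%:R)^-1.

Definition omega (R : realType) (P : sd_data R) (N : nat) (k : R)
    (xstar p : R * R) : R :=
  gfun (dot (p - xstar) (beta_dir P) / sigma_beta N k) *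
  gfun (dot (p - xstar) (eta_dir P) / sigma_eta N k) *
  gfun (- (dot (p - xstar) (eta_dir P) / sigma_eta N k)).

Definition weighted_norm (R : realType) (P : sd_data R) (N : nat) (eps k : R)
    (xstar : R * R) (G : R * R -> R) : R :=
  let w p := omega P N k xstar p in
  let Gbeta := ddir (beta_dir P) G in
  let Geta := ddir (eta_dir P) G in
  let dwinv := ddir (beta_dir P) (fun p => (w p)^-1) in
  Num.sqrt (
    eps * L2norm (@Omega R) (fun p => (Num.sqrt (w p))^-1 * Gbeta p) ^+ 2
    + eps * L2norm (@Omega R) (fun p => (Num.sqrt (w p))^-1 * Geta p) ^+ 2
    + bnorm P / 2 *
        L2norm (@Omega R) (fun p => Num.sqrt (dwinv p) * G p) ^+ 2
    + creact P * L2norm (@Omega R) (fun p => (Num.sqrt (w p))^-1 * G p) ^+ 2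
    + \sum_(K : tri N)
        bnorm P ^+ 2 * delta P eps K *
        L2norm (triangle P eps K)
          (fun p => (Num.sqrt (w p))^-1 * Gbeta p) ^+ 2).

(* Main.v *)
(** On continuous piecewise linear functions every form in the statement is a
    finite sum over triangles of nodal data.  Write E for the weighted energy of G
    with the weight 1/omega frozen at the right-angled vertex of each triangle; E
    bounds the weighted norm up to a constant.

    - If N is large, testing with the nodal interpolant I of G/omega gives
      c E <= a_SD(I, G) = G(xstar): the weight varies by O(1/k) on a cell, and its
      second order variation is absorbed by the derivative of 1/omega along b and
      by the reaction term.  In the layers, where the cells are anisotropic, the
      diffusion term also contributes.
    - If N is bounded, the weight is bounded too, and coercivity is enough.
    - G(xstar)^2 <= C N ln N E.  In the coarse region this is an inverse estimate;
      in a layer G is summed along the fine direction from xstar to the boundary,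
      where it vanishes, and the diffusion term pays for the differences.

    Hence E^2 <= C N ln N E.  The lower bound by |||G||| needs creact >= 1/4, which
    follows from the coercivity assumption applied to a fixed bump on finer and
    finer meshes, supported in the coarse region with epsilon tending to 0. *)

Require Import Defs.
From mathcomp Require Import all_boot all_order all_algebra.
From mathcomp Require Import all_classical all_reals all_analysis.
From mathcomp Require Import measurable_realfun ring lra zify.

Set Implicit Arguments.
Unset Strict Implicit.
Unset Printing Implicit Defensive.

Import Order.TTheory GRing.Theory Num.Theory.
Import numFieldNormedType.Exports.

Local Open Scope classical_set_scope.
Local Open Scope ring_scope.

(** The test function is only the interpolant of G/omega, so moving the convection derivative off it
    leaves an error: besides half of b.grad of the interpolated weight against G^2, which is
    positive up to O(1/k) terms, there is a quadrature error [local_quad] multiplied by b.grad G. In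
    the coarse region the stabilization pays for it. In the layers there is no stabilization and
    diffusion has to pay, at the price of a factor 1/epsilon. A discrete Poincare inequality across
    a layer of width O(epsilon ln N) gives back epsilon^2 ln^2 N, and the two logarithms are
    compensated because the weight varies only by a relative O(1/(k ln N)) on a cell. This is one
    use of the logarithm in sigma_beta; the other is that the weight stays comparable across a whole
    layer. The scaling sigma_eta = k N^(-1/2) makes the second crosswind differences of the weight
    on a cell of size 1/N as small as 1/N, so that the error of its difference quotients is O(1/k^2)
    whatever N is. The threshold k0 collects the conditions under which all these errors are
    absorbed. *)

Notation plane R := (measurableTypeR R * measurableTypeR R)%type.
Notation plane_measure R := (@lebesgue_measure R \x @lebesgue_measure R)%E.

(** * Integrals up to null sets *)

Section null_sets.
Local Open Scope ereal_scope.
Context d (T : measurableType d) (R : realType) (mu : {measure set T -> \bar R}).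
Import HBNNSimple.

Let nnint (f : T -> \bar R) := ereal_sup [set sintegral mu h |
  h in [set h : {nnsfun T >-> R} | forall x, (h x)%:E <= f x]].

(** A simple function below [f] can be set to 0 on [Z] without changing its integral, and the result
    is a simple function below [g]. *)
Let nnint_null_le (Z : set T) (f g : T -> \bar R) : measurable Z -> mu Z = 0 ->
  (forall x, 0 <= g x) -> (forall x, ~ Z x -> f x = g x) -> nnint f <= nnint g.
Proof.
move=> mZ Z0 g0 fg; apply: ge_ereal_sup => _ [h /= hf <-].
have mZC : measurable (~` Z) by exact: measurableC.
pose h' : {nnsfun T >-> R} := proj_nnsfun h mZC.
have -> : sintegral mu h = sintegral mu h'.
  rewrite -!integralT_nnsfun; apply: ge0_ae_eq_integral => //.
  - by apply/measurable_EFinP.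
  - by apply/measurable_EFinP.
  - by move=> x _; rewrite lee_fin.
  - by move=> x _; rewrite lee_fin.
  - exists Z; split => // x /= nx; apply: contrapT => nZx; apply: nx => _.
    by rewrite /mindic indicE mem_set//= mulr1.
apply: ereal_sup_ubound; exists h' => // x /=.
rewrite /mindic indicE; have [xZ|xZ] := pselect (Z x).
  by rewrite memNset ?mulr0//=; exact.
by rewrite mem_set//= mulr1 -fg.
Qed.

(* No measurability of [f] or [g] is needed, since the integral of a nonnegative
   function is a supremum over simple functions below it. *)
Lemma eq_integral_null (D Z : set T) (f g : T -> \bar R) :
  measurable Z -> mu Z = 0 -> (forall x, ~ Z x -> D x -> f x = g x) ->
  \int[mu]_(x in D) f x = \int[mu]_(x in D) g x.
Proof.
move=> mZ Z0 fg.
have fgD x : ~ Z x -> (f \_ D) x = (g \_ D) x.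
  by move=> nZ; rewrite !patchE; case: ifPn => // /set_mem; exact: fg.
rewrite /integral; congr (_ - _); apply/eqP; rewrite eq_le; apply/andP; split;
  apply: (@nnint_null_le Z) => // x; rewrite ?funepos_ge0 ?funeneg_ge0//.
all: by move=> nZ; rewrite ?funeposE ?funenegE fgD.
Qed.

Lemma eq_Rintegral_null (D Z : set T) (f g : T -> R) :
  measurable Z -> mu Z = 0 -> (forall x, ~ Z x -> D x -> f x = g x) ->
  (\int[mu]_(x in D) f x = \int[mu]_(x in D) g x)%R.
Proof.
move=> mZ Z0 fg; rewrite /Rintegral; congr fine.
by apply: (@eq_integral_null _ Z) => // x nZ Dx; rewrite fg.
Qed.

End null_sets.

(** * Lines in the plane are null sets *)

Section plane_measure.
Context (R : realType).
Local Notation T2 := (plane R).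
Local Notation mu := (@lebesgue_measure R).
Local Notation mu2 := (plane_measure R).
Implicit Types (f g : R * R -> R).

Lemma measurable_set_le f g : measurable_fun (setT : set T2) f ->
  measurable_fun (setT : set T2) g -> measurable ([set p | f p <= g p] : set T2).
Proof.
move=> mf mg; rewrite -[X in measurable X]setTI.
have -> : [set p | f p <= g p] = (fun p => f p - g p) @^-1` `]-oo, 0].
  by apply/seteqP; split => p /=; rewrite in_itv /= subr_le0.
by apply: (measurable_funB mf mg).
Qed.

Definition line (a b c : R) : set (R * R) := [set p | a * p.1 + b * p.2 = c].

Lemma measurable_affine (a b c : R) :
  measurable_fun (setT : set T2) (fun p : R * R => a + b * p.1 + c * p.2).
Proof.
apply: measurable_funD; last first.
  by apply: measurable_funM; [exact: measurable_cst|exact: measurable_snd].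
apply: measurable_funD; first exact: measurable_cst.
by apply: measurable_funM; [exact: measurable_cst|exact: measurable_fst].
Qed.

Lemma measurable_line a b c : measurable (line a b c : set T2).
Proof.
have -> : line a b c = [set p : R * R | 0 + a * p.1 + b * p.2 <= c + 0 * p.1 + 0 * p.2] `&`
                       [set p : R * R | c + 0 * p.1 + 0 * p.2 <= 0 + a * p.1 + b * p.2].
  apply/seteqP; split => p /=; rewrite /line /= !mul0r !addr0 add0r.
    by move=> ->.
  by move=> [? ?]; apply/eqP; rewrite eq_le; apply/andP.
by apply: measurableI; apply: measurable_set_le => //; exact: measurable_affine.
Qed.

Lemma line_null a b c : (a, b) != (0, 0) -> mu2 (line a b c) = 0%E.
Proof.
have [->|b0 _] := eqVneq b 0.
  rewrite xpair_eqE eqxx andbT => a0.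
  have -> : line a 0 c = [set c / a] `*` setT.
    apply/seteqP; split => p; rewrite /line /= mul0r addr0.
      by move=> <-; split=> //; field.
    by move=> [-> _]; field.
  have := @product_measure1E _ _ _ _ R mu mu [set c / a] setT
    (measurable_set1 _) measurableT.
  by move=> ->; rewrite [X in (X * _)%E](lebesgue_measure_set1 (c / a)) mul0e.
rewrite /product_measure1 /=; apply: integral0_eq => x _ /=.
have -> : xsection (line a b c) x = [set (c - a * x) / b].
  apply/seteqP; split => y; rewrite /xsection /= inE /line /=.
    by move=> <-; field.
  by move=> ->; field.
exact: lebesgue_measure_set1.
Qed.

End plane_measure.

(** * Quadratic polynomials over right triangles *)

Section triangle_integrals.
Context (R : realType).
Local Notation T2 := (plane R).
Local Notation mu := (@lebesgue_measure R).
Local Notation mu2 := (plane_measure R).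

Lemma integral_deriv_poly (a b : R) (P : {poly R}) : a <= b ->
  (\int[mu]_(x in `[a, b]) (P^`().[x])%:E = (P.[b] - P.[a])%:E)%E.
Proof.
rewrite le_eqVlt => /predU1P[->|ab].
  by rewrite set_itv1 integral_set1 subrr.
rewrite (@continuous_FTC2 _ _ (horner P)) ?EFinB//.
- by apply: continuous_in_subspaceT => x _; exact: continuous_horner.
- split => [x _||]; first exact: derivable_horner.
  + by apply: cvg_at_right_filter; exact: continuous_horner.
  + by apply: cvg_at_left_filter; exact: continuous_horner.
- by move=> x _; rewrite -derivE.
Qed.

(** Change of variable to the reference coordinate (y - o) / a. Both signs of [a] occur, because one
    of the two triangles of a mesh cell points backwards; the sign only reverses the interval, hence
    the absolute value. *)
Lemma integral_deriv_poly_scaled (a o L : R) (P : {poly R}) : a != 0 -> 0 <= L ->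
  (\int[mu]_(y in [set y | (0 <= (y - o) / a <= L)%R]) (P^`().[(y - o) / a])%:E
   = (`|a| * (P.[L] - P.[0]))%:E)%E.
Proof.
move=> a0 L0; pose A : {poly R} := a^-1 *: ('X - o%:P).
pose Q := a *: (P \Po A).
have dQ y : Q^`().[y] = P^`().[(y - o) / a].
  rewrite /Q derivZ deriv_comp /A derivZ derivXsubC !hornerE horner_comp !hornerE.
  rewrite (mulrC a^-1); move: (P^`().[(y - o) / a]) => z.
  change (a * z * a^-1 * 1 = z). by rewrite mulr1 mulrAC mulfV ?mul1r.
have QE y : Q.[y] = a * P.[(y - o) / a].
  by rewrite /Q hornerZ horner_comp /A !hornerE (mulrC a^-1).
under eq_integral do rewrite -dQ.
have ao : (a * 0 + o - o) / a = 0 by field.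
have aL : (a * L + o - o) / a = L by field.
have [agt0|] := ltP 0 a.
  rewrite gtr0_norm//.
  have -> : [set y | (0 <= (y - o) / a <= L)] = `[a * 0 + o, a * L + o]%classic.
    apply/seteqP; split => y /=; rewrite in_itv /= => /andP[];
      rewrite ?ler_pdivlMr ?ler_pdivrMr// => h1 h2; apply/andP; split; lra.
  rewrite integral_deriv_poly ?lerD2r ?ler_pM2l// !QE ao aL.
  by congr EFin; ring.
rewrite le_eqVlt (negbTE a0) /= => alt0; rewrite ltr0_norm//.
have -> : [set y | (0 <= (y - o) / a <= L)] = `[a * L + o, a * 0 + o]%classic.
  apply/seteqP; split => y /=; rewrite in_itv /= => /andP[];
    rewrite ?ler_ndivlMr ?ler_ndivrMr// => h1 h2; apply/andP; split; lra.
rewrite integral_deriv_poly ?lerD2r ?ler_nM2l// !QE ao aL.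
by congr EFin; ring.
Qed.

Lemma bounded_region_integrable (D : set (R * R)) (f : R * R -> R) (B M : R) :
  measurable (D : set T2) -> measurable_fun (setT : set T2) f ->
  D `<=` `[- B, B]%classic `*` `[- B, B]%classic ->
  (forall p, D p -> `|f p| <= M) -> mu2.-integrable D (EFin \o f).
Proof.
move=> mD mf DB fM; apply: measurable_bounded_integrable => //.
- apply: (@le_lt_trans _ _ (mu2 (`[- B, B]%classic `*` `[- B, B]%classic))).
    apply: le_measure; rewrite ?inE//.
    by apply: measurableX; exact: measurable_itv.
  rewrite [X in (X < _)%E](@product_measure1E _ _ _ _ R mu mu)//.
  have /= -> := lebesgue_measure_itv `[- B, B].
  by case: ifP => _; rewrite ?mul0e ?ltry// -EFinB -EFinM ltry.
- by apply: measurable_funTS.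
- apply: filterS (nbhs_pinfty_ge (num_real M)) => x Mx p Dp.
  by apply: le_trans Mx; exact: fM.
Qed.

(* Written with signed steps [a] and [c], so that the two triangles of a mesh cell
   have the same form, with [o] the vertex at the right angle. *)
Definition right_triangle (o : R * R) (a c : R) : set (R * R) :=
  [set p | [/\ 0 <= (p.1 - o.1) / a, 0 <= (p.2 - o.2) / c &
     (p.1 - o.1) / a + (p.2 - o.2) / c <= 1]].

Lemma right_triangle_coord (o : R * R) (a c : R) p : right_triangle o a c p ->
  0 <= (p.1 - o.1) / a <= 1 /\ 0 <= (p.2 - o.2) / c <= 1.
Proof.
rewrite /right_triangle /=; move: (_ / a) (_ / c) => s t [h1 h2 h3].
by split; apply/andP; split; lra.
Qed.

Lemma measurable_coord1 (o a : R) :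
  measurable_fun (setT : set T2) (fun p : R * R => (p.1 - o) / a).
Proof.
rewrite (_ : (fun p => _) = fun p => - (o / a) + a^-1 * p.1 + 0 * p.2).
  exact: measurable_affine.
by apply/funext => p; rewrite mul0r addr0 mulrBl addrC (mulrC p.1).
Qed.

Lemma measurable_coord2 (o a : R) :
  measurable_fun (setT : set T2) (fun p : R * R => (p.2 - o) / a).
Proof.
rewrite (_ : (fun p => _) = fun p => - (o / a) + 0 * p.1 + a^-1 * p.2).
  exact: measurable_affine.
by apply/funext => p; rewrite mul0r addr0 mulrBl addrC (mulrC p.2).
Qed.

Lemma measurable_right_triangle o a c :
  measurable (right_triangle o a c : set T2).
Proof.
have -> : right_triangle o a c =
    [set p | cst 0 p <= (fun p => (p.1 - o.1) / a) p] `&`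
    [set p | cst 0 p <= (fun p => (p.2 - o.2) / c) p] `&`
    [set p | (fun p => (p.1 - o.1) / a + (p.2 - o.2) / c) p <= cst 1 p].
  by apply/seteqP; split => p /=; [case=> ? ? ?|case=> -[]].
have m1 := measurable_coord1; have m2 := measurable_coord2.
have mD := measurable_funD (m1 o.1 a) (m2 o.2 c).
by apply: measurableI; [apply: measurableI|]; apply: measurable_set_le.
Qed.

Lemma right_triangle_bounded o a c : a != 0 -> c != 0 ->
  right_triangle o a c `<=`
    let B := `|o.1| + `|o.2| + `|a| + `|c| in
    `[- B, B]%classic `*` `[- B, B]%classic.
Proof.
move=> a0 c0 p /right_triangle_coord[/andP[s0 s1] /andP[t0 t1]].
have -> : p = (o.1 + a * ((p.1 - o.1) / a), o.2 + c * ((p.2 - o.2) / c)).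
  by case: p {s0 s1 t0 t1} => x y /=; congr pair; field.
have ba (z k s : R) : 0 <= s -> s <= 1 -> `|z + k * s| <= `|z| + `|k|.
  move=> s0' s1'; rewrite (le_trans (ler_normD _ _))// lerD2l normrM (ger0_norm s0').
  by rewrite ler_piMr.
have b1 := ba o.1 a _ s0 s1; have b2 := ba o.2 c _ t0 t1.
have := (normr_ge0 o.1, normr_ge0 o.2, normr_ge0 a, normr_ge0 c).
move=> [[[n1 n2] n3] n4].
split; rewrite /= in_itv /= -ler_norml.
  by apply: le_trans b1 _; lra.
by apply: le_trans b2 _; lra.
Qed.

End triangle_integrals.

Section quadratic_moments.
Context (R : realType).
Local Notation T2 := (plane R).
Local Notation mu := (@lebesgue_measure R).
Local Notation mu2 := (plane_measure R).

Lemma right_triangle_integrable (o : R * R) (a c M : R) (f : R * R -> R) : a != 0 -> c != 0 ->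
  measurable_fun (setT : set T2) f ->
  (forall p, right_triangle o a c p -> `|f p| <= M) ->
  mu2.-integrable (right_triangle o a c) (EFin \o f).
Proof.
move=> a0 c0 mf fM; apply: bounded_region_integrable fM => //.
  exact: measurable_right_triangle.
exact: right_triangle_bounded.
Qed.

Lemma integral_right_triangle (o : R * R) (a c q0 q1 q2 q3 q4 q5 : R) :
  a != 0 -> c != 0 ->
  \int[mu2]_(p in right_triangle o a c)
    (let s := (p.1 - o.1) / a in let t := (p.2 - o.2) / c in
     q0 + q1 * s + q2 * t + q3 * s ^+ 2 + q4 * (s * t) + q5 * t ^+ 2) =
  `|a| * `|c| * (q0 / 2 + q1 / 6 + q2 / 6 + q3 / 12 + q4 / 24 + q5 / 12).
Proof.
move=> a0 c0 /=.
have dP (k1 k2 k3 k4 t : R) : (k1 *: 'X + (k2 / 2) *: 'X^2 + (k3 / 3) *: 'X^3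
    + (k4 / 4) *: 'X^4)^`().[t] = k1 + k2 * t + k3 * t ^+ 2 + k4 * t ^+ 3.
  by rewrite !poly.derivE !hornerE /=; field.
set f := (fun p => _).
have ms := @measurable_coord1 R o.1 a; have mt := @measurable_coord2 R o.2 c.
have mf : measurable_fun (setT : set T2) f.
  apply: measurable_funD; last first.
    by apply: measurable_funM; [exact: measurable_cst|exact: measurable_funX].
  apply: measurable_funD; last first.
    by apply: measurable_funM; [exact: measurable_cst|exact: measurable_funM].
  apply: measurable_funD; last first.
    by apply: measurable_funM; [exact: measurable_cst|exact: measurable_funX].
  apply: measurable_funD; last first.
    by apply: measurable_funM; [exact: measurable_cst|].
  apply: measurable_funD; first exact: measurable_cst.
  by apply: measurable_funM; [exact: measurable_cst|].
have intf : mu2.-integrable (right_triangle o a c) (EFin \o f).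
  apply: (@right_triangle_integrable _ _ _
    (`|q0| + `|q1| + `|q2| + `|q3| + `|q4| + `|q5|)) => // p.
  move=> /right_triangle_coord; rewrite /f.
  move: (_ / a) (_ / c) => s t [/andP[s0 s1] /andP[t0 t1]].
  have le1 (q z : R) : 0 <= z -> z <= 1 -> `|q * z| <= `|q|.
    by move=> z0 z1; rewrite normrM (ger0_norm z0) ler_piMr.
  apply: (le_trans (ler_normD _ _)); apply: lerD; last first.
    by apply: le1; rewrite ?exprn_ge0 ?exprn_ile1.
  apply: (le_trans (ler_normD _ _)); apply: lerD; last first.
    by apply: le1; rewrite ?mulr_ge0 ?mulr_ile1.
  apply: (le_trans (ler_normD _ _)); apply: lerD; last first.
    by apply: le1; rewrite ?exprn_ge0 ?exprn_ile1.
  apply: (le_trans (ler_normD _ _)); apply: lerD; last first.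
    exact: le1.
  by apply: (le_trans (ler_normD _ _)); rewrite lerD2l le1.
rewrite /Rintegral; set I := (\int[_]_(_ in _) _)%E.
(* [A0] to [A3] are the coefficients in s of the inner integral over 0 <= t <= 1 - s, and [B] is a
   primitive of that cubic times the Jacobian |c|. *)
pose A0 := q0 + q2 / 2 + q5 / 3.
pose A1 := - q0 + q1 - q2 + q4 / 2 - q5.
pose A2 := - q1 + q3 + q2 / 2 - q4 + q5.
pose A3 := - q3 + q4 / 2 - q5 / 3.
pose B : {poly R} := `|c| *: (A0 *: 'X + (A1 / 2) *: 'X^2 + (A2 / 3) *: 'X^3
  + (A3 / 4) *: 'X^4).
have -> : I = (\int[mu]_(x in [set x | (0 <= (x - o.1) / a <= 1)%R])
    (B^`().[(x - o.1) / a])%:E)%E; last first.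
  rewrite integral_deriv_poly_scaled//= /B !hornerE /= /A0 /A1 /A2 /A3.
  by field.
rewrite /I integral_mkcond -integral12_prod_meas1; last first.
  by move/integrable_mkcond : intf; apply; exact: measurable_right_triangle.
rewrite [RHS]integral_mkcond; apply: eq_integral => x _.
rewrite patchE; case: ifPn => [/set_mem /= /andP[s0 s1]|/negP xs]; last first.
  apply: integral0_eq => y _; rewrite patchE; case: ifPn => // /set_mem.
  by move=> /right_triangle_coord[? _]; exfalso; apply: xs; apply: mem_set.
have [s sE] : exists s, s = (x - o.1) / a by eexists.
rewrite -sE in s0 s1 *.
(* [C] is the primitive in t at fixed s; its zero quartic term gives it the shape that [dP]
   differentiates. *)
pose C : {poly R} := (q0 + q1 * s + q3 * s ^+ 2) *: 'X
   + ((q2 + q4 * s) / 2) *: 'X^2 + (q5 / 3) *: 'X^3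
   + (0 / 4) *: 'X^4.
transitivity (\int[mu]_(y in [set y | (0 <= (y - o.2) / c <= 1 - s)%R])
    (C^`().[(y - o.2) / c])%:E)%E.
  rewrite [RHS]integral_mkcond; apply: eq_integral => y _; rewrite !patchE.
  have -> : ((x, y) \in right_triangle o a c) =
            (y \in [set y | (0 <= (y - o.2) / c <= 1 - s)]).
    apply/idP/idP => /set_mem /=.
      rewrite /right_triangle /= -sE.
      by move=> [h1 h2 h3]; apply/mem_set => /=; apply/andP; split => //; lra.
    move=> /andP[h1 h2]; apply/mem_set; rewrite /right_triangle /= -sE.
    by split => //; lra.
  case: ifPn => // _; congr EFin; rewrite /f /= -sE /C dP.
  by move: (_ / c) => t; ring.
rewrite integral_deriv_poly_scaled ?subr_ge0//.
congr EFin; rewrite /B derivZ hornerZ dP /C !hornerE /= /A0 /A1 /A2 /A3.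
by field.
Qed.

End quadratic_moments.

(** * The one-dimensional Shishkin mesh *)

Section mesh_points.
Context (R : realType) (N : nat) (lambda : R).
Hypotheses (N2 : (2 <= N)%N) (evenN : ~~ odd N).
Hypotheses (l0 : 0 < lambda) (l1 : lambda <= 1 / 2).
Local Notation x := (mesh_pt lambda N).

Lemma natr_mesh_gt0 : 0 < N%:R :> R.
Proof. by rewrite ltr0n; lia. Qed.

Lemma half_natr : N./2%:R = N%:R / 2 :> R.
Proof.
rewrite -[in RHS](odd_double_half N) (negbTE evenN) add0n -muln2 natrM.
by field.
Qed.

Lemma mesh_pt_step i : (i < N)%N ->
  x i.+1 - x i = if (i < N./2)%N then 2 * (1 - lambda) / N%:R else 2 * lambda / N%:R.
Proof.
move=> iN; have N0 := natr_mesh_gt0; have Nn0 : N%:R != 0 :> R by rewrite gt_eqF.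
rewrite /mesh_pt; case: (ltngtP i N./2) => [ilt|igt|->].
- by rewrite -natr1; field.
- by have -> : (N - i = (N - i.+1).+1)%N by [lia]; rewrite -natr1; field.
(* The step that starts at N/2 straddles the two branches of [mesh_pt]; they agree at N/2 because N
   is even. *)
- have -> : (N - N./2.+1)%N%:R = N%:R / 2 - 1 :> R.
    rewrite natrB -?natr1 ?half_natr; first by field.
    by have := odd_double_half N; move: N2; lia.
  by rewrite half_natr; field.
Qed.

Lemma mesh_pt0 : x 0%N = 0.
Proof. by rewrite /mesh_pt /= mulr0 !mul0r. Qed.

Lemma mesh_ptN : x N = 1.
Proof.
rewrite /mesh_pt subnn mulr0 !mul0r subr0 ifF//.
by apply/negbTE; rewrite -ltnNge; lia.
Qed.

Lemma mesh_pt_half : x N./2 = 1 - lambda.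
Proof.
by rewrite /mesh_pt leqnn half_natr; have := natr_mesh_gt0 => N0; field; rewrite gt_eqF.
Qed.

Lemma mesh_pt_step_gt0 i : (i < N)%N -> 0 < x i.+1 - x i.
Proof.
move=> iN; rewrite mesh_pt_step//; have N0 := natr_mesh_gt0.
by case: ifP => _; apply: divr_gt0 => //; move: l0 l1; lra.
Qed.

Lemma mesh_pt_step_le i : (i < N)%N -> x i.+1 - x i <= 2 / N%:R.
Proof.
move=> iN; rewrite mesh_pt_step//; have N0 := natr_mesh_gt0.
by case: ifP => _; rewrite ler_pM2r ?invr_gt0//; move: l0 l1; lra.
Qed.

Lemma mesh_pt_step_coarse i : (i < N./2)%N -> 1 / N%:R <= x i.+1 - x i.
Proof.
move=> iN; rewrite mesh_pt_step ?iN; last by have := odd_double_half N; lia.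
by rewrite ler_pM2r ?invr_gt0 ?natr_mesh_gt0//; move: l0 l1; lra.
Qed.

Lemma mesh_pt_step_fine i : (N./2 <= i < N)%N -> x i.+1 - x i = 2 * lambda / N%:R.
Proof. by move=> /andP[h iN]; rewrite mesh_pt_step// ifF// ltnNge h. Qed.

Lemma mesh_pt_lt i j : (i < j)%N -> (j <= N)%N -> x i < x j.
Proof.
elim: j => // j IH; rewrite ltnS leq_eqVlt => /predU1P[->|ij] jN.
  by rewrite -subr_gt0 mesh_pt_step_gt0.
by apply: (lt_trans (IH ij (ltnW jN))); rewrite -subr_gt0 mesh_pt_step_gt0.
Qed.

Lemma mesh_pt_le i j : (i <= j)%N -> (j <= N)%N -> x i <= x j.
Proof. by rewrite leq_eqVlt => /predU1P[->//|ij jN]; rewrite ltW// mesh_pt_lt. Qed.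

Lemma mesh_pt_itv i : (i <= N)%N -> 0 <= x i <= 1.
Proof.
by move=> iN; apply/andP; split; rewrite -?mesh_pt0 -?mesh_ptN; exact: mesh_pt_le.
Qed.

Lemma mesh_pt_cell (z : R) : 0 < z < 1 -> exists2 i, (i < N)%N & x i <= z <= x i.+1.
Proof.
move=> /andP[z0 z1].
have : exists i, z <= x i by exists N; rewrite mesh_ptN ltW.
move=> H; have [[|i] zi min] := ex_minnP H.
  by move: zi; rewrite mesh_pt0 leNgt z0.
have iN : (i < N)%N by apply: min; rewrite mesh_ptN ltW.
exists i => //; rewrite zi andbT leNgt; apply/negP => /ltW /min.
by rewrite ltnn.
Qed.

End mesh_points.

(** * The triangles of the mesh and the skeleton of their edges *)

Section mesh_triangles.
Context (R : realType) (P : sd_data R) (N : nat) (eps : R).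

Definition hx i := mesh_x P N eps i.+1 - mesh_x P N eps i.
Definition hy j := mesh_y P N eps j.+1 - mesh_y P N eps j.

(* The vertices of (i, j, t) are numbered 0, 1, 2 starting from the right angle,
   1 being its neighbour along the x-axis; [t + i] is [i] or [i.+1]. *)
Definition node0 (V : nat -> nat -> R) (K : tri N) : R :=
  let: (i, j, t) := K in V (t + i)%N (t + j)%N.
Definition node1 (V : nat -> nat -> R) (K : tri N) : R :=
  let: (i, j, t) := K in V (~~ t + i)%N (t + j)%N.
Definition node2 (V : nat -> nat -> R) (K : tri N) : R :=
  let: (i, j, t) := K in V (t + i)%N (~~ t + j)%N.

Definition corner (K : tri N) : R * R :=
  (node0 (fun i _ => mesh_x P N eps i) K, node0 (fun _ j => mesh_y P N eps j) K).
Definition step_x (K : tri N) : R := let: (i, j, t) := K in if t then - hx i else hx i.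
Definition step_y (K : tri N) : R := let: (i, j, t) := K in if t then - hy j else hy j.
Definition area (K : tri N) : R := let: (i, j, t) := K in hx i * hy j / 2.
End mesh_triangles.

Lemma itv_coordE (R : realFieldType) (a h x : R) : 0 < h ->
  (a <= x <= a + h) = (0 <= (x - a) / h <= 1).
Proof.
by move=> h0; rewrite ler_pdivlMr// ler_pdivrMr// mul0r mul1r subr_ge0 lerBlDl.
Qed.

Lemma mesh_xS (R : realType) (P : sd_data R) (N : nat) (eps : R) i :
  mesh_x P N eps i.+1 = mesh_x P N eps i + hx P N eps i.
Proof. by rewrite /hx addrC subrK. Qed.

Lemma mesh_yS (R : realType) (P : sd_data R) (N : nat) (eps : R) j :
  mesh_y P N eps j.+1 = mesh_y P N eps j + hy P N eps j.
Proof. by rewrite /hy addrC subrK. Qed.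

Section mesh_geometry.
Context (R : realType) (P : sd_data R) (N : nat) (eps : R).
Hypotheses (hP : sd_data_pos P) (adm : admissible P N eps).
Local Notation T2 := (plane R).
Local Notation mu := (@lebesgue_measure R).
Local Notation mu2 := (plane_measure R).
Local Notation X := (mesh_x P N eps).
Local Notation Y := (mesh_y P N eps).
Local Notation hx := (hx P N eps).
Local Notation hy := (hy P N eps).

Lemma admissible_ge2 : (2 <= N)%N. Proof. by case: adm => -[]. Qed.
Lemma admissible_even : ~~ odd N. Proof. by case: adm => -[]. Qed.
Lemma admissible_eps_gt0 : 0 < eps. Proof. by case: adm => -[]. Qed.
Lemma admissible_eps_le : eps <= N%:R^-1. Proof. by case: adm => -[]. Qed.

Let N2 := admissible_ge2.
Let evN := admissible_even.

Lemma ln_mesh_gt0 : 0 < ln N%:R :> R.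
Proof. by rewrite ln_gt0// ltr1n; have := N2; lia. Qed.

Lemma lambda_x_itv : 0 < lambda_x P N eps <= 1 / 2.
Proof.
apply/andP; split; last by rewrite /lambda_x /transition ge_min lexx.
case: adm => _ [-> _]; case: hP => _ [be1 _ _].
by rewrite !mulr_gt0 ?invr_gt0 ?admissible_eps_gt0 ?ln_mesh_gt0 ?divr_gt0.
Qed.

Lemma lambda_y_itv : 0 < lambda_y P N eps <= 1 / 2.
Proof.
apply/andP; split; last by rewrite /lambda_y /transition ge_min lexx.
case: adm => _ [_ ->]; case: hP => _ [_ be2 _].
by rewrite !mulr_gt0 ?invr_gt0 ?admissible_eps_gt0 ?ln_mesh_gt0 ?divr_gt0.
Qed.

Let lx0 : 0 < lambda_x P N eps. Proof. by case/andP: lambda_x_itv. Qed.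
Let lx1 : lambda_x P N eps <= 1 / 2. Proof. by case/andP: lambda_x_itv. Qed.
Let ly0 : 0 < lambda_y P N eps. Proof. by case/andP: lambda_y_itv. Qed.
Let ly1 : lambda_y P N eps <= 1 / 2. Proof. by case/andP: lambda_y_itv. Qed.

Lemma hx_gt0 i : (i < N)%N -> 0 < hx i. Proof. exact: mesh_pt_step_gt0. Qed.
Lemma hy_gt0 i : (i < N)%N -> 0 < hy i. Proof. exact: mesh_pt_step_gt0. Qed.

Lemma step_x_neq0 (K : tri N) : step_x P eps K != 0.
Proof. by case: K => [[i j] []]; rewrite /= ?oppr_eq0 gt_eqF// hx_gt0. Qed.

Lemma step_y_neq0 (K : tri N) : step_y P eps K != 0.
Proof. by case: K => [[i j] []]; rewrite /= ?oppr_eq0 gt_eqF// hy_gt0. Qed.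

Lemma area_step (K : tri N) :
  `|step_x P eps K| * `|step_y P eps K| = 2 * area P eps K.
Proof.
case: K => [[i j] t] /=.
have -> : `|if t then - hx i else hx i| = hx i.
  by case: t; rewrite ?normrN gtr0_norm// hx_gt0.
have -> : `|if t then - hy j else hy j| = hy j.
  by case: t; rewrite ?normrN gtr0_norm// hy_gt0.
by field.
Qed.

Lemma area_gt0 (K : tri N) : 0 < area P eps K.
Proof. by case: K => [[i j] t] /=; rewrite divr_gt0// mulr_gt0// ?hx_gt0 ?hy_gt0. Qed.

(** The point reflection of a cell in its centre swaps its triangles and turns the coordinates (s,
    t) into (1 - s, 1 - t); hence the negative steps of the upper triangle. *)
Lemma triangleE (K : tri N) :
  triangle P eps K = right_triangle (corner P eps K) (step_x P eps K) (step_y P eps K).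
Proof.
case: K => [[i j] t].
have hi := hx_gt0 (ltn_ord i); have hj := hy_gt0 (ltn_ord j).
have fE (a h x : R) : 0 < h -> (x - (a + h)) / - h = 1 - (x - a) / h.
  by move=> h0; field; rewrite gt_eqF.
rewrite /triangle /cell /right_triangle /cell_coord.
rewrite !mesh_xS !mesh_yS ![X i + hx i - _]addrAC ![Y j + hy j - _]addrAC !subrr !add0r.
case: t => /=; rewrite ?mesh_xS ?mesh_yS.
  apply/seteqP; split => p /=; rewrite !in_itv /= !itv_coordE// ?fE//.
    move: (_ / hx i) (_ / hy j) => s t [[/andP[? ?] /andP[? ?] ?]].
    by split; lra.
  move: (_ / hx i) (_ / hy j) => s t [? ? ?].
  by split; [split; apply/andP; split|]; lra.
apply/seteqP; split => p /=; rewrite !in_itv /= !itv_coordE//.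
  by move: (_ / hx i) (_ / hy j) => s t [[/andP[? ?] /andP[? ?] ?]].
move: (_ / hx i) (_ / hy j) => s t [? ? ?].
by split; [split; apply/andP; split|]; lra.
Qed.

Definition mesh_line (i : nat) : set (R * R) := line 1 0 (X i) `|` line 0 1 (Y i).
(** The equation [cell_coord] = 1 cleared of denominators. The guard on the indices keeps both
    coefficients positive, so that the set is a genuine line. *)
Definition mesh_diagonal (i j : nat) : set (R * R) :=
  if (i < N)%N && (j < N)%N then line (hy j) (hx i) (hy j * X i + hx i * Y j + hx i * hy j)
  else set0.
(** The closed triangles overlap on their edges, and pointwise derivatives are uncontrolled there.
    Off this null set each point of Omega lies in exactly one triangle, and in its interior. *)
Definition mesh_skeleton : set (R * R) :=
  (\bigcup_i mesh_line i) `|` (\bigcup_i \bigcup_j mesh_diagonal i j).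

Lemma measurable_mesh_skeleton : measurable (mesh_skeleton : set T2).
Proof.
apply: measurableU.
  by apply: bigcup_measurable => i _; apply: measurableU; exact: measurable_line.
apply: bigcup_measurable => i _; apply: bigcup_measurable => j _.
by rewrite /mesh_diagonal; case: ifP => // _; exact: measurable_line.
Qed.

Lemma mesh_skeleton_null : mu2 mesh_skeleton = 0%E.
Proof.
have neg a b c : (a, b) != (0, 0) -> mu2.-negligible (line a b c).
  by move=> ab; exists (line a b c); split;
    [exact: measurable_line|exact: line_null|].
apply: measure_negligible; first exact: measurable_mesh_skeleton.
apply: negligibleU.
  apply: negligible_bigcup => i; apply: negligibleU; apply: neg;
    by rewrite xpair_eqE oner_eq0 ?andbF.
apply: negligible_bigcup => i; apply: negligible_bigcup => j.
rewrite /mesh_diagonal; case: ifPn => [/andP[iN jN]|_]; last exact: negligible_set0.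
by apply: neg; rewrite xpair_eqE gt_eqF// hy_gt0.
Qed.

Lemma off_skeleton_x p i : ~ mesh_skeleton p -> p.1 != X i.
Proof.
move=> np; apply/eqP => pX; apply: np; left; exists i => //; left.
by rewrite /line /= mul1r mul0r addr0.
Qed.

Lemma off_skeleton_y p i : ~ mesh_skeleton p -> p.2 != Y i.
Proof.
move=> np; apply/eqP => pX; apply: np; left; exists i => //; right.
by rewrite /line /= mul1r mul0r add0r.
Qed.

Lemma off_skeleton_cell p (i j : 'I_N) : ~ mesh_skeleton p ->
  cell_coord P N eps i j p != 1.
Proof.
move=> np; apply/eqP => pX; apply: np; right; exists i => //; exists j => //.
have hi := hx_gt0 (ltn_ord i); have hj := hy_gt0 (ltn_ord j).
rewrite /mesh_diagonal !ltn_ord /= /line /=.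
move: pX; rewrite /cell_coord -/(hx i) -/(hy j) => pX.
have := congr1 (fun z => z * (hx i * hy j)) pX.
rewrite /= mul1r => <-; field; rewrite !gt_eqF//.
Qed.

Lemma triangle_off_skeleton p (i j : 'I_N) t : ~ mesh_skeleton p ->
  triangle P eps (i, j, t) p ->
  [/\ X i < p.1 < X i.+1, Y j < p.2 < Y j.+1 &
      if t then 1 < cell_coord P N eps i j p else cell_coord P N eps i j p < 1].
Proof.
move=> np [[/=]]; rewrite !in_itv /= => /andP[x1 x2] /andP[y1 y2] h.
have nx k := off_skeleton_x k np; have ny k := off_skeleton_y k np.
have nd := off_skeleton_cell i j np.
split; rewrite ?lt_neqAle ?x1 ?x2 ?y1 ?y2 ?nx ?ny ?andbT//; try by rewrite eq_sym ?nx ?ny.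
by case: t h => /= h; rewrite h andbT// eq_sym.
Qed.

Lemma Omega_subset_triangles p : Omega p -> exists K : tri N, triangle P eps K p.
Proof.
move=> [/=]; rewrite !in_itv /= => px py.
have [i iN xi] := mesh_pt_cell N2 evN lx0 lx1 px.
have [j jN yj] := mesh_pt_cell N2 evN ly0 ly1 py.
exists (Ordinal iN, Ordinal jN, 1 <= cell_coord P N eps i j p).
split; first by split; rewrite /= in_itv.
by rewrite /=; case: ifPn => // h; rewrite leNgt; apply/negP => /ltW; exact/negP.
Qed.

Lemma triangle_unit_square (K : tri N) p : triangle P eps K p ->
  0 <= p.1 <= 1 /\ 0 <= p.2 <= 1.
Proof.
case: K => [[i j] t] [[/=]]; rewrite !in_itv /= => /andP[x1 x2] /andP[y1 y2] _.
have /andP[a _] : 0 <= X i <= 1 by apply: mesh_pt_itv => //; exact: ltnW.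
have /andP[_ b] : 0 <= X i.+1 <= 1 by exact: mesh_pt_itv.
have /andP[c _] : 0 <= Y j <= 1 by apply: mesh_pt_itv => //; exact: ltnW.
have /andP[_ d] : 0 <= Y j.+1 <= 1 by exact: mesh_pt_itv.
split; apply/andP; split.
- exact: le_trans x1.
- exact: le_trans b.
- exact: le_trans y1.
- exact: le_trans d.
Qed.

Lemma triangle_off_skeleton_Omega (K : tri N) p : ~ mesh_skeleton p ->
  triangle P eps K p -> Omega p.
Proof.
move=> np Kp; have [/andP[x0 x1] /andP[y0 y1]] := triangle_unit_square Kp.
have := (off_skeleton_x 0 np, off_skeleton_x N np, off_skeleton_y 0 np, off_skeleton_y N np).
rewrite /mesh_x /mesh_y !mesh_pt0 !mesh_ptN// => -[[[a b] c] d].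
by split; rewrite /= in_itv /= !lt_neqAle ?x0 ?x1 ?y0 ?y1 ?b ?d ?andbT// eq_sym.
Qed.

Lemma triangle_unique p (K L : tri N) : ~ mesh_skeleton p ->
  triangle P eps K p -> triangle P eps L p -> K = L.
Proof.
case: K L => [[i j] t] [[i' j'] t'] np.
move=> /(triangle_off_skeleton np)[/andP[x1 x2] /andP[y1 y2] h].
move=> /(triangle_off_skeleton np)[/andP[x1' x2'] /andP[y1' y2'] h'].
have sep (lam : R) (a b : 'I_N) z : 0 < lam -> lam <= 1 / 2 ->
    mesh_pt lam N a < z -> z < mesh_pt lam N a.+1 ->
    mesh_pt lam N b < z -> z < mesh_pt lam N b.+1 -> a = b.
  move=> l0 l1 a1 a2 b1 b2; apply/val_inj/eqP => /=; rewrite eqn_leq.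
  apply/andP; split; rewrite leqNgt; apply/negP => ab.
    have := mesh_pt_le N2 evN l0 l1 ab (ltnW (ltn_ord a)).
    by move=> /(lt_le_trans b2)/(lt_trans a1); rewrite ltxx.
  have := mesh_pt_le N2 evN l0 l1 ab (ltnW (ltn_ord b)).
  by move=> /(lt_le_trans a2)/(lt_trans b1); rewrite ltxx.
have ii := sep _ _ _ _ lx0 lx1 x1 x2 x1' x2'.
have jj := sep _ _ _ _ ly0 ly1 y1 y2 y1' y2'.
move: h h'; rewrite -ii -jj; case: t t' => -[] // h h'.
all: by have := lt_trans h h'; have := lt_trans h' h; rewrite ltxx.
Qed.

End mesh_geometry.

(** * Exact integration over the mesh *)

Section bounded_on_square.
Context (R : realType).
Local Notation T2 := (plane R).

(** Enough for integrability on every triangle and stable under products; both the affine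
    interpolants and the weight belong to this class. *)
Definition square_bounded (f : R * R -> R) : Prop :=
  measurable_fun (setT : set T2) f /\
  exists M, forall p, 0 <= p.1 <= 1 -> 0 <= p.2 <= 1 -> `|f p| <= M.

Lemma square_bounded_affine a b c : square_bounded (fun p => a + b * p.1 + c * p.2).
Proof.
split; first exact: measurable_affine.
exists (`|a| + `|b| + `|c|) => p /andP[x0 x1] /andP[y0 y1].
have le1 (q z : R) : 0 <= z -> z <= 1 -> `|q * z| <= `|q|.
  by move=> z0 z1; rewrite normrM (ger0_norm z0) ler_piMr.
by do 2 ?[apply: le_trans (ler_normD _ _) _; apply: lerD]; rewrite ?le1.
Qed.

Lemma square_bounded_cst a : square_bounded (fun=> a).
Proof. by split; [exact: measurable_cst|exists `|a|]. Qed.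

Lemma square_boundedM f g : square_bounded f -> square_bounded g ->
  square_bounded (fun p => f p * g p).
Proof.
move=> [mf [M fM]] [mg [M' gM']]; split; first exact: measurable_funM.
exists (M * M') => p px py; rewrite normrM.
by apply: ler_pM; rewrite ?fM ?gM'.
Qed.

End bounded_on_square.

Section mesh_integrals.
Context (R : realType) (P : sd_data R) (N : nat) (eps : R).
Hypotheses (hP : sd_data_pos P) (adm : admissible P N eps).
Local Notation T2 := (plane R).
Local Notation mu2 := (plane_measure R).
Local Notation triangle := (triangle P eps).
Local Notation area := (area P eps).

Lemma measurable_triangle (K : tri N) : measurable (triangle K : set T2).
Proof. by rewrite triangleE//; exact: measurable_right_triangle. Qed.

Lemma triangle_integrable (K : tri N) f : square_bounded f ->
  mu2.-integrable (triangle K) (EFin \o f).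
Proof.
move=> [mf [M fM]]; rewrite (triangleE hP)//.
apply: right_triangle_integrable mf _; rewrite ?(step_x_neq0 hP) ?(step_y_neq0 hP)//.
move=> p; rewrite -(triangleE hP)// => /(triangle_unit_square hP adm)[px py].
exact: fM.
Qed.

Lemma integral_triangle_ae (K : tri N) f F :
  (forall p, ~ mesh_skeleton P N eps p -> triangle K p -> f p = F p) ->
  \int[mu2]_(p in triangle K) f p = \int[mu2]_(p in triangle K) F p.
Proof.
move=> fF.
apply: (@eq_Rintegral_null _ _ R mu2 (triangle K) (mesh_skeleton P N eps) f F) => //.
  exact: measurable_mesh_skeleton.
exact: mesh_skeleton_null.
Qed.

(** The integrand [f] may involve pointwise derivatives, about which nothing is known on the edges,
    so integrability is asked of the local representatives [F K]. Off the skeleton, [f] cut off to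
    Omega is the sum of the [F K] cut off to their triangles. *)
Lemma integral_Omega_triangles f (F : tri N -> R * R -> R) :
  (forall K, square_bounded (F K)) ->
  (forall K p, ~ mesh_skeleton P N eps p -> triangle K p -> f p = F K p) ->
  \int[mu2]_(p in @Omega R) f p = \sum_K \int[mu2]_(p in triangle K) F K p.
Proof.
move=> Fb fF.
have Fi K := triangle_integrable K (Fb K).
rewrite Rintegral_mkcond.
rewrite (@eq_Rintegral_null _ _ R mu2 setT (mesh_skeleton P N eps) _
   (fun p => \sum_K (F K \_ (triangle K)) p)); last 3 first.
- exact: measurable_mesh_skeleton.
- exact: mesh_skeleton_null.
- move=> p np _; rewrite patchE; case: ifPn => [/set_mem pO|/negP pO].
    have [K Kp] := Omega_subset_triangles hP adm pO.
    rewrite (bigD1 K)//= patchE mem_set// big1 ?addr0 ?(fF K)// => L LK.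
    rewrite patchE; case: ifPn => // /set_mem Lp.
    by move: LK; rewrite (triangle_unique hP adm np Kp Lp) eqxx.
  rewrite big1// => K _; rewrite patchE; case: ifPn => // /set_mem Kp.
  by case: pO; apply: mem_set; exact: (triangle_off_skeleton_Omega hP adm np Kp).
rewrite /Rintegral; under eq_integral do rewrite -sumEFin.
rewrite integral_sum//=; last first.
  move=> K; change (mu2.-integrable setT (EFin \o (F K \_ (triangle K)))).
  rewrite -restrict_EFin; apply/(integrable_mkcond _ (measurable_triangle K)).
  exact: Fi.
rewrite -sum_fine; last first.
  move=> K _; have := integrable_fin_num (measurable_triangle K) (Fi K).
  by rewrite integral_mkcond restrict_EFin.
by apply: eq_bigr => K _; rewrite [in RHS]integral_mkcond restrict_EFin.
Qed.

Lemma le_integral_triangle (K : tri N) F F' : square_bounded F -> square_bounded F' ->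
  (forall p, triangle K p -> F p <= F' p) ->
  \int[mu2]_(p in triangle K) F p <= \int[mu2]_(p in triangle K) F' p.
Proof.
move=> bF bF' FF'; apply: le_Rintegral => //; first exact: measurable_triangle.
  exact: triangle_integrable.
exact: triangle_integrable.
Qed.

(** The mass matrix of a triangle: the mean over the triangle of the product of two affine functions
    with these vertex values. *)
Definition vert_form (a0 a1 a2 c0 c1 c2 : R) : R :=
  (a0 * c0 + a1 * c1 + a2 * c2 + (a0 + a1 + a2) * (c0 + c1 + c2)) / 12.

Definition vert_interp (u0 u1 u2 : R) (K : tri N) (p : R * R) : R :=
  u0 + (u1 - u0) * ((p.1 - (corner P eps K).1) / step_x P eps K)
     + (u2 - u0) * ((p.2 - (corner P eps K).2) / step_y P eps K).

Lemma integral_triangle_mul (K : tri N) (u0 u1 u2 v0 v1 v2 : R) :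
  \int[mu2]_(p in triangle K)
    (vert_interp u0 u1 u2 K p * vert_interp v0 v1 v2 K p)
  = area K * vert_form u0 u1 u2 v0 v1 v2.
Proof.
rewrite (triangleE hP)//.
pose F (p : R * R) := let s := (p.1 - (corner P eps K).1) / step_x P eps K in
  let t := (p.2 - (corner P eps K).2) / step_y P eps K in
  u0 * v0 + (u0 * (v1 - v0) + v0 * (u1 - u0)) * s + (u0 * (v2 - v0) + v0 * (u2 - u0)) * t
  + (u1 - u0) * (v1 - v0) * s ^+ 2
  + ((u1 - u0) * (v2 - v0) + (u2 - u0) * (v1 - v0)) * (s * t)
  + (u2 - u0) * (v2 - v0) * t ^+ 2.
rewrite (@eq_Rintegral _ (plane R) R mu2 _ F); last first.
  move=> p _; rewrite /vert_interp /F /=.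
  by move: (_ / step_x P eps K) (_ / step_y P eps K) => s t; ring.
rewrite integral_right_triangle ?(step_x_neq0 hP) ?(step_y_neq0 hP)//.
by rewrite (area_step hP adm) /vert_form; field.
Qed.

Lemma integral_triangle_cst (K : tri N) (u : R) :
  \int[mu2]_(p in triangle K) u = area K * u.
Proof.
have := integral_triangle_mul K u u u 1 1 1.
rewrite (@eq_Rintegral _ (plane R) R mu2 _ (fun=> u)).
  by move=> ->; rewrite /vert_form; field.
by move=> p _; rewrite /vert_interp !subrr !mul0r !addr0 mulr1.
Qed.

(** The inequalities defining the triangle are strict off the skeleton, hence persist nearby. This
    is what lets derivatives be read off the affine formula of one triangle. *)
Lemma triangle_nbhs (K : tri N) p : ~ mesh_skeleton P N eps p -> triangle K p ->
  nbhs p (triangle K).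
Proof.
case: K => [[i j] t] np /(triangle_off_skeleton hP adm np)[/andP[x1 x2] /andP[y1 y2] h].
have c1 : continuous (fun q : R * R => q.1) by move=> q; exact: cvg_fst.
have c2 : continuous (fun q : R * R => q.2) by move=> q; exact: cvg_snd.
have cc : {for p, continuous (fun q : R * R => cell_coord P N eps i j q)}.
  rewrite /cell_coord; apply: cvgD; apply: cvgMl; apply: cvgB;
    by [exact: c1|exact: c2|exact: cvg_cst].
have n1 : \forall q \near p, mesh_x P N eps i < q.1 by exact: (cvgr_gt _ (c1 p)).
have n2 : \forall q \near p, q.1 < mesh_x P N eps i.+1 by exact: (cvgr_lt _ (c1 p)).
have n3 : \forall q \near p, mesh_y P N eps j < q.2 by exact: (cvgr_gt _ (c2 p)).
have n4 : \forall q \near p, q.2 < mesh_y P N eps j.+1 by exact: (cvgr_lt _ (c2 p)).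
have n5 : \forall q \near p, if t then 1 < cell_coord P N eps i j q
    else cell_coord P N eps i j q < 1.
  by case: t h => h; [exact: (cvgr_gt _ cc)|exact: (cvgr_lt _ cc)].
near=> q; split.
  by split; rewrite /= in_itv /=; apply/andP; split; apply: ltW; near: q.
have : if t then 1 < cell_coord P N eps i j q else cell_coord P N eps i j q < 1.
  by near: q.
by rewrite /=; clear; case: t => // /ltW.
Unshelve. all: by end_near. Qed.

End mesh_integrals.

(** * Derivatives of piecewise affine functions from nodal values *)

Section affine_derivative.
Context (R : realType).
Implicit Types (f : R * R -> R) (p d : R * R).

Lemma derive_near_affine f p d (a0 a1 a2 : R) :
  (\forall q \near p, f q = a0 + a1 * q.1 + a2 * q.2) ->
  'D_d f p = a1 * d.1 + a2 * d.2.
Proof.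
move=> fE; have fp := nbhs_singleton fE; apply: lim_near_cst => //.
have c0 : (fun h : R => h *: d + p) @ 0^' --> p.
  rewrite -[X in _ --> X]add0r -(scale0r d); apply: cvgD; last exact: cvg_cst.
  by apply: cvgZl; apply: cvg_within.
near=> h.
have h0 : h != 0 by near: h; exact: nbhs_dnbhs_neq.
have -> : (f \o shift p) (h *: d) = a0 + a1 * (h *: d + p).1 + a2 * (h *: d + p).2.
  by near: h; exact: (c0 _ fE).
rewrite fp /=; change (h^-1 * (a0 + a1 * (h * d.1 + p.1) + a2 * (h * d.2 + p.2)
  - (a0 + a1 * p.1 + a2 * p.2)) = a1 * d.1 + a2 * d.2).
by field.
Unshelve. all: by end_near. Qed.

End affine_derivative.

Section nodal_values.
Context (R : realType) (P : sd_data R) (N : nat) (eps : R).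
Hypotheses (hP : sd_data_pos P) (adm : admissible P N eps).
Implicit Types (V W : nat -> nat -> R) (K : tri N).

Definition grad_x K V : R := (node1 V K - node0 V K) / step_x P eps K.
Definition grad_y K V : R := (node2 V K - node0 V K) / step_y P eps K.
Definition grad_b K V : R := b1 P * grad_x K V + b2 P * grad_y K V.
Definition node_avg K V : R := (node0 V K + node1 V K + node2 V K) / 3.
Definition node_form K V W : R :=
  vert_form (node0 V K) (node1 V K) (node2 V K) (node0 W K) (node1 W K) (node2 W K).
Definition node_interp K V : R * R -> R :=
  vert_interp P eps (node0 V K) (node1 V K) (node2 V K) K.
Definition nodal (v : R * R -> R) (i j : nat) : R :=
  v (mesh_x P N eps i, mesh_y P N eps j).

Lemma node_xE K :
  node1 (fun i _ => mesh_x P N eps i) K = (corner P eps K).1 + step_x P eps K.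
Proof. by case: K => [[i j] []] /=; rewrite ?mesh_xS ?addrK. Qed.

Lemma node_yE K :
  node2 (fun _ j => mesh_y P N eps j) K = (corner P eps K).2 + step_y P eps K.
Proof. by case: K => [[i j] []] /=; rewrite ?mesh_yS ?addrK. Qed.

Lemma node_interpE K V p : node_interp K V p =
  (node0 V K - grad_x K V * (corner P eps K).1 - grad_y K V * (corner P eps K).2)
  + grad_x K V * p.1 + grad_y K V * p.2.
Proof.
rewrite /node_interp /vert_interp /grad_x /grad_y.
have := step_x_neq0 hP adm K; have := step_y_neq0 hP adm K.
move: (step_x _ _ _) (step_y _ _ _) => a c a0 c0; field; exact/andP.
Qed.

Lemma VN_interp v K p : VN P N eps v -> triangle P eps K p ->
  v p = node_interp K (nodal v) p.
Proof.
move=> [_ _ /(_ K)[a0 [a1 [a2 vE]]]] Kp.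
have sx := step_x_neq0 hP adm K; have sy := step_y_neq0 hP adm K.
have t0 : triangle P eps K (corner P eps K).
  rewrite (triangleE hP)// /right_triangle /= !subrr !mul0r addr0; split => //.
have t1 : triangle P eps K ((corner P eps K).1 + step_x P eps K, (corner P eps K).2).
  rewrite (triangleE hP)// /right_triangle /= !subrr !mul0r addrAC subrr add0r.
  by rewrite mulfV// addr0; split.
have t2 : triangle P eps K ((corner P eps K).1, (corner P eps K).2 + step_y P eps K).
  rewrite (triangleE hP)// /right_triangle /= !subrr !mul0r addrAC subrr add0r.
  by rewrite mulfV// add0r; split.
have n0 : node0 (nodal v) K = v (corner P eps K) by case: K {t0 t1 t2 Kp sx sy vE} => [[i j] t].
have n1 : node1 (nodal v) K = v ((corner P eps K).1 + step_x P eps K, (corner P eps K).2).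
  by rewrite -node_xE; case: K {t0 t1 t2 Kp sx sy vE n0} => [[i j] t].
have n2 : node2 (nodal v) K = v ((corner P eps K).1, (corner P eps K).2 + step_y P eps K).
  by rewrite -node_yE; case: K {t0 t1 t2 Kp sx sy vE n0 n1} => [[i j] t].
rewrite node_interpE /grad_x /grad_y n0 n1 n2 !vE//=.
by field; rewrite sx sy.
Qed.

Lemma VN_derive_interior v K p d : VN P N eps v -> nbhs p (triangle P eps K) ->
  'D_d v p = grad_x K (nodal v) * d.1 + grad_y K (nodal v) * d.2.
Proof.
move=> vV Kp; apply: derive_near_affine; apply: filterS Kp => q Kq.
by rewrite (VN_interp vV Kq) node_interpE.
Qed.

Lemma VN_dx v K p : VN P N eps v -> nbhs p (triangle P eps K) ->
  dx v p = grad_x K (nodal v).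
Proof. by move=> vV Kp; rewrite /dx (VN_derive_interior _ vV Kp) mulr1 mulr0 addr0. Qed.

Lemma VN_dy v K p : VN P N eps v -> nbhs p (triangle P eps K) ->
  dy v p = grad_y K (nodal v).
Proof. by move=> vV Kp; rewrite /dy (VN_derive_interior _ vV Kp) mulr1 mulr0 add0r. Qed.

Lemma VN_laplacian v K p : VN P N eps v -> nbhs p (triangle P eps K) ->
  laplacian v p = 0.
Proof.
move=> vV /nbhs_interior Kp; rewrite /laplacian.
have -> : dx (dx v) p = 0 * (1, 0 : R).1 + 0 * (1 : R, 0).2.
  apply: (@derive_near_affine _ (dx v) _ _ (grad_x K (nodal v))).
  by apply: filterS Kp => q Kq; rewrite (VN_dx vV Kq) !mul0r !addr0.
have -> : dy (dy v) p = 0 * (0, 1 : R).1 + 0 * (0 : R, 1).2.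
  apply: (@derive_near_affine _ (dy v) _ _ (grad_y K (nodal v))).
  by apply: filterS Kp => q Kq; rewrite (VN_dy vV Kq) !mul0r !addr0.
by rewrite !mul0r !addr0.
Qed.

Lemma VN_ddir_b v K p : VN P N eps v -> nbhs p (triangle P eps K) ->
  ddir (bvec P) v p = grad_b K (nodal v).
Proof. by move=> vV Kp; rewrite /ddir (VN_dx vV Kp) (VN_dy vV Kp). Qed.

Lemma square_bounded_node_interp K V : square_bounded (node_interp K V).
Proof.
rewrite (funext (node_interpE K V)).
exact: square_bounded_affine.
Qed.

End nodal_values.

(** * The bilinear form and the norm in nodal values *)

Section discrete_forms.
Context (R : realType) (P : sd_data R) (N : nat) (eps : R).
Hypotheses (hP : sd_data_pos P) (adm : admissible P N eps).
Implicit Types (V W : nat -> nat -> R) (K : tri N).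
Local Notation area := (area P eps).
Local Notation grad_x := (grad_x P eps).
Local Notation grad_y := (grad_y P eps).
Local Notation grad_b := (grad_b P eps).
Local Notation nodal := (nodal P N eps).
Local Notation delta := (delta P eps).
Local Notation skeleton := (mesh_skeleton P N eps).

(** The value of [a_SD] on nodal arrays: gradients are constant on a triangle, an affine function
    against a constant gives its vertex average, and the Laplacian disappears. *)
Definition mesh_aSD V W : R := \sum_(K : tri N) area K *
  (eps * (grad_x K V * grad_x K W + grad_y K V * grad_y K W)
   + grad_b K V * node_avg K W + creact P * node_form K V W
   + delta K * ((grad_b K V + creact P * node_avg K V) * grad_b K W)).

Definition mesh_norm2 V : R := \sum_(K : tri N) area K *
  (eps * (grad_x K V ^+ 2 + grad_y K V ^+ 2) + node_form K V V
   + delta K * grad_b K V ^+ 2).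

Lemma node0_affine K V (g c : R) :
  node0 (fun i j => g + c * V i j) K = g + c * node0 V K.
Proof. by case: K => [[i j] t]. Qed.
Lemma node1_affine K V (g c : R) :
  node1 (fun i j => g + c * V i j) K = g + c * node1 V K.
Proof. by case: K => [[i j] t]. Qed.
Lemma node2_affine K V (g c : R) :
  node2 (fun i j => g + c * V i j) K = g + c * node2 V K.
Proof. by case: K => [[i j] t]. Qed.

Lemma L2ip_Omega_cst u w (U W : tri N -> R) :
  (forall K p, ~ skeleton p -> nbhs p (triangle P eps K) -> u p = U K) ->
  (forall K p, ~ skeleton p -> nbhs p (triangle P eps K) -> w p = W K) ->
  L2ip (@Omega R) u w = \sum_(K : tri N) area K * (U K * W K).
Proof.
move=> uE wE; rewrite /L2ip.
rewrite (@integral_Omega_triangles R P N eps hP adm _ (fun K _ => U K * W K)).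
- by apply: eq_bigr => K _; rewrite integral_triangle_cst.
- by move=> K; exact: square_bounded_cst.
- by move=> K p np /(triangle_nbhs hP adm np) Kp; rewrite (uE K)// (wE K).
Qed.

Lemma integral_cst_interp K (c : R) W :
  \int[plane_measure R]_(p in triangle P eps K) (c * node_interp P eps K W p)
  = area K * (c * node_avg K W).
Proof.
have := integral_triangle_mul hP adm K c c c (node0 W K) (node1 W K) (node2 W K).
rewrite (@eq_Rintegral _ (plane R) R _ _ (fun p => c * node_interp P eps K W p)).
  by move=> ->; rewrite /vert_form /node_avg; field.
by move=> p _; rewrite {1}/vert_interp !subrr !mul0r !addr0.
Qed.

Lemma L2ip_Omega_cst_interp u w (U : tri N -> R) : VN P N eps w ->
  (forall K p, ~ skeleton p -> nbhs p (triangle P eps K) -> u p = U K) ->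
  L2ip (@Omega R) u w = \sum_(K : tri N) area K * (U K * node_avg K (nodal w)).
Proof.
move=> wV uE; rewrite /L2ip.
rewrite (@integral_Omega_triangles R P N eps hP adm _
  (fun K p => U K * node_interp P eps K (nodal w) p)).
- by apply: eq_bigr => K _; rewrite integral_cst_interp.
- move=> K; apply: square_boundedM; first exact: square_bounded_cst.
  exact: square_bounded_node_interp.
- move=> K p np Kp; rewrite (uE K)//; last exact: triangle_nbhs.
  by rewrite (VN_interp hP adm wV Kp).
Qed.

Lemma L2ip_Omega_interp v w (c : R) : VN P N eps v -> VN P N eps w ->
  L2ip (@Omega R) (fun p => c * v p) w =
  \sum_(K : tri N) area K * (c * node_form K (nodal v) (nodal w)).
Proof.
move=> vV wV; rewrite /L2ip.
rewrite (@integral_Omega_triangles R P N eps hP adm _ (fun K p =>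
  vert_interp P eps (c * node0 (nodal v) K) (c * node1 (nodal v) K) (c * node2 (nodal v) K) K p
  * node_interp P eps K (nodal w) p)).
- apply: eq_bigr => K _; rewrite integral_triangle_mul//.
  by rewrite /node_form /vert_form; field.
- move=> K; apply: square_boundedM; last exact: square_bounded_node_interp.
  have := @square_bounded_node_interp R P N eps hP adm K
    (fun i j => c * nodal v i j).
  by rewrite /node_interp; case: K => [[i j] t].
- move=> K p np Kp; rewrite (VN_interp hP adm wV Kp) (VN_interp hP adm vV Kp).
  by rewrite /node_interp /vert_interp; ring.
Qed.

Lemma a_SD_nodal v w : VN P N eps v -> VN P N eps w ->
  a_SD P N eps v w = mesh_aSD (nodal v) (nodal w).
Proof.
move=> vV wV; rewrite /a_SD.
rewrite (L2ip_Omega_cst (U := grad_x ^~ (nodal v)) (W := grad_x ^~ (nodal w))); last 2 first.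
- by move=> K p _ Kp; exact: VN_dx.
- by move=> K p _ Kp; exact: VN_dx.
rewrite (L2ip_Omega_cst (U := grad_y ^~ (nodal v)) (W := grad_y ^~ (nodal w))); last 2 first.
- by move=> K p _ Kp; exact: VN_dy.
- by move=> K p _ Kp; exact: VN_dy.
rewrite (L2ip_Omega_cst_interp (U := grad_b ^~ (nodal v)))//; last first.
  by move=> K p _ Kp; exact: VN_ddir_b.
rewrite L2ip_Omega_interp// -big_split/= mulr_sumr -!big_split/=.
apply: eq_bigr => K _.
have -> : L2ip (triangle P eps K) (fun p => - eps * laplacian v p + ddir (bvec P) v p +
     creact P * v p) (fun p => delta K * ddir (bvec P) w p)
  = area K * (delta K * ((grad_b K (nodal v) + creact P * node_avg K (nodal v))
     * grad_b K (nodal w))).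
  rewrite /L2ip; set d := delta K; set gv := grad_b K (nodal v).
  set gw := grad_b K (nodal w).
  (* The element residual b.grad v + c v is itself affine, and is treated as the interpolant of a
     shifted nodal array. *)
  have -> : area K * (d * ((gv + creact P * node_avg K (nodal v)) * gw)) =
      area K * (d * gw * node_avg K (fun i j => gv + creact P * nodal v i j)).
    by rewrite /node_avg node0_affine node1_affine node2_affine; field.
  rewrite -integral_cst_interp; apply: integral_triangle_ae => // p np Kp.
  have Kn := triangle_nbhs hP adm np Kp.
  rewrite (VN_laplacian hP adm vV Kn) (VN_ddir_b hP adm vV Kn) (VN_ddir_b hP adm wV Kn).
  rewrite (VN_interp hP adm vV Kp) /node_interp /vert_interp -/d -/gv -/gw.
  rewrite node0_affine node1_affine node2_affine.
  by ring.
by ring.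
Qed.

Lemma sqr_L2norm D (u : R * R -> R) : L2norm D u ^+ 2 = L2ip D u u.
Proof.
by rewrite /L2norm sqr_sqrtr// /L2ip; apply: Rintegral_ge0 => p _; exact: sqr_ge0.
Qed.

Lemma node_form_ge K V :
  (node0 V K ^+ 2 + node1 V K ^+ 2 + node2 V K ^+ 2) / 12 <= node_form K V V.
Proof.
by rewrite /node_form /vert_form ler_pM2r// -!expr2 lerDl sqr_ge0.
Qed.

Lemma node_form_ge0 K V : 0 <= node_form K V V.
Proof. by apply: le_trans (node_form_ge K V); rewrite divr_ge0// !addr_ge0 ?sqr_ge0. Qed.

Lemma delta_ge0 K : 0 <= delta K.
Proof.
rewrite /Defs.delta; case: ifP => // _; case: hP => _ [_ _ c0].
by apply: mulr_ge0; [exact: ltW|rewrite invr_ge0].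
Qed.

Lemma mesh_norm2_ge0 V : 0 <= mesh_norm2 V.
Proof.
apply: sumr_ge0 => K _; apply: mulr_ge0; first by rewrite ltW// area_gt0.
apply: addr_ge0; last by rewrite mulr_ge0 ?delta_ge0 ?sqr_ge0.
apply: addr_ge0; last exact: node_form_ge0.
by apply: mulr_ge0; [rewrite ltW// (admissible_eps_gt0 adm)|rewrite addr_ge0 ?sqr_ge0].
Qed.

Lemma SDnorm_nodal v : VN P N eps v ->
  SDnorm P N eps v ^+ 2 = mesh_norm2 (nodal v).
Proof.
move=> vV; rewrite /SDnorm sqr_sqrtr; last first.
  have e0 := admissible_eps_gt0 adm.
  rewrite !addr_ge0 ?sqr_ge0//; first by rewrite mulr_ge0 ?addr_ge0 ?sqr_ge0// ltW.
  by apply: sumr_ge0 => K _; rewrite mulr_ge0 ?sqr_ge0 ?delta_ge0.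
have ix : L2norm (@Omega R) (dx v) ^+ 2 =
    \sum_(K : tri N) area K * (grad_x K (nodal v) * grad_x K (nodal v)).
  by rewrite sqr_L2norm; apply: L2ip_Omega_cst => K p _ Kp; exact: VN_dx.
have iy : L2norm (@Omega R) (dy v) ^+ 2 =
    \sum_(K : tri N) area K * (grad_y K (nodal v) * grad_y K (nodal v)).
  by rewrite sqr_L2norm; apply: L2ip_Omega_cst => K p _ Kp; exact: VN_dy.
have i0 : L2norm (@Omega R) v ^+ 2 =
    \sum_(K : tri N) area K * (1 * node_form K (nodal v) (nodal v)).
  rewrite sqr_L2norm -(L2ip_Omega_interp 1 vV vV).
  by congr L2ip; apply/funext => p; rewrite mul1r.
have ib (K : tri N) : L2norm (triangle P eps K) (ddir (bvec P) v) ^+ 2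
    = area K * grad_b K (nodal v) ^+ 2.
  rewrite sqr_L2norm /L2ip -integral_triangle_cst//.
  apply: integral_triangle_ae => // p np Kp.
  by rewrite (VN_ddir_b hP adm vV (triangle_nbhs hP adm np Kp)) expr2.
transitivity (eps * (\sum_(K : tri N) area K * (grad_x K (nodal v) * grad_x K (nodal v)) +
    \sum_(K : tri N) area K * (grad_y K (nodal v) * grad_y K (nodal v))) +
    \sum_(K : tri N) area K * (1 * node_form K (nodal v) (nodal v)) +
    \sum_(K : tri N) delta K * (area K * grad_b K (nodal v) ^+ 2)).
  congr (eps * (_ + _) + _ + _); [exact: ix|exact: iy|exact: i0|].
  by apply: eq_bigr => K _; congr (_ * _); exact: ib.
rewrite -big_split/= mulr_sumr -!big_split/=.
by apply: eq_bigr => K _; ring.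
Qed.

End discrete_forms.

(** * A closed formula for the nodal interpolant *)

Section interpolation_on_a_line.
Context (R : realType) (N : nat) (lambda : R).
Hypotheses (N2 : (2 <= N)%N) (evenN : ~~ odd N).
Hypotheses (l0 : 0 < lambda) (l1 : lambda <= 1 / 2).
Local Notation x := (mesh_pt lambda N).

Definition ramp (i : nat) (z : R) : R :=
  Num.max 0 (Num.min 1 ((z - x i) / (x i.+1 - x i))).

Lemma ramp_itv i z : 0 <= ramp i z <= 1.
Proof. by rewrite /ramp le_max lexx /= ge_max ler01 ge_min lexx. Qed.

Lemma ramp0 i z : (i < N)%N -> z <= x i -> ramp i z = 0.
Proof.
move=> iN zx; apply/max_idPl; rewrite ge_min; apply/orP; right.
by rewrite ler_pdivrMr ?mesh_pt_step_gt0// mul0r subr_le0.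
Qed.

Lemma ramp1 i z : (i < N)%N -> x i.+1 <= z -> ramp i z = 1.
Proof.
move=> iN zx; rewrite /ramp.
have -> : Num.min 1 ((z - x i) / (x i.+1 - x i)) = 1.
  by apply/min_idPl; rewrite ler_pdivlMr ?mesh_pt_step_gt0// mul1r lerD2r.
exact/max_idPr.
Qed.

Lemma ramp_cell i z : (i < N)%N -> x i <= z <= x i.+1 ->
  ramp i z = (z - x i) / (x i.+1 - x i).
Proof.
move=> iN /andP[z0 z1]; rewrite /ramp.
have -> : Num.min 1 ((z - x i) / (x i.+1 - x i)) = (z - x i) / (x i.+1 - x i).
  by apply/min_idPr; rewrite ler_pdivrMr ?mesh_pt_step_gt0// mul1r lerD2r.
by apply/max_idPr; rewrite divr_ge0 ?subr_ge0// mesh_pt_le.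
Qed.

(** Cells left of [z] have ramp 1 and contribute t times their increment, cells to the right have
    ramp 0 and are cut off by the maximum; only the cell of [z] keeps a partial term. *)
Lemma ramp_sum (a : nat -> R) i0 z t : (i0 < N)%N -> x i0 <= z <= x i0.+1 ->
  0 <= t <= 1 ->
  \sum_(0 <= i < N) (a i.+1 - a i) * Num.max 0 (ramp i z + t - 1) =
  t * (a i0 - a 0%N) + (a i0.+1 - a i0) * Num.max 0 ((z - x i0) / (x i0.+1 - x i0) + t - 1).
Proof.
move=> iN zx /andP[t0 t1]; have /andP[z0 z1] := zx.
rewrite (big_cat_nat (n := i0)) ?(ltnW iN)//= (big_cat_nat (m := i0) (n := i0.+1))//=.
rewrite big_nat1 (ramp_cell iN zx) addrA [X in _ + X]big_nat_cond [X in _ + X]big1 ?addr0; last first.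
  move=> i /andP[/andP[ii iN'] _]; rewrite ramp0 ?add0r//.
    by rewrite (max_idPl _) ?mulr0// subr_le0.
  by apply: le_trans z1 _; apply: mesh_pt_le => //; exact: ltnW.
congr (_ + _); rewrite -(telescope_sumr _ (leq0n i0)) mulr_sumr.
apply: eq_big_nat => i /andP[_ ii].
rewrite ramp1 ?(ltn_trans ii)//; first by rewrite addrAC subrr add0r (max_idPr _)// mulrC.
by apply: le_trans z0; apply: mesh_pt_le => //; exact: ltnW.
Qed.

Lemma continuous_ramp i : continuous (ramp i).
Proof.
move=> z; apply: (@continuous_max _ _ (fun=> 0)
  (fun z => Num.min 1 ((z - x i) / (x i.+1 - x i)))); first exact: cst_continuous.
apply: (@continuous_min _ _ (fun=> 1) (fun z => (z - x i) / (x i.+1 - x i))).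
  exact: cst_continuous.
by apply: cvgMl; apply: cvgB; [exact: cvg_id|exact: cvg_cst].
Qed.

End interpolation_on_a_line.

Section nodal_interpolant.
Context (R : realType) (P : sd_data R) (N : nat) (eps : R).
Hypotheses (hP : sd_data_pos P) (adm : admissible P N eps).
Local Notation X := (mesh_x P N eps).
Local Notation Y := (mesh_y P N eps).
Local Notation lx := (lambda_x P N eps).
Local Notation ly := (lambda_y P N eps).
Variable V : nat -> nat -> R.
Hypotheses (V0l : forall j, V 0 j = 0) (VNl : forall j, V N j = 0).
Hypotheses (V0r : forall i, V i 0 = 0) (VNr : forall i, V i N = 0).

Let N2 := admissible_ge2 adm.
Let evN := admissible_even adm.
Let lx0 : 0 < lx. Proof. by case/andP: (lambda_x_itv hP adm). Qed.
Let lx1 : lx <= 1 / 2. Proof. by case/andP: (lambda_x_itv hP adm). Qed.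
Let ly0 : 0 < ly. Proof. by case/andP: (lambda_y_itv hP adm). Qed.
Let ly1 : ly <= 1 / 2. Proof. by case/andP: (lambda_y_itv hP adm). Qed.

Let Vd i j := V i.+1 j.+1 - V i j.+1 - (V i.+1 j - V i j).

(** On a cell, max(0, s + t - 1) vanishes below the diagonal s + t = 1 and is affine above it, so it
    carries the mixed second difference of [V] without leaving the functions affine on each
    triangle. As a sum over all cells the function is continuous by construction, with no gluing
    along edges. *)
Definition interpolant (p : R * R) : R := \sum_(0 <= j < N) \sum_(0 <= i < N)
  (V i.+1 j.+1 - V i j.+1 - (V i.+1 j - V i j)) *
  Num.max 0 (ramp N lx i p.1 + ramp N ly j p.2 - 1).

Lemma interpolant_cell i0 j0 p : (i0 < N)%N -> (j0 < N)%N ->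
  X i0 <= p.1 <= X i0.+1 -> Y j0 <= p.2 <= Y j0.+1 ->
  let s := (p.1 - X i0) / (X i0.+1 - X i0) in
  let t := (p.2 - Y j0) / (Y j0.+1 - Y j0) in
  interpolant p = V i0 j0 + s * (V i0.+1 j0 - V i0 j0) + t * (V i0 j0.+1 - V i0 j0)
    + Vd i0 j0 * Num.max 0 (s + t - 1).
Proof.
move=> iN jN px py s t.
have s01 : 0 <= s <= 1.
  by rewrite /s /mesh_x -(ramp_cell N2 evN lx0 lx1 iN px) ramp_itv.
have t01 : 0 <= t <= 1.
  by rewrite /t /mesh_y -(ramp_cell N2 evN ly0 ly1 jN py) ramp_itv.
rewrite /interpolant.
transitivity (\sum_(0 <= j < N) (((V i0 j.+1 - V i0 j) * Num.max 0 (ramp N ly j p.2 + 1 - 1))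
   + ((V i0.+1 j.+1 - V i0 j.+1) - (V i0.+1 j - V i0 j)) * Num.max 0 (ramp N ly j p.2 + s - 1))).
  apply: eq_big_nat => j /andP[_ jN'].
  have := ramp_sum N2 evN lx0 lx1 (fun i => V i j.+1 - V i j) iN px (ramp_itv N ly j p.2).
  rewrite /= !V0l !subr0 -/(mesh_x P N eps i0) -/(mesh_x P N eps i0.+1) -/s => h.
  transitivity (\sum_(0 <= i < N) (V i.+1 j.+1 - V i.+1 j - (V i j.+1 - V i j)) *
      Num.max 0 (ramp N lx i p.1 + ramp N ly j p.2 - 1)).
    by apply: eq_big_nat => i _; congr (_ * _); ring.
  rewrite h addrK; have /andP[r0 _] := ramp_itv N ly j p.2.
  by rewrite (max_idPr r0) [ramp N ly j p.2 + s]addrC; ring.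
rewrite big_split /=.
have h1 := ramp_sum N2 evN ly0 ly1 (fun j => V i0 j) jN py (t := 1).
rewrite h1 ?ler01 ?lexx//.
have h2 := ramp_sum N2 evN ly0 ly1 (fun j => V i0.+1 j - V i0 j) jN py s01.
rewrite /= in h2; rewrite h2 !V0r !subr0.
rewrite -/(mesh_y P N eps j0) -/(mesh_y P N eps j0.+1) -/t.
have /andP[t0 _] := t01.
by rewrite addrK (max_idPr t0) [t + s]addrC /Vd; ring.
Qed.

(** Left of the square or below it all ramps of one direction are 0; beyond the two other sides they
    are all 1 and the sum telescopes to boundary values of [V]. *)
Lemma interpolant_out p : ~ Omega p -> interpolant p = 0.
Proof.
move=> pO.
have Hx : p.1 <= 0 \/ 1 <= p.1 \/ p.2 <= 0 \/ 1 <= p.2.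
  have [h1|h1] := leP p.1 0; first by left.
  have [h2|h2] := leP 1 p.1; first by right; left.
  have [h3|h3] := leP p.2 0; first by right; right; left.
  have [h4|h4] := leP 1 p.2; first by right; right; right.
  by case: pO; split; rewrite /= in_itv /= ?h1 ?h2 ?h3 ?h4.
have x0 i : (i <= N)%N -> 0 <= X i <= 1 by exact: mesh_pt_itv.
have y0 i : (i <= N)%N -> 0 <= Y i <= 1 by exact: mesh_pt_itv.
have rx i := ramp_itv N lx i p.1; have ry j := ramp_itv N ly j p.2.
have zl (a b : R) : a = 0 -> 0 <= b <= 1 -> Num.max 0 (a + b - 1) = 0.
  by move=> -> /andP[_ b1]; apply/max_idPl; rewrite add0r subr_le0.
have zr (a b : R) : b = 0 -> 0 <= a <= 1 -> Num.max 0 (a + b - 1) = 0.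
  by move=> -> /andP[_ a1]; apply/max_idPl; rewrite addr0 subr_le0.
case: Hx => [h|[h|[h|h]]].
- rewrite /interpolant big_nat_cond big1// => j _; rewrite big_nat_cond big1// => i.
  rewrite andbT => /andP[_ iN]; rewrite zl ?mulr0//; apply: ramp0 => //.
  by apply: le_trans h _; have /andP[] := x0 i (ltnW iN).
- rewrite /interpolant big_nat_cond big1// => j _.
  transitivity (\sum_(0 <= i < N) ((V i.+1 j.+1 - V i.+1 j) - (V i j.+1 - V i j)) *
    ramp N ly j p.2).
    apply: eq_big_nat => i /andP[_ iN]; rewrite ramp1//; last first.
      by apply: le_trans h; have /andP[] := x0 i.+1 iN.
    have /andP[r0 _] := ry j.
    by rewrite (addrAC 1) subrr add0r (max_idPr r0); congr (_ * _); ring.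
  rewrite -mulr_suml (telescope_sumr (fun i => V i j.+1 - V i j))// !V0l !VNl.
  by rewrite !subrr mul0r.
- rewrite /interpolant big_nat_cond big1// => j; rewrite andbT => /andP[_ jN].
  rewrite big1// => i _; rewrite zr ?mulr0//; apply: ramp0 => //.
  by apply: le_trans h _; have /andP[] := y0 j (ltnW jN).
- rewrite /interpolant exchange_big /= big_nat_cond big1// => i _.
  transitivity (\sum_(0 <= j < N) ((V i.+1 j.+1 - V i j.+1) - (V i.+1 j - V i j)) *
    ramp N lx i p.1).
    apply: eq_big_nat => j /andP[_ jN]; rewrite (ramp1 _ _ _ _ jN)//; last first.
      by apply: le_trans h; have /andP[] := y0 j.+1 jN.
    have /andP[r0 _] := rx i.
    by rewrite addrK (max_idPr r0).
  rewrite -mulr_suml (telescope_sumr (fun j => V i.+1 j - V i j))// !V0r !VNr.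
  by rewrite !subrr mul0r.
Qed.

Lemma continuous_interpolant : continuous interpolant.
Proof.
have csum (I : Type) (r : seq I) (F : I -> R * R -> R) :
    (forall i, continuous (F i)) -> continuous (fun p => \sum_(i <- r) F i p).
  move=> cF; elim: r => [|i r IH] p.
    by under eq_fun do rewrite big_nil; exact: cst_continuous.
  by under eq_fun do rewrite big_cons; apply: cvgD; [exact: cF|exact: IH].
apply: (@csum nat) => j; apply: (@csum nat) => i p; apply: cvgMr.
apply: (@continuous_max _ _ (fun=> 0) (fun q : R * R => ramp N lx i q.1 + ramp N ly j q.2 - 1)).
  exact: cst_continuous.
apply: cvgB; last exact: cvg_cst.
apply: cvgD.
  apply: (@continuous_comp _ _ _ fst (ramp N lx i)); first exact: cvg_fst.
  exact: continuous_ramp.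
apply: (@continuous_comp _ _ _ snd (ramp N ly j)); first exact: cvg_snd.
exact: continuous_ramp.
Qed.

Lemma VN_interpolant : VN P N eps interpolant.
Proof.
split; first exact/continuous_subspaceT/continuous_interpolant.
- exact: interpolant_out.
- move=> [[i j] t].
  pose a := (X i.+1 - X i)^-1; pose b := (Y j.+1 - Y j)^-1.
  (* The maximum is 0 below the diagonal and equals its argument above it, so the mixed difference
     enters the upper triangle only. *)
  pose D : R := if t then Vd i j else 0.
  pose Ax := (V i.+1 j - V i j + D) * a; pose Ay := (V i j.+1 - V i j + D) * b.
  exists (V i j - D - Ax * X i - Ay * Y j), Ax, Ay => p [[/=]].
  rewrite !in_itv /= => px py h; rewrite (interpolant_cell _ _ px py)// -/a -/b.
  have -> : Vd i j * Num.max 0 ((p.1 - X i) * a + (p.2 - Y j) * b - 1) =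
     D * ((p.1 - X i) * a + (p.2 - Y j) * b - 1).
    rewrite /D {D Ax Ay}; case: t h => /= h.
      by rewrite (max_idPr _)// subr_ge0.
    by rewrite (max_idPl _) ?mul0r ?mulr0// subr_le0.
  by rewrite /Ax /Ay; ring.
Qed.

Lemma nodal_interpolant i j : (i <= N)%N -> (j <= N)%N ->
  nodal P N eps interpolant i j = V i j.
Proof.
rewrite /nodal leq_eqVlt => /predU1P[->|iN].
  move=> jN; rewrite VNl interpolant_out// => -[/=]; rewrite in_itv /=.
  by rewrite /mesh_x mesh_ptN// ltxx andbF.
rewrite leq_eqVlt => /predU1P[->|jN].
  rewrite VNr interpolant_out// => -[/= _]; rewrite in_itv /=.
  by rewrite /mesh_y mesh_ptN// ltxx andbF.
rewrite (interpolant_cell iN jN) /=; last 2 first.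
- by rewrite lexx /= mesh_pt_le.
- by rewrite lexx /= mesh_pt_le.
rewrite !subrr !mul0r !addr0 add0r (max_idPl _) ?mulr0 ?addr0//.
Qed.

End nodal_interpolant.

(** * The reciprocal weight in scaled coordinates *)

Section exponential_weight.
Context (R : realType).
Implicit Types r s a t : R.

Lemma expR_half_le2 t : t <= 1 / 2 -> expR t <= 2.
Proof.
move=> t1; have h := expR_ge1Dx (- t); have e0 := expR_gt0 t.
have : expR t * expR (- t) = 1 by rewrite -expRD subrr expR0.
nra.
Qed.

(** From expR (- t) >= 1 - t follows expR t <= 1 / (1 - t), which is at most 1 + t + 2 t^2 for t <=
    1/2. *)
Lemma expR_taylor2 t : `|t| <= 1 / 2 -> 0 <= expR t - 1 - t <= 2 * t ^+ 2.
Proof.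
rewrite ler_norml => /andP[t0 t1]; have h := expR_ge1Dx (- t).
have h' := expR_ge1Dx t; have e0 := expR_gt0 t.
have e1 : expR t * expR (- t) = 1 by rewrite -expRD subrr expR0.
apply/andP; split; first lra.
have : expR t * (1 - t) <= 1 by rewrite -[leRHS]e1 ler_pM2l.
have : 0 <= t ^+ 2 * (1 - 2 * t) by rewrite mulr_ge0 ?sqr_ge0//; lra.
nra.
Qed.

(** With g the profile of the weight, 1 / (g(s) g(-s)) = (2 + e^s + e^(-s)) / 4. The factor 1/2 of 1
    / g(r) is moved here as well, so that [weight] is 1/omega and [weight_deriv] is its derivative
    in r. *)
Definition transverse s : R := (2 + expR s + expR (- s)) / 8.
Definition weight r s : R := (1 + expR r) * transverse s.
Definition weight_deriv r s : R := expR r * transverse s.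

Lemma transverse_gt0 s : 0 < transverse s.
Proof.
by rewrite divr_gt0// ltr_wpDr ?expR_ge0// ltr_wpDr ?expR_ge0.
Qed.

Lemma weight_deriv_gt0 r s : 0 < weight_deriv r s.
Proof. by rewrite mulr_gt0 ?expR_gt0 ?transverse_gt0. Qed.

Lemma weight_deriv_le r s : weight_deriv r s <= weight r s.
Proof. by rewrite ler_pM2r ?transverse_gt0// lerDr. Qed.

Lemma weight_gt0 r s : 0 < weight r s.
Proof. exact: lt_le_trans (weight_deriv_gt0 r s) (weight_deriv_le r s). Qed.

Lemma transverse_ge s : 1 / 2 <= transverse s.
Proof.
rewrite /transverse ler_pdivlMr//.
have e0 := expR_gt0 s; have e1 := expR_gt0 (- s).
have e : expR s * expR (- s) = 1 by rewrite -expRD subrr expR0.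
have := sqr_ge0 (expR s - 1); nra.
Qed.

Lemma weight_ge r s : 1 / 2 <= weight r s.
Proof.
have := transverse_ge s; have := expR_gt0 r; rewrite /weight; nra.
Qed.

Lemma transverse_quasi s t : transverse (s + t) <= expR `|t| * transverse s.
Proof.
rewrite /transverse mulrA ler_pM2r// !mulrDr opprD !expRD.
have e0 := expR_gt0 s; have e1 := expR_gt0 (- s).
have h1 : expR t <= expR `|t| by rewrite ler_expR ler_norm.
have h2 : expR (- t) <= expR `|t| by rewrite ler_expR -normrN ler_norm.
have h3 : 1 <= expR `|t| by rewrite -expR0 ler_expR.
nra.
Qed.

Lemma weight_deriv_quasi r s a t :
  weight_deriv (r + a) (s + t) <= expR (`|a| + `|t|) * weight_deriv r s.
Proof.
rewrite /weight_deriv [X in X * _ <= _]expRD [X in _ <= X * _]expRD.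
rewrite [leRHS](_ : _ = (expR r * expR `|a|) * (expR `|t| * transverse s)); last by ring.
apply: ler_pM; rewrite ?mulr_ge0 ?expR_ge0 ?transverse_quasi ?(ltW (transverse_gt0 _))//.
by rewrite ler_pM2l ?expR_gt0// ler_expR ler_norm.
Qed.

(** A Harnack-type bound: it allows the weight on a triangle, or across a layer, to be replaced by
    its value at one point. *)
Lemma weight_quasi r s a t :
  weight (r + a) (s + t) <= expR (`|a| + `|t|) * weight r s.
Proof.
have -> x y : weight x y = transverse y + weight_deriv x y by rewrite /weight mulrDl mul1r.
have -> x y : weight x y = transverse y + weight_deriv x y by rewrite /weight mulrDl mul1r.
rewrite mulrDr lerD ?weight_deriv_quasi//.
apply: le_trans (transverse_quasi _ _) _.
by rewrite ler_pM2r ?transverse_gt0// ler_expR lerDr.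
Qed.

Lemma transverse_taylor s t : `|t| <= 1 / 2 ->
  0 <= transverse (s + t) - transverse s - (expR s - expR (- s)) / 8 * t
    <= 2 * t ^+ 2 * transverse s.
Proof.
move=> t1; have /andP[u0 u1] := expR_taylor2 t1.
have /andP[v0 v1] : 0 <= expR (- t) - 1 - (- t) <= 2 * (- t) ^+ 2.
  by apply: expR_taylor2; rewrite normrN.
rewrite sqrrN in v1.
rewrite /transverse opprD !expRD.
have e0 := expR_gt0 s; have e1 := expR_gt0 (- s); have t2 := sqr_ge0 t.
apply/andP; split; nra.
Qed.

(* Second order expansion: the remainder is quadratic in the transverse increment
   against the weight itself, but carries the small factor [weight_deriv] as soon
   as the increment [a] along the streamline is involved. *)
Lemma weight_taylor r s a t : `|a| <= 1 / 2 -> `|t| <= 1 / 2 ->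
  `|weight (r + a) (s + t) - weight r s
     - (weight_deriv r s * a + (1 + expR r) * ((expR s - expR (- s)) / 8) * t)|
  <= 2 * t ^+ 2 * weight r s + weight_deriv r s * (4 * a ^+ 2 + 2 * `|a| * `|t|).
Proof.
move=> a1 t1; have /andP[T0 T1] := transverse_taylor s t1.
have /andP[u0 u1] := expR_taylor2 a1.
have c0 := transverse_gt0 s; set c := transverse s in T0 T1 c0 *.
have [c' c'E] : exists c', c' = (expR s - expR (- s)) / 8 by eexists.
have c'1 : `|c'| <= c.
  rewrite c'E /c /transverse ler_norml -mulNr !ler_pM2r//.
  by have := expR_gt0 s; have := expR_gt0 (- s); move=> *; apply/andP; split; lra.
rewrite -c'E in T0 T1 *.
have [Q QE] : exists Q, Q = transverse (s + t) - c - c' * t by eexists.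
rewrite -QE in T0 T1.
have [rho rhoE] : exists rho, rho = expR a - 1 - a by eexists.
rewrite -rhoE in u0 u1.
have tE : transverse (s + t) = c + c' * t + Q by rewrite QE; ring.
have aE : expR a = 1 + a + rho by rewrite rhoE; ring.
rewrite /weight /weight_deriv -/c tE expRD aE.
have e0 := expR_gt0 r; set e := expR r in e0 *.
clearbody c e.
(* The transverse remainder [Q] appears against the full factor 1 + e, while the two other terms
   carry the factor e alone; e times c is [weight_deriv]. *)
have -> : (1 + e * (1 + a + rho)) * (c + c' * t + Q) - (1 + e) * c
    - (e * c * a + (1 + e) * c' * t)
  = (1 + e) * Q + e * rho * (c + (c' * t + Q)) + e * a * (c' * t + Q) by ring.
have q1 : `|c' * t + Q| <= 2 * `|t| * c.
  apply: le_trans (ler_normD _ _) _; rewrite normrM (ger0_norm T0).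
  have h1 : `|c'| * `|t| <= c * `|t| by rewrite ler_wpM2r.
  have h2 : Q <= `|t| * c.
    apply: le_trans T1 _; rewrite ler_pM2r// -real_normK ?num_real//.
    by have := normr_ge0 t; nra.
  by lra.
have q2 : `|c + (c' * t + Q)| <= 2 * c.
  apply: le_trans (ler_normD _ _) _; rewrite (gtr0_norm c0).
  by have := normr_ge0 t; nra.
apply: le_trans (ler_normD _ _) _.
have b3 : `|e * a * (c' * t + Q)| <= e * c * (2 * `|a| * `|t|).
  rewrite !normrM (gtr0_norm e0) -!mulrA ler_pM2l//.
  rewrite (_ : c * _ = `|a| * (2 * `|t| * c)); last by ring.
  by rewrite ler_wpM2l.
have b2 : `|e * rho * (c + (c' * t + Q))| <= e * c * (4 * a ^+ 2).
  rewrite !normrM (gtr0_norm e0) (ger0_norm u0) -!mulrA ler_pM2l//.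
  rewrite (_ : c * _ = 2 * a ^+ 2 * (2 * c)); last by ring.
  by apply: ler_pM.
have b1 : `|(1 + e) * Q| <= 2 * t ^+ 2 * ((1 + e) * c).
  rewrite normrM (ger0_norm T0) gtr0_norm ?addr_gt0//.
  rewrite (_ : 2 * _ * _ = (1 + e) * (2 * t ^+ 2 * c)); last by ring.
  by rewrite ler_pM2l ?addr_gt0.
have := ler_normD ((1 + e) * Q) (e * rho * (c + (c' * t + Q))).
lra.
Qed.

Lemma weight_diff r s a t : `|a| <= 1 / 2 -> `|t| <= 1 / 2 ->
  `|weight (r + a) (s + t) - weight r s|
  <= 2 * `|t| * weight r s + 4 * `|a| * weight_deriv r s.
Proof.
move=> a1 t1; have h := weight_taylor r s a1 t1.
have w0 := weight_gt0 r s; have d0 := weight_deriv_gt0 r s.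
set A := weight_deriv r s * a in h; set B := (1 + expR r) * _ * t in h.
have hA : `|A| <= weight_deriv r s * `|a| by rewrite normrM (gtr0_norm d0).
have hB : `|B| <= weight r s * `|t|.
  rewrite /B normrM ler_wpM2r// normrM gtr0_norm ?addr_gt0 ?expR_gt0//.
  rewrite /weight ler_pM2l ?addr_gt0 ?expR_gt0//.
  rewrite /transverse ler_norml -mulNr !ler_pM2r//.
  by have := expR_gt0 s; have := expR_gt0 (- s); move=> *; apply/andP; split; lra.
set w := weight (r + a) (s + t) in h *.
have : `|w - weight r s| <= `|w - weight r s - (A + B)| + (`|A| + `|B|).
  have := ler_normD (w - weight r s - (A + B)) (A + B); rewrite subrK.
  by have := ler_normD A B; lra.
have t0 := normr_ge0 t; have a0 := normr_ge0 a.
rewrite -(real_normK (num_real a)) -(real_normK (num_real t)) in h.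
have k1 : 2 * `|t| ^+ 2 * weight r s <= `|t| * weight r s by rewrite ler_pM2r//; nra.
have k2 : weight_deriv r s * (4 * `|a| ^+ 2 + 2 * `|a| * `|t|) <= 3 * `|a| * weight_deriv r s.
  by rewrite [leRHS]mulrC ler_pM2l//; nra.
lra.
Qed.

End exponential_weight.

(** * The reciprocal weight on the plane *)

Section weight_on_plane.
Context (R : realType) (P : sd_data R) (N : nat) (k : R) (xs : R * R).
Hypotheses (hP : sd_data_pos P) (N2 : (2 <= N)%N) (k0 : 0 < k).
Local Notation sb := (sigma_beta N k).
Local Notation se := (sigma_eta N k).

Lemma bnorm_gt0 : 0 < bnorm P.
Proof.
case: hP => -[b10 b20 _] _.
by rewrite /bnorm sqrtr_gt0 addr_gt0// exprn_gt0.
Qed.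

Lemma bnorm_sqr : bnorm P ^+ 2 = b1 P ^+ 2 + b2 P ^+ 2.
Proof. by rewrite /bnorm sqr_sqrtr// addr_ge0 ?sqr_ge0. Qed.

Lemma b1_le_bnorm : b1 P <= bnorm P.
Proof.
case: hP => -[b10 b20 _] _; have := bnorm_gt0; have := bnorm_sqr; nra.
Qed.

Lemma b2_le_bnorm : b2 P <= bnorm P.
Proof.
case: hP => -[b10 b20 _] _; have := bnorm_gt0; have := bnorm_sqr; nra.
Qed.

Lemma natr_ge2 : 2 <= N%:R :> R.
Proof. by rewrite ler_nat. Qed.

Lemma ln_natr_ge : 1 / 2 <= ln N%:R :> R.
Proof.
have N0 : (0 : R) < N%:R by apply: lt_le_trans natr_ge2.
rewrite -ler_expR lnK ?posrE//; apply: le_trans natr_ge2.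
exact: expR_half_le2.
Qed.

(** Equivalent to 1 / sigma_eta <= 2 / sigma_beta: the crosswind rate of change of the weight is
    dominated by the streamline rate. *)
Lemma ln_natr_le_sqrt : ln N%:R <= 2 * Num.sqrt N%:R :> R.
Proof.
have N0 : (0 : R) < N%:R by apply: lt_le_trans natr_ge2.
have s0 : 0 < Num.sqrt N%:R :> R by rewrite sqrtr_gt0.
have -> : ln N%:R = 2 * ln (Num.sqrt N%:R) :> R.
  by rewrite -[in LHS](sqr_sqrtr (ltW N0)) lnXn// mulr_natl.
rewrite ler_pM2l//; apply: ltW; exact: ln_sublinear.
Qed.

Lemma sigma_beta_gt0 : 0 < sb.
Proof.
have N0 : (0 : R) < N%:R by apply: lt_le_trans natr_ge2.
by rewrite /sigma_beta !mulr_gt0 ?invr_gt0//; apply: lt_le_trans ln_natr_ge.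
Qed.

Lemma sigma_eta_gt0 : 0 < se.
Proof.
have N0 : (0 : R) < N%:R by apply: lt_le_trans natr_ge2.
by rewrite /sigma_eta mulr_gt0// invr_gt0 sqrtr_gt0.
Qed.

Definition along (p : R * R) : R := dot (p - xs) (beta_dir P) / sb.
Definition across (p : R * R) : R := dot (p - xs) (eta_dir P) / se.
Definition weight_at (p : R * R) : R := weight (along p) (across p).
Definition weight_deriv_at (p : R * R) : R := weight_deriv (along p) (across p) / sb.

Lemma alongE p q : along q = along p +
  (b1 P / bnorm P * (q.1 - p.1) + b2 P / bnorm P * (q.2 - p.2)) / sb.
Proof.
rewrite /along /dot /beta_dir /= -mulrDl; congr (_ / _).
by ring.
Qed.

Lemma acrossE p q : across q = across p +
  (- b2 P / bnorm P * (q.1 - p.1) + b1 P / bnorm P * (q.2 - p.2)) / se.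
Proof.
rewrite /across /dot /eta_dir /= -mulrDl; congr (_ / _).
by ring.
Qed.

Lemma omegaV p : (omega P N k xs p)^-1 = weight_at p.
Proof.
rewrite /omega /gfun /weight_at /weight /transverse -/(along p) -/(across p).
move: (along p) (across p) => r s.
have e0 := expR_gt0 s; have e1 := expR_gt0 (- s); have e2 := expR_gt0 r.
have e : expR s * expR (- s) = 1 by rewrite -expRD subrr expR0.
have -> : 2 + expR s + expR (- s) = (1 + expR s) * (1 + expR (- s)).
  by rewrite mulrDl !mulrDr e; ring.
by field; rewrite !gt_eqF// ?addr_gt0.
Qed.

Lemma omega_gt0 p : 0 < omega P N k xs p.
Proof. by rewrite -invr_gt0 omegaV weight_gt0. Qed.

Lemma sqr_sqrt_omegaV p : (Num.sqrt (omega P N k xs p))^-1 ^+ 2 = weight_at p.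
Proof. by rewrite exprVn sqr_sqrtr ?omegaV// ltW// omega_gt0. Qed.

Lemma weight_at_self : weight_at xs = 1.
Proof.
rewrite /weight_at /along /across subrr /dot /= !mul0r !addr0 !mul0r /weight /transverse.
by rewrite oppr0 expR0; field.
Qed.

Lemma weight_deriv_at_gt0 p : 0 < weight_deriv_at p.
Proof. by rewrite divr_gt0 ?weight_deriv_gt0 ?sigma_beta_gt0. Qed.

Lemma weight_deriv_at_le p : weight_deriv_at p <= weight_at p / sb.
Proof. by rewrite ler_pM2r ?invr_gt0 ?sigma_beta_gt0// weight_deriv_le. Qed.

Lemma increment_le (p q : R * R) (c1 c2 s : R) : 0 < s -> `|c1| <= 1 -> `|c2| <= 1 ->
  `|(c1 * (q.1 - p.1) + c2 * (q.2 - p.2)) / s| <= (`|q.1 - p.1| + `|q.2 - p.2|) / s.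
Proof.
move=> s0 h1 h2; rewrite normrM normfV (gtr0_norm s0) ler_pM2r ?invr_gt0//.
apply: le_trans (ler_normD _ _) _; rewrite !normrM.
by apply: lerD; rewrite ler_piMl.
Qed.

Lemma unit_coef : `|b1 P / bnorm P| <= 1 /\ `|b2 P / bnorm P| <= 1 /\
  `|- b2 P / bnorm P| <= 1.
Proof.
case: hP => -[b10 b20 _] _; have b0 := bnorm_gt0.
rewrite mulNr normrN !normrM normfV (gtr0_norm b0) (gtr0_norm b10) (gtr0_norm b20).
by rewrite !ler_pdivrMr// !mul1r b1_le_bnorm b2_le_bnorm.
Qed.

Lemma weight_at_quasi p q :
  let e := expR ((`|q.1 - p.1| + `|q.2 - p.2|) * (sb^-1 + se^-1)) in
  weight_at q <= e * weight_at p /\ weight_deriv_at q <= e * weight_deriv_at p.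
Proof.
move=> e; have [u1 [u2 u3]] := unit_coef.
have i1 := increment_le p q sigma_beta_gt0 u1 u2.
have i2 := increment_le p q sigma_eta_gt0 u3 u1.
rewrite /weight_at /weight_deriv_at (alongE p q) (acrossE p q).
set a := _ / sb in i1 *; set t := _ / se in i2 *.
have eE : expR (`|a| + `|t|) <= e by rewrite ler_expR mulrDr lerD.
split.
  apply: le_trans (weight_quasi _ _ _ _) _.
  by rewrite ler_wpM2r// ltW// weight_gt0.
rewrite mulrA ler_pM2r ?invr_gt0 ?sigma_beta_gt0//.
apply: le_trans (weight_deriv_quasi _ _ _ _) _.
by rewrite ler_wpM2r// ltW// weight_deriv_gt0.
Qed.

Lemma measurable_along : measurable_fun (setT : set (plane R)) along.
Proof.
rewrite (_ : along = fun p => along (0, 0) + (b1 P / bnorm P / sb) * p.1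
   + (b2 P / bnorm P / sb) * p.2); first exact: measurable_affine.
by apply/funext => p; rewrite (alongE (0, 0)) /= !subr0; ring.
Qed.

Lemma measurable_across : measurable_fun (setT : set (plane R)) across.
Proof.
rewrite (_ : across = fun p => across (0, 0) + (- b2 P / bnorm P / se) * p.1
   + (b1 P / bnorm P / se) * p.2); first exact: measurable_affine.
by apply/funext => p; rewrite (acrossE (0, 0)) /= !subr0; ring.
Qed.

Lemma square_bounded_weight :
  square_bounded weight_at /\ square_bounded weight_deriv_at.
Proof.
have ma := measurable_along; have mc := measurable_across.
have mt : measurable_fun (setT : set (plane R)) (fun p => transverse (across p)).
  apply: measurable_funM; last exact: measurable_cst.
  apply: measurable_funD.
    apply: measurable_funD; first exact: measurable_cst.
    exact: (measurableT_comp (@measurable_expR R)).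
  apply: (measurableT_comp (@measurable_expR R)).
  exact: (measurableT_comp (@oppr_measurable R setT)).
have me : measurable_fun (setT : set (plane R)) (fun p => expR (along p)).
  exact: (measurableT_comp (@measurable_expR R)).
have bd (p : R * R) : 0 <= p.1 <= 1 -> 0 <= p.2 <= 1 ->
    `|p.1 - 0| + `|p.2 - 0| <= 2.
  by rewrite !subr0 => /andP[? ?] /andP[? ?]; rewrite !ger0_norm//; lra.
have is0 : 0 <= sb^-1 + se^-1.
  by rewrite addr_ge0 ?invr_ge0 ?ltW ?sigma_beta_gt0 ?sigma_eta_gt0.
split; split.
- apply: measurable_funM => //; apply: measurable_funD => //; exact: measurable_cst.
- exists (expR (2 * (sb^-1 + se^-1)) * weight_at (0, 0)) => p px py.
  have [h _] := weight_at_quasi (0, 0) p.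
  rewrite gtr0_norm ?weight_gt0//; apply: le_trans h _.
  by rewrite ler_pM2r ?weight_gt0// ler_expR ler_wpM2r// bd.
- apply: measurable_funM; last exact: measurable_cst.
  exact: measurable_funM.
- exists (expR (2 * (sb^-1 + se^-1)) * weight_deriv_at (0, 0)) => p px py.
  have [_ h] := weight_at_quasi (0, 0) p.
  rewrite gtr0_norm ?weight_deriv_at_gt0//; apply: le_trans h _.
  by rewrite ler_pM2r ?weight_deriv_at_gt0// ler_expR ler_wpM2r// bd.
Qed.

End weight_on_plane.

Section weight_derivative.
Context (R : realType).

Lemma derive_line (f : R * R -> R) (p d : R * R) :
  'D_d f p = (fun h : R => f (h *: d + p))^`()%classic 0.
Proof.
rewrite /derive derive1E /derive /=; congr (lim (_ @ 0^')).
by apply/funext => h; rewrite /= addr0 [h%:A]mulr1 scale0r add0r.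
Qed.

Lemma is_derive_expR_affine (r a : R) :
  is_derive (0 : R) 1 (fun h => expR (r + h * a)) (a * expR r).
Proof.
have d1 : is_derive (0 : R) 1 (fun h : R => r + h * a) a.
  have -> : (fun h : R => r + h * a) = cst r + (a \*: id).
    by apply/funext => h; congr (_ + _); exact: mulrC.
  by apply: is_derive_eq; rewrite add0r; exact: mulr1.
have d2 : is_derive (r + 0 * a) 1 expR (expR r).
  by rewrite mul0r addr0; exact: is_derive_expR.
by rewrite (mulrC a); exact: (@is_derive1_comp R expR (fun h => r + h * a) 0 _ _ d2 d1).
Qed.

Lemma derive_weight_line (r s a t : R) :
  (fun h : R => weight (r + h * a) (s + h * t))^`()%classic 0 =
  a * weight_deriv r s + t * ((1 + expR r) * ((expR s - expR (- s)) / 8)).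
Proof.
have d1 := is_derive_expR_affine r a.
have d2 := is_derive_expR_affine s t.
have d3 := is_derive_expR_affine (- s) (- t).
have -> : (fun h : R => weight (r + h * a) (s + h * t)) =
  (cst 1 + (fun h => expR (r + h * a))) *
  (8^-1 \*: (cst 2 + (fun h => expR (s + h * t)) + (fun h => expR (- s + h * - t)))).
  apply/funext => h; rewrite /weight /transverse.
  rewrite [_ / 8]mulrC; congr (_ * (_ * (_ + expR _))).
  by rewrite opprD mulrN.
rewrite derive1E derive_val /weight_deriv /transverse.
rewrite -[X in X = _]/((1 + expR (r + 0 * a)) * (8^-1 * (0 + t * expR s + - t * expR (- s)))
  + 8^-1 * (2 + expR (s + 0 * t) + expR (- s + 0 * - t)) * (0 + a * expR r)).
by rewrite !mul0r !addr0; field.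
Qed.

(** The crosswind factor does not contribute, because the two directions are orthogonal; the
    streamline coefficient is (b1^2 + b2^2) / b^2 = 1. *)
Lemma ddir_omegaV (P : sd_data R) (N : nat) (k : R) (xs p : R * R) :
  sd_data_pos P -> (2 <= N)%N -> 0 < k ->
  ddir (beta_dir P) (fun p => (omega P N k xs p)^-1) p = weight_deriv_at P N k xs p.
Proof.
move=> hP N2 k0.
have b0 := bnorm_gt0 hP; have bs := bnorm_sqr P.
rewrite (_ : (fun p => _) = weight_at P N k xs); last by apply/funext => q; rewrite omegaV.
have D d : 'D_d (weight_at P N k xs) p =
  (b1 P / bnorm P * d.1 + b2 P / bnorm P * d.2) / sigma_beta N k
    * weight_deriv (along P N k xs p) (across P N k xs p)
  + (- b2 P / bnorm P * d.1 + b1 P / bnorm P * d.2) / sigma_eta N k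
    * ((1 + expR (along P N k xs p)) *
       ((expR (across P N k xs p) - expR (- across P N k xs p)) / 8)).
  rewrite derive_line -derive_weight_line; congr (_^`()%classic 0).
  apply/funext => h; rewrite /weight_at (alongE _ _ _ _ p) (acrossE _ _ _ _ p).
  have -> : (h *: d + p).1 - p.1 = h * d.1 by exact: addrK.
  have -> : (h *: d + p).2 - p.2 = h * d.2 by exact: addrK.
  by congr (weight (_ + _) (_ + _)); ring.
rewrite /ddir /dx /dy !D /weight_deriv_at /beta_dir /=.
set w := weight_deriv _ _; set z := (1 + _) * _.
transitivity ((b1 P ^+ 2 + b2 P ^+ 2) / bnorm P ^+ 2 * (w / sigma_beta N k)).
  by field; rewrite !gt_eqF ?sigma_beta_gt0 ?sigma_eta_gt0.
by rewrite -bs mulfV ?mul1r// expf_neq0// gt_eqF.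
Qed.

End weight_derivative.

(** * Variation of the weight over one mesh cell *)

Section mesh_weight.
Context (R : realType) (P : sd_data R) (N : nat) (eps k : R) (xs : R * R).
Hypotheses (hP : sd_data_pos P) (adm : admissible P N eps) (k24 : 24 <= k).
Local Notation W := (nodal P N eps (weight_at P N k xs)).
Local Notation D := (nodal P N eps (weight_deriv_at P N k xs)).
Local Notation sx := (step_x P eps).
Local Notation sy := (step_y P eps).

Let N2 := admissible_ge2 adm.
Let k0 : 0 < k. Proof. by move: k24; lra. Qed.
Let sb0 := sigma_beta_gt0 N2 k0.
Let se0 := sigma_eta_gt0 N2 k0.

Lemma natr_gt0 : 0 < N%:R :> R.
Proof. by apply: lt_le_trans (natr_ge2 R N2). Qed.

Lemma sigma_betaV : (sigma_beta N k)^-1 = N%:R / (k * ln N%:R).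
Proof.
have L0 := ln_natr_ge R N2; have N0 := natr_gt0.
rewrite /sigma_beta; field; rewrite !gt_eqF//; lra.
Qed.

Lemma sigma_etaV : (sigma_eta N k)^-1 = Num.sqrt N%:R / k.
Proof.
have N0 : 0 < Num.sqrt N%:R :> R by rewrite sqrtr_gt0 natr_gt0.
by rewrite /sigma_eta; field; rewrite !gt_eqF.
Qed.

Lemma sigma_betaV_le : (sigma_beta N k)^-1 <= 2 * N%:R / k.
Proof.
rewrite sigma_betaV; have L0 := ln_natr_ge R N2; have N0 := natr_gt0.
have kL : 0 < k * ln N%:R by rewrite mulr_gt0//; lra.
rewrite ler_pdivrMr// [leRHS](_ : _ = N%:R * (2 * ln N%:R)); last by field; rewrite gt_eqF.
by rewrite ler_peMr ?(ltW N0)//; lra.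
Qed.

Lemma sqrt_natr_le : Num.sqrt N%:R <= N%:R :> R.
Proof.
have N0 := natr_gt0; have N2' := natr_ge2 R N2.
rewrite -[leRHS](ger0_norm (ltW N0)) -sqrtr_sqr ler_wsqrtr// expr2.
by rewrite ler_pMl//; lra.
Qed.

Lemma step_x_le (K : tri N) : `|sx K| <= 2 / N%:R.
Proof.
have [/andP[l0 l1] _] := (lambda_x_itv hP adm, lambda_y_itv hP adm).
case: K => [[i j] t] /=.
have -> : `|if t then - hx P N eps i else hx P N eps i| = hx P N eps i.
  by case: t; rewrite ?normrN gtr0_norm// hx_gt0.
exact: mesh_pt_step_le N2 (admissible_even adm) l0 l1 _ _.
Qed.

Lemma step_y_le (K : tri N) : `|sy K| <= 2 / N%:R.
Proof.
have /andP[l0 l1] := lambda_y_itv hP adm.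
case: K => [[i j] t] /=.
have -> : `|if t then - hy P N eps j else hy P N eps j| = hy P N eps j.
  by case: t; rewrite ?normrN gtr0_norm// hy_gt0.
exact: mesh_pt_step_le N2 (admissible_even adm) l0 l1 _ _.
Qed.

Lemma node0_nodal (f : R * R -> R) (K : tri N) :
  node0 (nodal P N eps f) K = f (corner P eps K).
Proof. by case: K => [[i j] t]. Qed.

Lemma node1_nodal (f : R * R -> R) (K : tri N) :
  node1 (nodal P N eps f) K = f ((corner P eps K).1 + sx K, (corner P eps K).2).
Proof. by rewrite -node_xE; case: K => [[i j] t]. Qed.

Lemma node2_nodal (f : R * R -> R) (K : tri N) :
  node2 (nodal P N eps f) K = f ((corner P eps K).1, (corner P eps K).2 + sy K).
Proof. by rewrite -node_yE; case: K => [[i j] t]. Qed.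

Lemma increment_small (c h s B : R) : `|c| <= 1 -> 0 < s -> s^-1 <= B -> `|h| <= 2 / N%:R ->
  2 / N%:R * B <= 1 / 2 -> `|c * h / s| <= 1 / 2.
Proof.
move=> c1 s0 sB h1 hB; apply: le_trans hB.
rewrite !normrM normfV (gtr0_norm s0); apply: ler_pM => //.
- by rewrite invr_ge0 ltW.
- by apply: le_trans h1; rewrite ler_piMl.
Qed.

(** Steps are at most 2/N, so the scaled increments are at most 4/k along the stream and, by
    [smalle], 2/k across; both lie in the range 1/2 of the expansions. *)
Let smallb : 2 / N%:R * (2 * N%:R / k) <= 1 / 2.
Proof.
have -> : 2 / N%:R * (2 * N%:R / k) = 4 / k by field; rewrite !gt_eqF ?natr_gt0.
by rewrite ler_pdivrMr//; move: k24; lra.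
Qed.

Let smalle : 2 / N%:R * (N%:R / k) <= 1 / 2.
Proof.
have -> : 2 / N%:R * (N%:R / k) = 2 / k by field; rewrite !gt_eqF ?natr_gt0.
by rewrite ler_pdivrMr//; move: k24; lra.
Qed.

Let seV_le : (sigma_eta N k)^-1 <= N%:R / k.
Proof. by rewrite sigma_etaV ler_pM2r ?invr_gt0// sqrt_natr_le. Qed.

Lemma weight_step_diff (p : R * R) (cb ce h : R) : `|cb| <= 1 -> `|ce| <= 1 ->
  `|h| <= 2 / N%:R ->
  let r := along P N k xs p in let s := across P N k xs p in
  `|weight (r + cb * h / sigma_beta N k) (s + ce * h / sigma_eta N k) - weight r s|
  <= `|h| * (2 * (Num.sqrt N%:R / k) * weight_at P N k xs p
             + 4 * weight_deriv_at P N k xs p).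
Proof.
move=> cb1 ce1 h1 /=; set r := along _ _ _ _ _; set s := across _ _ _ _ _.
have a1 := increment_small cb1 sb0 sigma_betaV_le h1 smallb.
have t1 := increment_small ce1 se0 seV_le h1 smalle.
apply: le_trans (weight_diff r s a1 t1) _.
have w0 := weight_gt0 r s; have d0 := weight_deriv_gt0 r s.
rewrite -sigma_etaV /weight_deriv_at /weight_at -/r -/s.
have e1 : `|cb * h / sigma_beta N k| <= `|h| / sigma_beta N k.
  rewrite !normrM normfV (gtr0_norm sb0) ler_pM2r ?invr_gt0//.
  by rewrite ler_piMl.
have e2 : `|ce * h / sigma_eta N k| <= `|h| / sigma_eta N k.
  rewrite !normrM normfV (gtr0_norm se0) ler_pM2r ?invr_gt0//.
  by rewrite ler_piMl.
rewrite mulrDr; apply: lerD.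
  rewrite [leRHS](_ : _ = 2 * (`|h| / sigma_eta N k) * weight r s); last by ring.
  by rewrite ler_pM2r// ler_pM2l.
rewrite [leRHS](_ : _ = 4 * (`|h| / sigma_beta N k) * weight_deriv r s); last by ring.
by rewrite ler_pM2r// ler_pM2l.
Qed.

Lemma weight_node1 (K : tri N) : node1 W K = weight
  (along P N k xs (corner P eps K) + b1 P / bnorm P * sx K / sigma_beta N k)
  (across P N k xs (corner P eps K) + - b2 P / bnorm P * sx K / sigma_eta N k).
Proof.
rewrite node1_nodal /weight_at (alongE _ _ _ _ (corner P eps K)).
by rewrite (acrossE _ _ _ _ (corner P eps K)) /= addrAC !subrr add0r !mulr0 !addr0.
Qed.

Lemma weight_node2 (K : tri N) : node2 W K = weight
  (along P N k xs (corner P eps K) + b2 P / bnorm P * sy K / sigma_beta N k)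
  (across P N k xs (corner P eps K) + b1 P / bnorm P * sy K / sigma_eta N k).
Proof.
rewrite node2_nodal /weight_at (alongE _ _ _ _ (corner P eps K)).
rewrite (acrossE _ _ _ _ (corner P eps K)) /= !subrr !mulr0 !add0r.
by rewrite [_ + sy K - _]addrAC subrr add0r.
Qed.

Lemma node1_weight_diff (K : tri N) : `|node1 W K - node0 W K| <=
  `|sx K| * (2 * (Num.sqrt N%:R / k) * node0 W K + 4 * node0 D K).
Proof.
have [u1 [u2 u3]] := unit_coef hP.
rewrite weight_node1 !node0_nodal.
exact: weight_step_diff u1 u3 (step_x_le K).
Qed.

Lemma node2_weight_diff (K : tri N) : `|node2 W K - node0 W K| <=
  `|sy K| * (2 * (Num.sqrt N%:R / k) * node0 W K + 4 * node0 D K).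
Proof.
have [u1 [u2 u3]] := unit_coef hP.
rewrite weight_node2 !node0_nodal.
exact: weight_step_diff u2 u1 (step_y_le K).
Qed.

(** The purely crosswind second-order term is of size h^2 / sigma_eta^2 = h^2 N / k^2, and one
    factor h <= 2/N removes the N; this dictates sigma_eta of order N^(-1/2). All other second-order
    terms carry [weight_deriv_at], with 20/k = 4 (4/k) + 2 (2/k). *)
Lemma weight_step_taylor (p : R * R) (cb ce h : R) : `|cb| <= 1 -> `|ce| <= 1 ->
  h != 0 -> `|h| <= 2 / N%:R ->
  let r := along P N k xs p in let s := across P N k xs p in
  `|(weight (r + cb * h / sigma_beta N k) (s + ce * h / sigma_eta N k) - weight r s) / h
    - (cb * weight_deriv_at P N k xs p + ce * ((1 + expR r) * ((expR s - expR (- s)) / 8)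
        / sigma_eta N k))|
  <= 4 / k ^+ 2 * weight_at P N k xs p + 20 / k * weight_deriv_at P N k xs p.
Proof.
move=> cb1 ce1 h0 h1 /=; set r := along _ _ _ _ _; set s := across _ _ _ _ _.
have N0 := natr_gt0.
have a1 := increment_small cb1 sb0 sigma_betaV_le h1 smallb.
have t1 := increment_small ce1 se0 seV_le h1 smalle.
have := weight_taylor r s a1 t1.
have w0 := weight_gt0 r s; have d0 := weight_deriv_gt0 r s.
set a := cb * h / _; set t := ce * h / _ => T.
have hn0 : 0 < `|h| by rewrite normr_gt0.
rewrite -(ler_pM2r hn0) -normrM.
rewrite [X in `|X| <= _](_ : _ = weight (r + a) (s + t) - weight r s
     - (weight_deriv r s * a + (1 + expR r) * ((expR s - expR (- s)) / 8) * t)); last first.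
  by rewrite /a /t /weight_deriv_at -/r -/s; field; rewrite h0 !gt_eqF.
apply: le_trans T _; rewrite /weight_at /weight_deriv_at -/r -/s.
have e1 : `|a| <= `|h| / sigma_beta N k.
  rewrite !normrM normfV (gtr0_norm sb0) ler_pM2r ?invr_gt0//.
  by rewrite ler_piMl.
have e2 : `|t| <= `|h| / sigma_eta N k.
  rewrite !normrM normfV (gtr0_norm se0) ler_pM2r ?invr_gt0//.
  by rewrite ler_piMl.
have t2 : `|t| <= 2 / k.
  apply: le_trans e2 _; apply: (@le_trans _ _ (2 / N%:R * (N%:R / k))).
    by apply: ler_pM => //; rewrite invr_ge0 ltW.
  by rewrite le_eqVlt; apply/orP; left; apply/eqP; field; rewrite !gt_eqF.
have a2 : `|a| <= 4 / k.
  apply: le_trans e1 _; apply: (@le_trans _ _ (2 / N%:R * (2 * N%:R / k))).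
    by apply: ler_pM => //; [rewrite invr_ge0 ltW|exact: sigma_betaV_le].
  by rewrite le_eqVlt; apply/orP; left; apply/eqP; field; rewrite !gt_eqF.
have tt : t ^+ 2 <= 2 / k ^+ 2 * `|h|.
  rewrite -real_normK ?num_real//.
  apply: (@le_trans _ _ ((`|h| / sigma_eta N k) ^+ 2)).
    by rewrite ler_pXn2r ?nnegrE// mulr_ge0// invr_ge0 ltW.
  rewrite sigma_etaV.
  have sN : Num.sqrt N%:R ^+ 2 = N%:R :> R by rewrite sqr_sqrtr// ltW.
  rewrite !exprMn exprVn sN expr2.
  rewrite [leLHS](_ : _ = (`|h| * N%:R) * (`|h| / k ^+ 2)); last by ring.
  rewrite [leRHS](_ : _ = 2 * (`|h| / k ^+ 2)); last by ring.
  rewrite ler_pM2r ?divr_gt0 ?exprn_gt0//.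
  by rewrite -ler_pdivlMr.
set d := weight_deriv r s in d0 *; set w := weight r s in w0 *.
have -> : (4 / k ^+ 2 * w + 20 / k * (d / sigma_beta N k)) * `|h|
  = 2 * (2 / k ^+ 2 * `|h|) * w + d * (20 / k * (`|h| / sigma_beta N k)) by ring.
apply: lerD; first by rewrite ler_pM2r// ler_pM2l.
rewrite ler_pM2l//.
have -> : a ^+ 2 = `|a| * `|a| by rewrite -expr2 real_normK ?num_real.
have -> : 4 * (`|a| * `|a|) + 2 * `|a| * `|t| = (4 * `|a| + 2 * `|t|) * `|a| by ring.
apply: ler_pM => //.
by move: a2 t2; rewrite (_ : 20 / k = 4 * (4 / k) + 2 * (2 / k)); [lra|ring].
Qed.

Lemma grad_b_weight (K : tri N) : grad_b P eps K W >= bnorm P * node0 D K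
  - (b1 P + b2 P) * (4 / k ^+ 2 * node0 W K + 20 / k * node0 D K).
Proof.
have [u1 [u2 u3]] := unit_coef hP.
have b0 := bnorm_gt0 hP; have bs := bnorm_sqr P.
have [[b10 b20 _] _] := hP.
rewrite /grad_b /grad_x /grad_y weight_node1 weight_node2 !node0_nodal.
have h1 := weight_step_taylor (corner P eps K) u1 u3 (step_x_neq0 hP adm K) (step_x_le K).
have h2 := weight_step_taylor (corner P eps K) u2 u1 (step_y_neq0 hP adm K) (step_y_le K).
rewrite /= in h1 h2; move: h1 h2; rewrite /weight_at.
set A1 := (_ - _) / _; set A2 := (_ - _) / sy K.
set err := 4 / _ * _ + _; set z := (1 + _) * _ / _; set d := weight_deriv_at _ _ _ _ _.
rewrite !ler_norml => /andP[h1 _] /andP[h2 _].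
(* The vector b is orthogonal to the crosswind direction, so the first-order crosswind slope [z]
   cancels in the combination with b1 and b2. *)
have -> : bnorm P * d = b1 P * (b1 P / bnorm P * d + - b2 P / bnorm P * z)
    + b2 P * (b2 P / bnorm P * d + b1 P / bnorm P * z).
  have -> : bnorm P * d = bnorm P ^+ 2 / bnorm P * d by field; rewrite gt_eqF.
  by rewrite bs; field; rewrite gt_eqF.
set B1 := _ + - b2 P / _ * _ in h1 *; set B2 := b2 P / _ * _ + _ in h2 *.
have g1 : b1 P * (B1 - err) <= b1 P * A1 by rewrite ler_pM2l//; lra.
have g2 : b2 P * (B2 - err) <= b2 P * A2 by rewrite ler_pM2l//; lra.
by rewrite mulrDl; move: g1 g2; rewrite !mulrBr; lra.
Qed.

Lemma node0_deriv_le (K : tri N) : node0 D K <= node0 W K * (N%:R / (k * ln N%:R)).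
Proof. by rewrite !node0_nodal -sigma_betaV; exact: weight_deriv_at_le. Qed.

Lemma node0_weight_gt0 (K : tri N) : 0 < node0 W K.
Proof. by rewrite node0_nodal weight_gt0. Qed.

Lemma node0_deriv_gt0 (K : tri N) : 0 < node0 D K.
Proof. by rewrite node0_nodal weight_deriv_at_gt0. Qed.

Lemma weight_at_near (p q : R * R) :
  (`|q.1 - p.1| + `|q.2 - p.2|) * (3 * N%:R / k) <= 1 / 2 ->
  weight_at P N k xs q <= 2 * weight_at P N k xs p /\
  weight_deriv_at P N k xs q <= 2 * weight_deriv_at P N k xs p.
Proof.
move=> h; have [h1 h2] := weight_at_quasi xs hP N2 k0 p q.
have e2 : expR ((`|q.1 - p.1| + `|q.2 - p.2|) * ((sigma_beta N k)^-1 + (sigma_eta N k)^-1)) <= 2.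
  apply: expR_half_le2; apply: le_trans h.
  rewrite ler_wpM2l ?addr_ge0//.
  have -> : 3 * N%:R / k = 2 * N%:R / k + N%:R / k by ring.
  by rewrite lerD ?sigma_betaV_le.
split; [apply: le_trans h1 _|apply: le_trans h2 _]; rewrite ler_pM2r//.
  exact: weight_gt0.
exact: weight_deriv_at_gt0.
Qed.

Lemma triangle_dist (K : tri N) p q : triangle P eps K p -> triangle P eps K q ->
  `|q.1 - p.1| + `|q.2 - p.2| <= 4 / N%:R.
Proof.
have aux (x y o s : R) : s != 0 -> 0 <= (x - o) / s <= 1 -> 0 <= (y - o) / s <= 1 ->
    `|y - x| <= `|s|.
  move=> s0 /andP[x0 x1] /andP[y0 y1].
  have -> : y - x = ((y - o) / s - (x - o) / s) * s by field.
  by rewrite normrM ler_piMl// ler_norml; apply/andP; split; lra.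
rewrite (triangleE hP)// => /right_triangle_coord[p1 p2] /right_triangle_coord[q1 q2].
have h1 := aux _ _ _ _ (step_x_neq0 hP adm K) p1 q1.
have h2 := aux _ _ _ _ (step_y_neq0 hP adm K) p2 q2.
have := step_x_le K; have := step_y_le K.
have -> : 4 / N%:R = 2 / N%:R + 2 / N%:R :> R by ring.
by move=> *; lra.
Qed.

(** Two points of a triangle are within 4/N in the l1 distance, which makes the exponent at most
    12/k; 24 <= k brings it to 1/2, whence the factor 2. *)
Lemma weight_at_triangle (K : tri N) p q : triangle P eps K p -> triangle P eps K q ->
  weight_at P N k xs q <= 2 * weight_at P N k xs p /\
  weight_deriv_at P N k xs q <= 2 * weight_deriv_at P N k xs p.
Proof.
move=> Kp Kq; apply: weight_at_near.
apply: (@le_trans _ _ (4 / N%:R * (3 * N%:R / k))).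
  by rewrite ler_pM2r ?divr_gt0 ?mulr_gt0 ?natr_gt0// (triangle_dist Kp Kq).
have -> : 4 / N%:R * (3 * N%:R / k) = 12 / k by field; rewrite !gt_eqF ?natr_gt0.
by rewrite ler_pdivrMr//; move: k24; lra.
Qed.

Lemma triangle_vertices (K : tri N) : [/\ triangle P eps K (corner P eps K),
  triangle P eps K ((corner P eps K).1 + sx K, (corner P eps K).2) &
  triangle P eps K ((corner P eps K).1, (corner P eps K).2 + sy K)].
Proof.
have sx0 := step_x_neq0 hP adm K; have sy0 := step_y_neq0 hP adm K.
rewrite (triangleE hP)// /right_triangle /=; split; rewrite ?subrr ?mul0r ?addr0 ?add0r//.
  by rewrite addrAC subrr add0r mulfV// !addr0; split.
by rewrite addrAC subrr add0r mulfV// !add0r; split.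
Qed.

Lemma node_weight_le (K : tri N) :
  [/\ 0 < node1 W K, node1 W K <= 2 * node0 W K, 0 < node2 W K & node2 W K <= 2 * node0 W K].
Proof.
have [v0 v1 v2] := triangle_vertices K.
rewrite node0_nodal node1_nodal node2_nodal.
have [h1 _] := weight_at_triangle v0 v1; have [h2 _] := weight_at_triangle v0 v2.
by split=> //; exact: weight_gt0.
Qed.

End mesh_weight.

(** * Algebraic estimates on one triangle *)

Section local_estimates.
Context (R : realType).

Lemma young_weighted (w x y : R) : 0 < w -> - (w / 4 * x ^+ 2 + y ^+ 2 / w) <= x * y.
Proof.
move=> w0; rewrite -subr_ge0.
have -> : x * y - - (w / 4 * x ^+ 2 + y ^+ 2 / w) = (w * x / 2 + y) ^+ 2 / w.
  by field; rewrite gt_eqF.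
by rewrite divr_ge0 ?sqr_ge0 ?ltW.
Qed.

Lemma sqr_le_of_norm (x y : R) : `|x| <= y -> x ^+ 2 <= y ^+ 2.
Proof.
move=> xy; rewrite -real_normK ?num_real// ler_pXn2r// nnegrE//.
exact: le_trans xy.
Qed.

(** The numbers 1/12 and 1/3 are the extreme eigenvalues of the mass matrix. *)
Lemma vert_form_bounds (G0 G1 G2 : R) : let S := G0 ^+ 2 + G1 ^+ 2 + G2 ^+ 2 in
  S / 12 <= vert_form G0 G1 G2 G0 G1 G2 /\ vert_form G0 G1 G2 G0 G1 G2 <= S / 3.
Proof.
rewrite /vert_form /=.
have q1 := sqr_ge0 (G0 - G1); have q2 := sqr_ge0 (G0 - G2); have q3 := sqr_ge0 (G1 - G2).
have q4 := sqr_ge0 (G0 + G1 + G2).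
by split; lra.
Qed.

(** Here [w], [W1], [W2] are the values of the weight at the three vertices, [w] at the right angle,
    and [a] bounds its difference quotients; [Ix] and [Iy] are the slopes of the interpolant of
    weight times function. *)
Variables (w a W1 W2 G0 G1 G2 sx sy : R).
Hypotheses (w0 : 0 < w) (sx0 : sx != 0) (sy0 : sy != 0).
Let S := G0 ^+ 2 + G1 ^+ 2 + G2 ^+ 2.
Let gx := (G1 - G0) / sx.
Let gy := (G2 - G0) / sy.
Let Ix := (W1 * G1 - w * G0) / sx.
Let Iy := (W2 * G2 - w * G0) / sy.
Hypotheses (h1 : `|W1 - w| <= `|sx| * a) (h2 : `|W2 - w| <= `|sy| * a).

Let al1 := (W1 - w) / sx.
Let al2 := (W2 - w) / sy.

Let S_ge0 : 0 <= S. Proof. by rewrite !addr_ge0 ?sqr_ge0. Qed.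

Let al1_le : al1 ^+ 2 <= a ^+ 2.
Proof.
apply: sqr_le_of_norm; rewrite normrM normfV ler_pdivrMr ?normr_gt0//.
by rewrite mulrC.
Qed.

Let al2_le : al2 ^+ 2 <= a ^+ 2.
Proof.
apply: sqr_le_of_norm; rewrite normrM normfV ler_pdivrMr ?normr_gt0//.
by rewrite mulrC.
Qed.

(** Discrete product rule: the weight is taken at the right angle, the function at the far
    vertex. *)
Let IxE : Ix = w * gx + G1 * al1.
Proof. by rewrite /Ix /gx /al1; field. Qed.

Let IyE : Iy = w * gy + G2 * al2.
Proof. by rewrite /Iy /gy /al2; field. Qed.

Lemma local_diffusion :
  3 / 4 * w * (gx ^+ 2 + gy ^+ 2) - a ^+ 2 / w * S <= Ix * gx + Iy * gy.
Proof.
rewrite IxE IyE; move: al1_le al2_le; move: (al1) (al2) (gx) (gy) => u v g g' u2 v2.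
have y1 := young_weighted g (G1 * u) w0.
have y2 := young_weighted g' (G2 * v) w0.
have b1 : (G1 * u) ^+ 2 / w + (G2 * v) ^+ 2 / w <= a ^+ 2 / w * S.
  rewrite -mulrDl mulrAC ler_pM2r ?invr_gt0// !exprMn.
  have l1 : G1 ^+ 2 * u ^+ 2 <= G1 ^+ 2 * a ^+ 2 by rewrite ler_wpM2l ?sqr_ge0.
  have l2 : G2 ^+ 2 * v ^+ 2 <= G2 ^+ 2 * a ^+ 2 by rewrite ler_wpM2l ?sqr_ge0.
  have l3 : 0 <= G0 ^+ 2 * a ^+ 2 by rewrite mulr_ge0 ?sqr_ge0.
  rewrite /S; lra.
lra.
Qed.

Lemma local_convection_sq (b1 b2 : R) :
  (b1 * (G1 * al1) + b2 * (G2 * al2)) ^+ 2 <= (b1 ^+ 2 + b2 ^+ 2) * a ^+ 2 * S.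
Proof.
move: al1_le al2_le; move: (al1) (al2) => u v u2 v2.
apply: (@le_trans _ _ ((b1 ^+ 2 + b2 ^+ 2) * ((G1 * u) ^+ 2 + (G2 * v) ^+ 2))).
  have := sqr_ge0 (b1 * (G2 * v) - b2 * (G1 * u)); lra.
rewrite -mulrA ler_wpM2l ?addr_ge0 ?sqr_ge0// !exprMn.
have l1 : G1 ^+ 2 * u ^+ 2 <= G1 ^+ 2 * a ^+ 2 by rewrite ler_wpM2l ?sqr_ge0.
have l2 : G2 ^+ 2 * v ^+ 2 <= G2 ^+ 2 * a ^+ 2 by rewrite ler_wpM2l ?sqr_ge0.
have l3 : 0 <= G0 ^+ 2 * a ^+ 2 by rewrite mulr_ge0 ?sqr_ge0.
rewrite /S; lra.
Qed.

(** Each of two cross terms, the product-rule error and the reaction, costs a quarter of w (b.grad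
    G)^2. The 4/3 comes from the squared average, at most a third of the sum of squares, with [W1]
    and [W2] at most 2 w. *)
Lemma local_stabilization (b1 b2 c : R) : 0 < W1 -> 0 < W2 -> W1 <= 2 * w -> W2 <= 2 * w ->
  let bg := b1 * gx + b2 * gy in
  1 / 2 * w * bg ^+ 2 - (b1 ^+ 2 + b2 ^+ 2) * (a ^+ 2 / w * S) - 4 / 3 * c ^+ 2 * w * S <=
  ((b1 * Ix + b2 * Iy) + c * ((w * G0 + W1 * G1 + W2 * G2) / 3)) * bg.
Proof.
move=> W1p W2p W1w W2w /=; set bg := b1 * gx + b2 * gy.
set av := (_ + _ + _) / 3.
have [z zE] : exists z, z = b1 * (G1 * al1) + b2 * (G2 * al2) by eexists.
have -> : b1 * Ix + b2 * Iy = w * bg + z by rewrite IxE IyE zE /bg; ring.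
have y1 := young_weighted bg z w0.
have y2 := young_weighted bg (c * av) w0.
have zs : z ^+ 2 / w <= (b1 ^+ 2 + b2 ^+ 2) * (a ^+ 2 / w * S).
  have -> : (b1 ^+ 2 + b2 ^+ 2) * (a ^+ 2 / w * S) = (b1 ^+ 2 + b2 ^+ 2) * a ^+ 2 * S / w by ring.
  by rewrite ler_pM2r ?invr_gt0// zE; exact: local_convection_sq.
have as_ : av ^+ 2 <= 4 / 3 * w ^+ 2 * S.
  have e0 : (w * G0) ^+ 2 <= 4 * w ^+ 2 * G0 ^+ 2.
    by rewrite exprMn ler_wpM2r ?sqr_ge0//; have := sqr_ge0 w; lra.
  have e1 : (W1 * G1) ^+ 2 <= 4 * w ^+ 2 * G1 ^+ 2.
    by rewrite exprMn ler_wpM2r ?sqr_ge0//; nra.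
  have e2 : (W2 * G2) ^+ 2 <= 4 * w ^+ 2 * G2 ^+ 2.
    by rewrite exprMn ler_wpM2r ?sqr_ge0//; nra.
  have q1 := sqr_ge0 (w * G0 - W1 * G1); have q2 := sqr_ge0 (w * G0 - W2 * G2).
  have q3 := sqr_ge0 (W1 * G1 - W2 * G2).
  rewrite /av /S; lra.
have cs : (c * av) ^+ 2 / w <= 4 / 3 * c ^+ 2 * w * S.
  rewrite ler_pdivrMr// exprMn.
  have -> : 4 / 3 * c ^+ 2 * w * S * w = c ^+ 2 * (4 / 3 * w ^+ 2 * S) by ring.
  by rewrite ler_wpM2l ?sqr_ge0.
lra.
Qed.

(** The form is w times the mass of the function plus a part linear in W1 - w and W2 - w, and the
    latter is at most 4 mu w S / 12. *)
Lemma local_reaction (mu : R) : `|W1 - w| <= mu * w -> `|W2 - w| <= mu * w ->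
  w * S / 12 - mu / 3 * w * S <= vert_form (w * G0) (W1 * G1) (W2 * G2) G0 G1 G2.
Proof.
move=> m1 m2.
have [f1 _] := vert_form_bounds G0 G1 G2; rewrite -/S in f1.
have -> : vert_form (w * G0) (W1 * G1) (W2 * G2) G0 G1 G2 = w * vert_form G0 G1 G2 G0 G1 G2
  + ((W1 - w) * (G1 * (G0 + 2 * G1 + G2)) + (W2 - w) * (G2 * (G0 + G1 + 2 * G2))) / 12.
  by rewrite /vert_form; ring.
have wf : w * S / 12 <= w * vert_form G0 G1 G2 G0 G1 G2.
  by rewrite -mulrA ler_pM2l.
have p1 (x y : R) : `|x| <= mu * w -> - (mu * w * `|y|) <= x * y.
  move=> hx; have : `|x * y| <= mu * w * `|y| by rewrite normrM ler_wpM2r.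
  by rewrite ler_norml => /andP[].
have q1 := p1 _ (G1 * (G0 + 2 * G1 + G2)) m1.
have q2 := p1 _ (G2 * (G0 + G1 + 2 * G2)) m2.
have mw : 0 <= mu * w := le_trans (normr_ge0 _) m1.
have T : `|G1 * (G0 + 2 * G1 + G2)| + `|G2 * (G0 + G1 + 2 * G2)| <= 4 * S.
  rewrite /S; have e1 := sqr_ge0 (G0 - G1); have e2 := sqr_ge0 (G0 - G2).
  have e3 := sqr_ge0 (G1 - G2); have e4 := sqr_ge0 (G0 + G1); have e5 := sqr_ge0 (G0 + G2).
  have e6 := sqr_ge0 (G1 + G2); have s0 := sqr_ge0 G0; have s1 := sqr_ge0 G1.
  have s2 := sqr_ge0 G2.
  have [p|p] := leP 0 (G1 * (G0 + 2 * G1 + G2));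
    have [p'|p'] := leP 0 (G2 * (G0 + G1 + 2 * G2));
    rewrite ?(ger0_norm p) ?(ger0_norm p') ?(ltr0_norm p) ?(ltr0_norm p'); lra.
have : mu * w * (`|G1 * (G0 + 2 * G1 + G2)| + `|G2 * (G0 + G1 + 2 * G2)|) <= mu * w * (4 * S).
  by rewrite ler_wpM2l.
lra.
Qed.

(** The two averages of weight times function agree when the weight is constant, so their difference
    sees only W1 - w and W2 - w. *)
Lemma local_quadrature (h : R) : `|sx| <= h -> `|sy| <= h ->
  (vert_form w W1 W2 G0 G1 G2 - (w * G0 + W1 * G1 + W2 * G2) / 3) ^+ 2
  <= 4 / 3 * (h * a) ^+ 2 * S.
Proof.
move=> hx hy.
have a0 : 0 <= a.
  have : 0 <= `|sx| * a := le_trans (normr_ge0 _) h1.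
  by rewrite pmulr_rge0// normr_gt0.
have H1 : `|W1 - w| <= h * a by apply: le_trans h1 _; rewrite ler_wpM2r.
have H2 : `|W2 - w| <= h * a by apply: le_trans h2 _; rewrite ler_wpM2r.
have s1 := sqr_le_of_norm H1; have s2 := sqr_le_of_norm H2.
have [x xE] : exists x, x = W1 - w by eexists.
have [y yE] : exists y, y = W2 - w by eexists.
rewrite -xE in s1; rewrite -yE in s2.
have -> : vert_form w W1 W2 G0 G1 G2 - (w * G0 + W1 * G1 + W2 * G2) / 3 =
  (x * (G0 - 2 * G1 + G2) + y * (G0 + G1 - 2 * G2)) / 12.
  by rewrite xE yE /vert_form; field.
set H := h * a in s1 s2 *.
have u1 : (x * (G0 - 2 * G1 + G2)) ^+ 2 <= H ^+ 2 * (G0 - 2 * G1 + G2) ^+ 2.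
  by rewrite exprMn ler_wpM2r ?sqr_ge0.
have u2 : (y * (G0 + G1 - 2 * G2)) ^+ 2 <= H ^+ 2 * (G0 + G1 - 2 * G2) ^+ 2.
  by rewrite exprMn ler_wpM2r ?sqr_ge0.
have v1 : (G0 - 2 * G1 + G2) ^+ 2 + (G0 + G1 - 2 * G2) ^+ 2 <= 12 * S.
  rewrite /S.
  have e1 := sqr_ge0 (G0 + 2 * G1 + G2); have e2 := sqr_ge0 (G0 + G1 + 2 * G2).
  have e3 := sqr_ge0 (G0 - G2); have e4 := sqr_ge0 (G0 - G1); have s0 := sqr_ge0 G0.
  have s1' := sqr_ge0 G1; have s2' := sqr_ge0 G2.
  have e5 := sqr_ge0 (G1 + G2); have e6 := sqr_ge0 (G0 + G1); have e7 := sqr_ge0 (G0 + G2).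
  lra.
have v2 : H ^+ 2 * ((G0 - 2 * G1 + G2) ^+ 2 + (G0 + G1 - 2 * G2) ^+ 2) <= H ^+ 2 * (12 * S).
  by rewrite ler_wpM2l ?sqr_ge0.
have q := sqr_ge0 (x * (G0 - 2 * G1 + G2) - y * (G0 + G1 - 2 * G2)).
have HS : 0 <= H ^+ 2 * S by rewrite mulr_ge0 ?sqr_ge0.
lra.
Qed.

End local_estimates.

(** * Summation by parts on the mesh *)

Section summation_by_parts.
Context (R : realType) (P : sd_data R) (N : nat) (eps : R).
Hypotheses (hP : sd_data_pos P) (adm : admissible P N eps).
Implicit Types (U V W : nat -> nat -> R).
Local Notation area := (area P eps).
Local Notation grad_x := (grad_x P eps).
Local Notation grad_y := (grad_y P eps).
Local Notation grad_b := (grad_b P eps).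
Local Notation hx := (hx P N eps).
Local Notation hy := (hy P N eps).

Definition boundary_zero V : Prop :=
  (forall j, V 0 j = 0 /\ V N j = 0) /\ (forall i, V i 0 = 0 /\ V i N = 0).

Lemma sum_tri (F : tri N -> R) :
  \sum_(K : tri N) F K =
  \sum_(i < N) \sum_(j < N) (F (i, j, false) + F (i, j, true)).
Proof.
transitivity (\sum_(q : ('I_N * 'I_N) * bool) F (q.1, q.2)).
  by apply: eq_bigr => -[].
rewrite -(pair_bigA _ (fun p t => F (p, t))) /=.
transitivity (\sum_(p : 'I_N * 'I_N) (F (p.1, p.2, false) + F (p.1, p.2, true))).
  by apply: eq_bigr => -[i j] _; rewrite big_bool addrC.
by rewrite -(pair_bigA _ (fun i j => F (i, j, false) + F (i, j, true))).
Qed.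

(** The integral over an edge of unit length of the product of three affine functions with these end
    values. *)
Let edge (u0 u1 v0 v1 w0 w1 : R) : R :=
  (3 * u0 * v0 * w0 + 3 * u1 * v1 * w1 + u0 * v0 * w1 + u0 * v1 * w0 + u1 * v0 * w0
   + u1 * v1 * w0 + u1 * v0 * w1 + u0 * v1 * w1) / 12.

(** The two triangles of a cell together give the difference of the fluxes [e] through its right and
    left sides: the diagonal is shared and the horizontal sides have no normal component along x.
    Each row then telescopes. *)
Lemma sum_grad_x_product U V W : boundary_zero V ->
  \sum_(K : tri N) area K * (grad_x K U * node_form K V W + grad_x K V * node_form K U W
    + grad_x K W * node_form K U V) = 0.
Proof.
move=> [Vl Vr]; rewrite sum_tri exchange_big /=; apply: big1 => j _.
pose e (i : nat) := hy j * edge (U i j) (U i j.+1) (V i j) (V i j.+1) (W i j) (W i j.+1).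
transitivity (\sum_(0 <= i < N) (e i.+1 - e i)).
  rewrite big_mkord; apply: eq_bigr => i _.
  have h0 := hx_gt0 hP adm (ltn_ord i).
  rewrite /e /edge /area /grad_x /node_form /vert_form /=.
  by field; rewrite gt_eqF.
rewrite telescope_sumr// /e /edge !(Vl _).1 !(Vl _).2.
by rewrite !(mulr0, mul0r, addr0, subr0).
Qed.

Lemma sum_grad_y_product U V W : boundary_zero V ->
  \sum_(K : tri N) area K * (grad_y K U * node_form K V W + grad_y K V * node_form K U W
    + grad_y K W * node_form K U V) = 0.
Proof.
move=> [Vl Vr]; rewrite sum_tri; apply: big1 => i _.
pose e (j : nat) := hx i * edge (U i j) (U i.+1 j) (V i j) (V i.+1 j) (W i j) (W i.+1 j).
transitivity (\sum_(0 <= j < N) (e j.+1 - e j)).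
  rewrite big_mkord; apply: eq_bigr => j _.
  have h0 := hy_gt0 hP adm (ltn_ord j).
  rewrite /e /edge /area /grad_y /node_form /vert_form /=.
  by field; rewrite gt_eqF.
rewrite telescope_sumr// /e /edge !(Vr _).1 !(Vr _).2.
by rewrite !(mulr0, mul0r, addr0, subr0).
Qed.

(* The divergence theorem for the cubic [U V W]: the edge contributions
   telescope, and vanish on the boundary with [V]. *)
Lemma sum_grad_b_product U V W : boundary_zero V ->
  \sum_(K : tri N) area K * (grad_b K U * node_form K V W + grad_b K V * node_form K U W
    + grad_b K W * node_form K U V) = 0.
Proof.
move=> V0.
transitivity (b1 P * 0 + b2 P * 0); last by rewrite !mulr0 addr0.
rewrite -[in X in b1 P * X](sum_grad_x_product U W V0).
rewrite -[in X in b2 P * X](sum_grad_y_product U W V0).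
rewrite !mulr_sumr -big_split /=; apply: eq_bigr => K _.
by rewrite /grad_b; ring.
Qed.

(** The cubic identity with one factor equal to 1. *)
Lemma sum_grad_b_antisym V W : boundary_zero V ->
  \sum_(K : tri N) area K * (grad_b K W * node_avg K V)
  = - \sum_(K : tri N) area K * (grad_b K V * node_avg K W).
Proof.
move=> V0; apply/eqP; rewrite -subr_eq0 opprK -big_split /=; apply/eqP.
rewrite -[RHS](sum_grad_b_product (fun _ _ => 1) W V0); apply: eq_bigr => K _.
have -> : grad_b K (fun _ _ => 1) = 0.
  by case: K => [[i j] t]; rewrite /grad_b /grad_x /grad_y /= !subrr !mul0r !mulr0 addr0.
have f1 X : node_form K (fun _ _ => 1) X = node_avg K X.
  by case: K => [[i j] t]; rewrite /node_form /vert_form /node_avg /=; field.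
by rewrite !f1; ring.
Qed.

(** The cubic identity with [V] taken twice: the discrete counterpart of integrating W V b.grad V by
    parts, exact with the interpolated weight. *)
Lemma sum_weighted_square V W : boundary_zero V ->
  \sum_(K : tri N) area K * (grad_b K V * node_form K W V)
  = - \sum_(K : tri N) area K * (1 / 2 * grad_b K W * node_form K V V).
Proof.
move=> V0; apply/eqP; rewrite -subr_eq0 opprK -big_split /=; apply/eqP.
transitivity (1 / 2 * 0 : R); last by rewrite mulr0.
rewrite -[in X in 1 / 2 * X](sum_grad_b_product W V V0) mulr_sumr; apply: eq_bigr => K _.
by field.
Qed.

End summation_by_parts.

(** * A weighted Poincare inequality across the layers *)

Section layer_rows.
Context (R : realType) (N : nat).

Lemma sqr_sum_le (n : nat) (x : nat -> R) :
  (\sum_(0 <= i < n) x i) ^+ 2 <= n%:R * \sum_(0 <= i < n) x i ^+ 2.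
Proof.
elim: n => [|n IH]; first by rewrite !big_geq// expr0n mul0r.
rewrite !big_nat_recr//=.
set s := \sum_(0 <= i < n) x i in IH *; set q := \sum_(0 <= i < n) x i ^+ 2 in IH *.
rewrite -natr1; case: n @s @q IH => [|n] s q IH.
  by rewrite /s /q !big_geq// !add0r mul1r.
have n0 : 0 < n.+1%:R :> R by rewrite ltr0n.
have : 2 * s * x n.+1 <= n.+1%:R * x n.+1 ^+ 2 + s ^+ 2 / n.+1%:R.
  rewrite -subr_ge0.
  have -> : n.+1%:R * x n.+1 ^+ 2 + s ^+ 2 / n.+1%:R - 2 * s * x n.+1 =
     (n.+1%:R * x n.+1 - s) ^+ 2 / n.+1%:R by field; rewrite gt_eqF.
  by rewrite divr_ge0 ?sqr_ge0 ?ltW.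
have : s ^+ 2 / n.+1%:R <= q by rewrite ler_pdivrMr// mulrC.
move: IH; clear n0; clearbody s q; move: (n.+1%:R : R) => m; lra.
Qed.

(** Telescoping from i to the boundary index N, followed by Cauchy-Schwarz. *)
Lemma sqr_le_sum_steps (a : nat -> R) (n i : nat) : a N = 0 -> (n <= i)%N -> (i <= N)%N ->
  a i ^+ 2 <= N%:R * \sum_(m < N | (n <= m)%N) (a m.+1 - a m) ^+ 2.
Proof.
move=> aN ni iN.
have -> : a i ^+ 2 = (\sum_(0 <= m < N) if (i <= m)%N then a m.+1 - a m else 0) ^+ 2.
  rewrite (big_cat_nat (n := i))//= big_nat big1 ?add0r; last first.
    by move=> m /andP[_ mi]; rewrite leqNgt mi.
  rewrite (eq_big_nat _ _ (F2 := fun m => a m.+1 - a m)); last by move=> m /andP[->].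
  by rewrite telescope_sumr// aN sub0r sqrrN.
apply: le_trans (sqr_sum_le _ _) _; rewrite ler_wpM2l// big_mkord [leRHS]big_mkcond /=.
apply: ler_sum => m _; case: (leqP i m) => im; first by rewrite (leq_trans ni im).
by rewrite expr0n /=; case: ifP => // _; rewrite sqr_ge0.
Qed.

(** [p] and [q] are the values on two neighbouring mesh lines, and the two brackets collect the
    vertices of the lower and upper triangles between them. One factor N is from Cauchy-Schwarz, one
    from summing over the row; 12 is 3 vertices times 2 triangles times the weight ratio 2. *)
Lemma layer_row (n : nat) (w w' : 'I_N -> R) (p q : nat -> R) :
  p N = 0 -> q N = 0 -> (forall i, 0 < w i) -> (forall i, 0 < w' i) ->
  (forall i j : 'I_N, (n <= i)%N -> (n <= j)%N ->
    [/\ w i <= 2 * w j, w i <= 2 * w' j, w' i <= 2 * w j & w' i <= 2 * w' j]) ->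
  \sum_(i < N | (n <= i)%N) (w i * (p i ^+ 2 + p i.+1 ^+ 2 + q i ^+ 2)
      + w' i * (q i.+1 ^+ 2 + q i ^+ 2 + p i.+1 ^+ 2)) <=
  12 * N%:R ^+ 2 * \sum_(i < N | (n <= i)%N)
     (w i * (p i.+1 - p i) ^+ 2 + w' i * (q i.+1 - q i) ^+ 2).
Proof.
move=> pN qN w0 w0' ww; set X := \sum_(i < N | _) (_ * _ + _ * _) in |- *.
set Y := (X in 12 * _ * X).
pose T := \sum_(m < N | (n <= m)%N) (p m.+1 - p m) ^+ 2
   + \sum_(m < N | (n <= m)%N) (q m.+1 - q m) ^+ 2.
have N0 : 0 <= N%:R :> R by [].
have Tp : 0 <= \sum_(m < N | (n <= m)%N) (p m.+1 - p m) ^+ 2.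
  by apply: sumr_ge0 => m _; exact: sqr_ge0.
have Tq : 0 <= \sum_(m < N | (n <= m)%N) (q m.+1 - q m) ^+ 2.
  by apply: sumr_ge0 => m _; exact: sqr_ge0.
have pT i : (n <= i)%N -> (i <= N)%N -> p i ^+ 2 <= N%:R * T.
  move=> ni iN; apply: le_trans (sqr_le_sum_steps pN ni iN) _.
  by rewrite ler_wpM2l// lerDl.
have qT i : (n <= i)%N -> (i <= N)%N -> q i ^+ 2 <= N%:R * T.
  move=> ni iN; apply: le_trans (sqr_le_sum_steps qN ni iN) _.
  by rewrite ler_wpM2l// lerDr.
have wT (v : R) : 0 < v -> (forall j : 'I_N, (n <= j)%N -> v <= 2 * w j /\ v <= 2 * w' j) ->
    v * T <= 2 * Y.
  move=> v0 vw; rewrite /T mulrDr !mulr_sumr -big_split /=.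
  apply: ler_sum => j nj; have [h1 h2] := vw j nj.
  rewrite mulrDr (mulrA 2 (w j)) (mulrA 2 (w' j)).
  by apply: lerD; rewrite ler_wpM2r ?sqr_ge0.
have Y0 : 0 <= Y.
  by apply: sumr_ge0 => i _; rewrite addr_ge0// mulr_ge0 ?sqr_ge0 ?ltW.
apply: (@le_trans _ _ (\sum_(i < N | (n <= i)%N) (12 * N%:R * Y))).
  apply: ler_sum => i ni.
  have h1 : w i * T <= 2 * Y by apply: wT => // j nj; have [] := ww i j ni nj.
  have h2 : w' i * T <= 2 * Y by apply: wT => // j nj; have [] := ww i j ni nj.
  have ni' := leq_trans ni (leqnSn i).
  have p0 := pT i ni (ltnW (ltn_ord i)); have p1 := pT i.+1 ni' (ltn_ord i).
  have q0 := qT i ni (ltnW (ltn_ord i)); have q1 := qT i.+1 ni' (ltn_ord i).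
  apply: (@le_trans _ _ (w i * (3 * (N%:R * T)) + w' i * (3 * (N%:R * T)))).
    by apply: lerD; rewrite ler_pM2l//; lra.
  have : 3 * N%:R * (w i * T + w' i * T) <= 3 * N%:R * (2 * Y + 2 * Y).
    by rewrite ler_wpM2l ?mulr_ge0//; lra.
  lra.
rewrite big_mkcond /=; apply: (@le_trans _ _ (\sum_(i < N) (12 * N%:R * Y))).
  by apply: ler_sum => i _; case: ifP => // _; rewrite !mulr_ge0.
by rewrite sumr_const card_ord -mulr_natl expr2; lra.
Qed.

End layer_rows.

Lemma shifted_index_layer (n N i : nat) (t : bool) : (n <= i)%N -> (i < N)%N ->
  (n <= t + i <= N)%N.
Proof.
case: t => ni iN; apply/andP; split; [exact: leqW|exact: iN|exact: ni|exact: ltnW].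
Qed.

Lemma shifted_index_cell (i : nat) (t : bool) : (i <= t + i <= i.+1)%N.
Proof. by case: t; apply/andP; split; [exact: leqnSn|exact: leqnn|exact: leqnn|exact: leqnSn]. Qed.

Section layer_bound.
Context (R : realType) (P : sd_data R) (N : nat) (eps k : R) (xs : R * R).
Hypotheses (hP : sd_data_pos P) (adm : admissible P N eps) (k24 : 24 <= k).
Hypotheses (kb1 : 30 / beta1 P <= k) (kb2 : 30 / beta2 P <= k).
Local Notation W := (nodal P N eps (weight_at P N k xs)).
Local Notation area := (area P eps).
Local Notation grad_x := (grad_x P eps).
Local Notation grad_y := (grad_y P eps).
Local Notation hx := (hx P N eps).
Local Notation hy := (hy P N eps).

Definition node_sqr (V : nat -> nat -> R) (K : tri N) : R :=
  node0 V K ^+ 2 + node1 V K ^+ 2 + node2 V K ^+ 2.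
Definition layer_x (K : tri N) : bool := let: (i, j, t) := K in (N./2 <= i)%N.
Definition layer_y (K : tri N) : bool := let: (i, j, t) := K in (N./2 <= j)%N.

Let N2 := admissible_ge2 adm.
Let evN := admissible_even adm.
Let k0 : 0 < k. Proof. by move: k24; lra. Qed.
Let N0 := natr_gt0 adm.

(** The logarithm of the layer width cancels that of sigma_beta, and epsilon N <= 1 does the rest;
    across the stream, epsilon ln N sqrt N <= 2 epsilon N. The 30 is 4 times 3 times 5/2, so that
    the layer takes up at most 1/4 of the exponent and the cell the other 1/4. *)
Lemma layer_width_small (be lam : R) : 0 < be -> 30 / be <= k ->
  lam = 5 / 2 * eps * be^-1 * ln N%:R ->
  (lam + 2 / N%:R) * ((sigma_beta N k)^-1 + (sigma_eta N k)^-1) <= 1 / 2.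
Proof.
move=> be0 kb ->.
have L0 := ln_natr_ge R N2; have L1 := ln_natr_le_sqrt R N2.
have e0 := admissible_eps_gt0 adm; have e1 := admissible_eps_le adm.
have b1 : 2 / N%:R * ((sigma_beta N k)^-1 + (sigma_eta N k)^-1) <= 1 / 4.
  apply: (@le_trans _ _ (2 / N%:R * (3 * N%:R / k))).
    rewrite ler_pM2l ?divr_gt0//.
    have -> : 3 * N%:R / k = 2 * N%:R / k + N%:R / k by ring.
    rewrite lerD ?(sigma_betaV_le adm)// (sigma_etaV adm)//.
    by rewrite ler_pM2r ?invr_gt0// (sqrt_natr_le adm).
  have -> : 2 / N%:R * (3 * N%:R / k) = 6 / k by field; rewrite !gt_eqF.
  by rewrite ler_pdivrMr//; move: k24; lra.
have b2 : 5 / 2 * eps * be^-1 * ln N%:R * ((sigma_beta N k)^-1 + (sigma_eta N k)^-1) <= 1 / 4.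
  rewrite (sigma_betaV adm)// (sigma_etaV adm)//.
  set s := Num.sqrt N%:R in L1 *; have s0 : 0 < s by rewrite sqrtr_gt0.
  have sN : s * s = N%:R by rewrite -expr2 sqr_sqrtr// ltW.
  have -> : 5 / 2 * eps * be^-1 * ln N%:R * (N%:R / (k * ln N%:R) + s / k)
    = (5 / 2 / be / k) * (eps * N%:R + eps * (ln N%:R * s)).
    by field; rewrite !gt_eqF//; lra.
  have eN : eps * N%:R <= 1 by rewrite -ler_pdivlMr// div1r.
  have es : eps * (ln N%:R * s) <= 2.
    apply: (@le_trans _ _ (eps * (2 * s * s))).
      by rewrite ler_pM2l// ler_pM2r.
    by rewrite -mulrA sN; lra.
  apply: (@le_trans _ _ (5 / 2 / be / k * 3)).
    by rewrite ler_pM2l ?divr_gt0//; lra.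
  rewrite mulrAC ler_pdivrMr//.
  by move: kb; rewrite (_ : 30 / be = 4 * (5 / 2 / be * 3)); [lra|field; rewrite gt_eqF].
by rewrite mulrDl; lra.
Qed.

Lemma weight_at_close (p q : R * R) (l : R) : `|q.1 - p.1| + `|q.2 - p.2| <= l ->
  l * ((sigma_beta N k)^-1 + (sigma_eta N k)^-1) <= 1 / 2 ->
  weight_at P N k xs q <= 2 * weight_at P N k xs p.
Proof.
move=> pq lk; have [h1 _] := weight_at_quasi xs hP N2 k0 p q.
apply: le_trans h1 _; rewrite ler_pM2r ?weight_gt0//.
apply: expR_half_le2; apply: le_trans lk; rewrite ler_wpM2r//.
by rewrite addr_ge0// invr_ge0 ltW ?sigma_beta_gt0 ?sigma_eta_gt0.
Qed.

Let dist_layer (lam : R) (i i' : nat) : 0 < lam -> lam <= 1 / 2 ->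
  (N./2 <= i <= N)%N -> (N./2 <= i' <= N)%N ->
  `|mesh_pt lam N i' - mesh_pt lam N i| <= lam.
Proof.
move=> l0 l1 /andP[ni iN] /andP[ni' iN'].
have h : mesh_pt lam N N./2 = 1 - lam by exact: mesh_pt_half.
have a := mesh_pt_le N2 evN l0 l1 ni iN; have b := mesh_pt_le N2 evN l0 l1 ni' iN'.
have c := mesh_pt_le N2 evN l0 l1 iN (leqnn N).
have d := mesh_pt_le N2 evN l0 l1 iN' (leqnn N).
have e : mesh_pt lam N N = 1 by exact: mesh_ptN.
by rewrite ler_norml; move: a b c d; rewrite h e => *; apply/andP; split; lra.
Qed.

Let dist_cell (lam : R) (i i' : nat) (j : 'I_N) : 0 < lam -> lam <= 1 / 2 ->
  (j <= i <= j.+1)%N -> (j <= i' <= j.+1)%N ->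
  `|mesh_pt lam N i' - mesh_pt lam N i| <= 2 / N%:R.
Proof.
move=> l0 l1 /andP[ji ij] /andP[ji' ij'].
have jN := ltn_ord j.
have a := mesh_pt_le N2 evN l0 l1 ji (leq_trans ij jN).
have b := mesh_pt_le N2 evN l0 l1 ji' (leq_trans ij' jN).
have c := mesh_pt_le N2 evN l0 l1 ij jN; have d := mesh_pt_le N2 evN l0 l1 ij' jN.
have e := mesh_pt_step_le N2 evN l0 l1 jN.
by rewrite ler_norml; apply/andP; split; lra.
Qed.

Let lx := lambda_x P N eps.
Let ly := lambda_y P N eps.
Let lx0 : 0 < lx. Proof. by case/andP: (lambda_x_itv hP adm). Qed.
Let lx1 : lx <= 1 / 2. Proof. by case/andP: (lambda_x_itv hP adm). Qed.
Let ly0 : 0 < ly. Proof. by case/andP: (lambda_y_itv hP adm). Qed.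
Let ly1 : ly <= 1 / 2. Proof. by case/andP: (lambda_y_itv hP adm). Qed.

Lemma weight_layer_x (i i' j : 'I_N) (t t' : bool) : (N./2 <= i)%N -> (N./2 <= i')%N ->
  node0 W (i, j, t) <= 2 * node0 W (i', j, t').
Proof.
move=> ni ni'; rewrite !node0_nodal.
apply: (@weight_at_close _ _ (lx + 2 / N%:R)); last first.
  by apply: (layer_width_small _ kb1); [case: hP => _ []|case: adm => _ []].
apply: lerD; rewrite /corner /=.
  by apply: dist_layer => //; exact: shifted_index_layer.
by apply: (@dist_cell _ _ _ j) => //; exact: shifted_index_cell.
Qed.

Lemma weight_layer_y (i j j' : 'I_N) (t t' : bool) : (N./2 <= j)%N -> (N./2 <= j')%N ->
  node0 W (i, j, t) <= 2 * node0 W (i, j', t').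
Proof.
move=> ni ni'; rewrite !node0_nodal.
apply: (@weight_at_close _ _ (ly + 2 / N%:R)); last first.
  by apply: (layer_width_small _ kb2); [case: hP => _ []|case: adm => _ []].
rewrite addrC; apply: lerD; rewrite /corner /=.
  by apply: dist_layer => //; exact: shifted_index_layer.
by apply: (@dist_cell _ _ _ i) => //; exact: shifted_index_cell.
Qed.

(** The row inequality with the constant fine step 2 lambda / N: N^2 cancels and 12 times 4
    remains. *)
Lemma layer_x_bound (V : nat -> nat -> R) : boundary_zero N V ->
  \sum_(K : tri N | layer_x K) area K * (node0 W K * node_sqr V K) <=
  48 * lx ^+ 2 * \sum_(K : tri N | layer_x K) area K * (node0 W K * grad_x K V ^+ 2).
Proof.
move=> [Vl Vr]; rewrite big_mkcond [in leRHS]big_mkcond /= !sum_tri.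
rewrite exchange_big [in leRHS]exchange_big mulr_sumr /=; apply: ler_sum => j _.
have h0 i : (N./2 <= i)%N -> (i < N)%N -> hx i = 2 * lx / N%:R.
  by move=> ni iN; apply: mesh_pt_step_fine => //; rewrite ni.
have := @layer_row R N N./2 (fun i => node0 W (i, j, false)) (fun i => node0 W (i, j, true))
  (V ^~ j) (V ^~ j.+1) (Vl _).2 (Vl _).2.
have wpos (K : tri N) : 0 < node0 W K by exact: node0_weight_gt0.
move=> H.
have {}H := H (fun i => wpos _)
  (fun i => wpos _)
  (fun i i' ni ni' => And4 (weight_layer_x j false false ni ni')
    (weight_layer_x j false true ni ni') (weight_layer_x j true false ni ni')
    (weight_layer_x j true true ni ni')).
pose A := 2 * lx / N%:R * hy j / 2.
have A0 : 0 < A by rewrite /A !mulr_gt0 ?invr_gt0// (hy_gt0 hP adm).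
have := ler_wpM2l (ltW A0) H.
rewrite mulrCA mulr_sumr [in X in _ <= X]mulr_sumr => HA.
apply: le_trans (le_trans _ HA) _.
  rewrite [leRHS]big_mkcond /=; apply: ler_sum => i _; case: ifP => ni; last by rewrite addr0.
  rewrite le_eqVlt; apply/orP; left; apply/eqP.
  by rewrite /node_sqr /area /= (h0 i ni)// /A; ring.
rewrite le_eqVlt; apply/orP; left; apply/eqP.
rewrite big_mkcond /= !mulr_sumr; apply: eq_bigr => i _; case: ifP => ni; last first.
  by rewrite addr0 !mulr0.
rewrite /grad_x /area /= (h0 i ni)// /A.
by field; rewrite !gt_eqF.
Qed.

Lemma layer_y_bound (V : nat -> nat -> R) : boundary_zero N V ->
  \sum_(K : tri N | layer_y K) area K * (node0 W K * node_sqr V K) <=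
  48 * ly ^+ 2 * \sum_(K : tri N | layer_y K) area K * (node0 W K * grad_y K V ^+ 2).
Proof.
move=> [Vl Vr]; rewrite big_mkcond [in leRHS]big_mkcond /= !sum_tri.
rewrite mulr_sumr /=; apply: ler_sum => i _.
have h0 j : (N./2 <= j)%N -> (j < N)%N -> hy j = 2 * ly / N%:R.
  by move=> ni iN; apply: mesh_pt_step_fine => //; rewrite ni.
have := @layer_row R N N./2 (fun j => node0 W (i, j, false)) (fun j => node0 W (i, j, true))
  (V i) (V i.+1) (Vr _).2 (Vr _).2.
have wpos (K : tri N) : 0 < node0 W K by exact: node0_weight_gt0.
move=> H.
have {}H := H (fun i => wpos _)
  (fun i => wpos _)
  (fun j j' nj nj' => And4 (weight_layer_y i false false nj nj')
    (weight_layer_y i false true nj nj') (weight_layer_y i true false nj nj')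
    (weight_layer_y i true true nj nj')).
pose A := hx i * (2 * ly / N%:R) / 2.
have A0 : 0 < A by rewrite /A !mulr_gt0 ?invr_gt0// (hx_gt0 hP adm).
have := ler_wpM2l (ltW A0) H.
rewrite mulrCA mulr_sumr [in X in _ <= X]mulr_sumr => HA.
apply: le_trans (le_trans _ HA) _.
  rewrite [leRHS]big_mkcond /=; apply: ler_sum => j _; case: ifP => nj; last by rewrite addr0.
  rewrite le_eqVlt; apply/orP; left; apply/eqP.
  by rewrite /node_sqr /area /= (h0 j nj)// /A; ring.
rewrite le_eqVlt; apply/orP; left; apply/eqP.
rewrite big_mkcond /= !mulr_sumr; apply: eq_bigr => j _; case: ifP => nj; last first.
  by rewrite addr0 !mulr0.
rewrite /grad_y /area /= (h0 j nj)// /A.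
by field; rewrite !gt_eqF.
Qed.

End layer_bound.

Lemma half_leqn (n : nat) : (n./2 <= n)%N.
Proof. by have := odd_double_half n; lia. Qed.

(** * Weighted coercivity on fine meshes *)

Section weighted_coercivity.
Context (R : realType) (P : sd_data R) (N : nat) (eps k : R) (xs : R * R).
Hypotheses (hP : sd_data_pos P) (adm : admissible P N eps) (k24 : 24 <= k).
Hypotheses (kb1 : 30 / beta1 P <= k) (kb2 : 30 / beta2 P <= k).
Let b := bnorm P.
Let c := creact P.
Let Cs := Cstar P.
(** N times the total factor of [slope]^2 / w among the errors: diffusion gives 1, stabilization
    [Cstar P] b^2, and the quadrature error in the coarse region 16 / (3 Cstar). With [kc], [kd] and
    [Nlarge] the errors use up at most half of the streamline-derivative term and half of the
    reaction term. *)
Definition kappa : R := 1 + Cstar P * bnorm P ^+ 2 + 16 / (3 * Cstar P).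
Hypothesis kc : 48 * (8 * kappa + (b1 P + b2 P) + 7 * c) <= c * k.
Hypothesis kd : 48 * (64 * kappa + 4 * (b1 P + b2 P)) <= b * k.
Hypothesis kl : 641 ^+ 2 * b ^+ 2 * ((beta1 P)^-1 ^+ 2 + (beta2 P)^-1 ^+ 2) <= k.
Hypothesis Nlarge : 64 * c * Cs <= N%:R.
Local Notation W := (nodal P N eps (weight_at P N k xs)).
Local Notation D := (nodal P N eps (weight_deriv_at P N k xs)).
Local Notation area := (area P eps).
Local Notation delta := (delta P eps).
Local Notation grad_x := (grad_x P eps).
Local Notation grad_y := (grad_y P eps).
Local Notation grad_b := (grad_b P eps).
Local Notation sx := (step_x P eps).
Local Notation sy := (step_y P eps).

Let k0 : 0 < k. Proof. by move: k24; lra. Qed.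
Let N2 := admissible_ge2 adm.
Let N0 := natr_gt0 adm.
Let L := ln N%:R : R.
Let L12 : 1 / 2 <= L := ln_natr_ge R N2.

Lemma delta_le (K : tri N) : delta K <= Cs / N%:R.
Proof.
rewrite /Defs.delta; case: ifP => // _; case: hP => _ [_ _ c0].
by rewrite divr_ge0 ?ltW.
Qed.

Lemma delta_coarse (K : tri N) : ~~ layer_x K -> ~~ layer_y K -> delta K = Cs / N%:R.
Proof.
case: K => [[i j] t]; rewrite /= -!ltnNge => ni nj.
rewrite /Defs.delta ifT//; apply/asboolP => p [[/=]].
have [/andP[lx0 lx1] /andP[ly0 ly1]] := (lambda_x_itv hP adm, lambda_y_itv hP adm).
have evN := admissible_even adm.
rewrite !in_itv /= => /andP[x1 x2] /andP[y1 y2] _.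
have hN : (N./2 <= N)%N by exact: half_leqn.
have /andP[a0 _] := mesh_pt_itv N2 evN lx0 lx1 (ltnW (ltn_ord i)).
have /andP[b0 _] := mesh_pt_itv N2 evN ly0 ly1 (ltnW (ltn_ord j)).
have a1 := mesh_pt_le N2 evN lx0 lx1 ni hN.
have b1 := mesh_pt_le N2 evN ly0 ly1 nj hN.
rewrite mesh_pt_half// in a1; rewrite mesh_pt_half// in b1.
split; rewrite /= in_itv /=; apply/andP; split.
- exact: le_trans x1.
- exact: le_trans x2 _.
- exact: le_trans y1.
- exact: le_trans y2 _.
Qed.

(* [slope K] bounds the difference quotients of the weight on [K]. *)
Definition slope (K : tri N) : R := 2 * (Num.sqrt N%:R / k) * node0 W K + 4 * node0 D K.

Lemma slope_ge0 (K : tri N) : 0 <= slope K.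
Proof.
have w0 := node0_weight_gt0 P eps k xs K; have d0 := node0_deriv_gt0 xs adm k24 K.
have sk : 0 <= Num.sqrt N%:R / k by rewrite divr_ge0 ?sqrtr_ge0// ltW.
rewrite /slope; move: (Num.sqrt N%:R / k) sk w0 d0 => s s0 w0 d0; nra.
Qed.

Lemma deriv_le (K : tri N) : node0 D K <= node0 W K * (2 * N%:R / k).
Proof.
apply: le_trans (node0_deriv_le xs adm k24 K) _.
rewrite ler_pM2l ?(node0_weight_gt0 P eps k xs K)//.
by rewrite -(sigma_betaV adm k24) (sigma_betaV_le adm k24).
Qed.

(** In the square of the streamline part one factor [node0 D K] is kept and the other is traded for
    2 N w / k. The N in front is later compensated by epsilon and [delta], both O(1/N). *)
Lemma slope_sqr (K : tri N) : slope K ^+ 2 / node0 W K <=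
  N%:R * (8 / k ^+ 2 * node0 W K + 64 / k * node0 D K).
Proof.
have w0 := node0_weight_gt0 P eps k xs K; have d0 := node0_deriv_gt0 xs adm k24 K.
have dw := deriv_le K.
rewrite ler_pdivrMr// /slope; set w := node0 W K in w0 dw *; set d := node0 D K in d0 dw *.
set s := Num.sqrt _; have sN : s ^+ 2 = N%:R by rewrite sqr_sqrtr// ltW.
apply: (@le_trans _ _ (2 * (2 * (s / k) * w) ^+ 2 + 2 * (4 * d) ^+ 2)).
  by have := sqr_ge0 (2 * (s / k) * w - 4 * d); lra.
have -> : 2 * (2 * (s / k) * w) ^+ 2 = N%:R * (8 / k ^+ 2 * w) * w.
  by rewrite -sN; field; rewrite gt_eqF.
have : 32 * d * d <= 32 * d * (w * (2 * N%:R / k)) by rewrite ler_pM2l// mulr_gt0.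
have -> : 32 * d * (w * (2 * N%:R / k)) = N%:R * (64 / k * d) * w by ring.
lra.
Qed.

(** The relative variation of the weight on a cell, with the gain 1 / ln N that the layer argument
    consumes. *)
Lemma slope_step (K : tri N) : 2 / N%:R * slope K <= 16 / (k * L) * node0 W K.
Proof.
have w0 := node0_weight_gt0 P eps k xs K.
have dw := node0_deriv_le xs adm k24 K.
have L0 : 0 < L by apply: lt_le_trans L12.
have Ls := ln_natr_le_sqrt R N2; rewrite -/L in Ls.
rewrite /slope; set w := node0 W K in w0 dw *; set s := Num.sqrt _ in Ls *.
have s0 : 0 < s by rewrite sqrtr_gt0.
have sN : s * s = N%:R by rewrite -expr2 sqr_sqrtr// ltW.
have e1 : 2 / N%:R * (2 * (s / k) * w) <= 8 / (k * L) * w.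
  have -> : 2 / N%:R * (2 * (s / k) * w) = 4 / (k * s) * w.
    by rewrite -sN; field; rewrite !gt_eqF.
  rewrite ler_pM2r// ler_pdivrMr ?mulr_gt0//.
  have -> : 8 / (k * L) * (k * s) = 8 * s / L by field; rewrite !gt_eqF.
  by rewrite ler_pdivlMr//; lra.
have e2 : 2 / N%:R * (4 * node0 D K) <= 8 / (k * L) * w.
  have -> : 8 / (k * L) * w = 2 / N%:R * (4 * (w * (N%:R / (k * L)))).
    by field; rewrite !gt_eqF.
  by rewrite ler_pM2l ?divr_gt0// ler_pM2l.
by rewrite mulrDr (_ : 16 / (k * L) = 8 / (k * L) + 8 / (k * L)); [lra|ring].
Qed.

Lemma slope_step_coarse (K : tri N) : 2 / N%:R * slope K <= 20 / k * node0 W K.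
Proof.
have w0 := node0_weight_gt0 P eps k xs K.
have dw := deriv_le K; have sN := sqrt_natr_le adm.
have -> : 20 / k * node0 W K = 2 / N%:R * (2 * (N%:R / k) * node0 W K
    + 4 * (node0 W K * (2 * N%:R / k))) by field; rewrite !gt_eqF.
rewrite ler_pM2l ?divr_gt0// /slope lerD ?ler_pM2l//.
by rewrite ler_pM2r// ler_pM2l// ler_pM2r ?invr_gt0.
Qed.

Variable G : nat -> nat -> R.
Hypothesis G0 : boundary_zero N G.
Let I i j := W i j * G i j.

Definition local_main (K : tri N) : R :=
  eps * (grad_x K I * grad_x K G + grad_y K I * grad_y K G)
  + 1 / 2 * grad_b K W * node_form K G G + c * node_form K I G
  + delta K * ((grad_b K I + c * node_avg K I) * grad_b K G).

Definition local_quad (K : tri N) : R := node_form K W G - node_avg K I.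

(** Convection is moved onto G, which leaves minus b.grad G times the average of [I]. Replacing this
    average by [node_form K W G] costs [local_quad], and the replaced sum is half of b.grad W
    against G^2 by [sum_weighted_square]. *)
Lemma mesh_aSD_split : mesh_aSD P N eps I G =
  \sum_(K : tri N) area K * (local_main K + grad_b K G * local_quad K).
Proof.
have e1 := sum_grad_b_antisym hP adm I G0.
have e2 := sum_weighted_square hP adm W G0.
transitivity (\sum_(K : tri N) area K * (local_main K - 1 / 2 * grad_b K W * node_form K G G)
  + \sum_(K : tri N) area K * (grad_b K I * node_avg K G)).
  by rewrite -big_split; apply: eq_bigr => K _; rewrite /local_main -/c /=; ring.
rewrite e1.
have -> : - \sum_(K : tri N) area K * (grad_b K G * node_avg K I) =
  - \sum_(K : tri N) area K * (grad_b K G * node_avg K I)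
  + (\sum_(K : tri N) area K * (grad_b K G * node_form K W G)
     + \sum_(K : tri N) area K * (1 / 2 * grad_b K W * node_form K G G)).
  by rewrite e2 addNr addr0.
rewrite -sumrN -!big_split /=; apply: eq_bigr => K _.
by rewrite /local_quad; ring.
Qed.

Lemma node0_I (K : tri N) : node0 I K = node0 W K * node0 G K.
Proof. by case: K => [[i j] t]. Qed.
Lemma node1_I (K : tri N) : node1 I K = node1 W K * node1 G K.
Proof. by case: K => [[i j] t]. Qed.
Lemma node2_I (K : tri N) : node2 I K = node2 W K * node2 G K.
Proof. by case: K => [[i j] t]. Qed.

(** The local estimates added up. The streamline term is half of the bound for b.grad W times the
    mass of G; the eigenvalue 1/12 yields b/24 in the main part, the eigenvalue 1/3 yields the 1/6
    in the error. *)
Lemma local_main_ge (K : tri N) :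
  let w := node0 W K in let d := node0 D K in let S := node_sqr G K in
  let g2 := grad_x K G ^+ 2 + grad_y K G ^+ 2 in
  3 / 4 * (eps * w * g2) + 1 / 2 * (delta K * w * grad_b K G ^+ 2)
  + S * (b / 24 * d + c / 12 * w)
  - S * ((eps + delta K * b ^+ 2) * (slope K ^+ 2 / w)
         + (b1 P + b2 P) * (4 / k ^+ 2 * w + 20 / k * d) / 6
         + 4 / 3 * c ^+ 2 * delta K * w + c * (20 / k) / 3 * w)
  <= local_main K.
Proof.
set w := node0 W K; set d := node0 D K; set S := node_sqr G K => /=.
have w0 : 0 < w by exact: node0_weight_gt0.
have d0 : 0 < d by exact: node0_deriv_gt0.
have [n1 n1w n2 n2w] := node_weight_le xs hP adm k24 K.
have h1 := node1_weight_diff xs hP adm k24 K.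
have h2 := node2_weight_diff xs hP adm k24 K.
rewrite -/(slope K) -/w in h1 h2 n1w n2w.
have sx0 := step_x_neq0 hP adm K; have sy0 := step_y_neq0 hP adm K.
have e0 := admissible_eps_gt0 adm; have de0 := delta_ge0 eps hP K.
have [_ [_ _ Cs0]] := hP; have [[b10 b20 c0] _] := hP.
have bs : b ^+ 2 = b1 P ^+ 2 + b2 P ^+ 2 := bnorm_sqr P.
have S0 : 0 <= S by rewrite /S /node_sqr !addr_ge0 ?sqr_ge0.
have m1 : `|node1 W K - w| <= 20 / k * w.
  apply: le_trans h1 _; apply: le_trans (slope_step_coarse K).
  by rewrite ler_wpM2r ?slope_ge0// (step_x_le hP adm).
have m2 : `|node2 W K - w| <= 20 / k * w.
  apply: le_trans h2 _; apply: le_trans (slope_step_coarse K).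
  by rewrite ler_wpM2r ?slope_ge0// (step_y_le hP adm).
have D1 := local_diffusion (node0 G K) (node1 G K) (node2 G K) w0 sx0 sy0 h1 h2.
have D2 := @local_stabilization _ _ _ _ _ (node0 G K) (node1 G K) (node2 G K) _ _ w0 sx0 sy0 h1 h2
   (b1 P) (b2 P) c n1 n2 n1w n2w.
have D3 := local_reaction (node0 G K) (node1 G K) (node2 G K) w0 m1 m2.
have [F1 F2] := vert_form_bounds (node0 G K) (node1 G K) (node2 G K).
have D4 := grad_b_weight xs hP adm k24 K.
rewrite /= -/w -/d -bs -/b in D1 D2 D3 D4.
rewrite -/(node_sqr G K) -/S -/(node_form K G G) in D1 D2 D3 F1 F2.
rewrite /local_main.
have gxI : grad_x K I = (node1 W K * node1 G K - w * node0 G K) / sx K.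
  by rewrite /grad_x node0_I node1_I.
have gyI : grad_y K I = (node2 W K * node2 G K - w * node0 G K) / sy K.
  by rewrite /grad_y node0_I node2_I.
have avI : node_avg K I = (w * node0 G K + node1 W K * node1 G K + node2 W K * node2 G K) / 3.
  by rewrite /node_avg node0_I node1_I node2_I.
have fI : node_form K I G = vert_form (w * node0 G K) (node1 W K * node1 G K)
    (node2 W K * node2 G K) (node0 G K) (node1 G K) (node2 G K).
  by rewrite /node_form node0_I node1_I node2_I.
rewrite -gxI -gyI -/(grad_x K G) -/(grad_y K G) in D1 D2.
rewrite -avI -/(grad_b K G) -/(grad_b K I) in D2.
rewrite -fI in D3.
clear gxI gyI avI fI h1 h2 m1 m2 n1 n1w n2 n2w.
move: D1 D2 D3 D4 F1 F2.
move: (grad_x K I) (grad_y K I) (grad_x K G) (grad_y K G) (grad_b K G) (grad_b K I).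
move: (grad_b K W) (node_form K G G) (node_form K I G) (node_avg K I).
move: (slope K ^+ 2 / w) => A bW FG FI av Ix Iy gx gy bg bI D1 D2 D3 D4 F1 F2.
set e := (b1 P + b2 P) * _ in D4 *.
have E0 : 0 <= e.
  apply: mulr_ge0; first by rewrite ltW// addr_gt0.
  by apply: addr_ge0; rewrite ltW// mulr_gt0// divr_gt0// exprn_gt0.
have T1 := ler_wpM2l (ltW e0) D1.
have T2 := ler_wpM2l de0 D2.
have T3 := ler_wpM2l (ltW c0) D3; rewrite -/c in T3.
have FG0 : 0 <= FG by apply: le_trans F1; rewrite divr_ge0.
have T4 := ler_wpM2r FG0 D4.
have bd0 : 0 <= b * d by rewrite mulr_ge0 ?ltW// bnorm_gt0.
have T5 := ler_wpM2l bd0 F1.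
have T6 := ler_wpM2l E0 F2.
clearbody S w d e.
lra.
Qed.

Lemma local_quad_sqr (K : tri N) :
  local_quad K ^+ 2 <= 4 / 3 * (2 / N%:R * slope K) ^+ 2 * node_sqr G K.
Proof.
have h1 := node1_weight_diff xs hP adm k24 K.
have h2 := node2_weight_diff xs hP adm k24 K.
have sx0 := step_x_neq0 hP adm K; have sy0 := step_y_neq0 hP adm K.
have := local_quadrature (node0 G K) (node1 G K) (node2 G K) sx0 h1 h2
  (step_x_le hP adm K) (step_y_le hP adm K).
by rewrite /local_quad /node_form /node_avg node0_I node1_I node2_I.
Qed.

Lemma local_error (K : tri N) :
  let w := node0 W K in let d := node0 D K in
  (eps + delta K * b ^+ 2 + 16 / (3 * Cs * N%:R)) * (slope K ^+ 2 / w)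
         + (b1 P + b2 P) * (4 / k ^+ 2 * w + 20 / k * d) / 6
         + 4 / 3 * c ^+ 2 * delta K * w + c * (20 / k) / 3 * w
  <= b / 48 * d + c / 24 * w.
Proof.
set w := node0 W K; set d := node0 D K => /=.
have w0 : 0 < w by exact: node0_weight_gt0.
have d0 : 0 < d by exact: node0_deriv_gt0.
have [[b10 b20 c0] [_ _ Cs0]] := hP.
have As := slope_sqr K; rewrite -/w -/d in As.
have bsq : 0 <= b ^+ 2 by exact: sqr_ge0.
have kap : eps + delta K * b ^+ 2 + 16 / (3 * Cs * N%:R) <= kappa / N%:R.
  have -> : kappa / N%:R = N%:R^-1 + Cs / N%:R * b ^+ 2 + 16 / (3 * Cs * N%:R).
    by rewrite /kappa -/b -/Cs; field; rewrite !gt_eqF.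
  by rewrite lerD2r lerD ?(admissible_eps_le adm)// ler_wpM2r ?delta_le.
have A0 : 0 <= slope K ^+ 2 / w by rewrite divr_ge0 ?sqr_ge0 ?ltW.
have kap0 : 0 < kappa.
  rewrite /kappa -/b -/Cs ltr_wpDr// ?divr_ge0 ?mulr_ge0 ?ltW// ltr_wpDr//.
  by rewrite mulr_ge0// ltW.
have T1 : (eps + delta K * b ^+ 2 + 16 / (3 * Cs * N%:R)) * (slope K ^+ 2 / w) <=
    kappa * (8 / k ^+ 2 * w + 64 / k * d).
  apply: le_trans (ler_wpM2r A0 kap) _.
  have -> : kappa * (8 / k ^+ 2 * w + 64 / k * d) =
    kappa / N%:R * (N%:R * (8 / k ^+ 2 * w + 64 / k * d)) by field; rewrite !gt_eqF.
  by rewrite ler_pM2l ?divr_gt0.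
have kk : k ^- 2 <= k^-1.
  rewrite lef_pV2 ?posrE ?exprn_gt0// expr2 ler_peMr ?ltW//.
  by move: k24; lra.
have [x xE] : exists x, x = w / k by eexists.
have [y yE] : exists y, y = d / k by eexists.
have x0 : 0 < x by rewrite xE divr_gt0.
have y0 : 0 < y by rewrite yE divr_gt0.
have kx : w / k ^+ 2 <= x by rewrite xE ler_pM2l.
have e1 : 48 * (8 * kappa + (b1 P + b2 P) + 7 * c) * x <= c * w.
  have -> : c * w = c * k * x by rewrite xE; field; rewrite gt_eqF.
  by rewrite ler_pM2r.
have e2 : 48 * (64 * kappa + 4 * (b1 P + b2 P)) * y <= b * d.
  have -> : b * d = b * k * y by rewrite yE; field; rewrite gt_eqF.
  by rewrite ler_pM2r.
(* [Nlarge] gives c delta <= 1/64, and 4/3 of 1/64 is 1/48. *)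
have e3 : 4 / 3 * c ^+ 2 * delta K * w <= c * w / 48.
  have : c * (Cs / N%:R) <= 64^-1.
    by rewrite mulrA ler_pdivrMr// [leRHS]mulrC ler_pdivlMr// mulrC mulrA.
  move=> h1; have h2 := delta_le K.
  have h3 : c * delta K <= 64^-1 by apply: le_trans h1; rewrite ler_pM2l.
  have h4 : c * w * (c * delta K) <= c * w * 64^-1 by rewrite ler_pM2l// mulr_gt0.
  lra.
have T2 : kappa * (8 / k ^+ 2 * w + 64 / k * d) <= kappa * (8 * x + 64 * y).
  rewrite ler_pM2l// (_ : 64 / k * d = 64 * y); last by rewrite yE; ring.
  by rewrite lerD2r (_ : 8 / k ^+ 2 * w = 8 * (w / k ^+ 2)) ?ler_pM2l//; ring.
have T3 : (b1 P + b2 P) * (4 / k ^+ 2 * w + 20 / k * d) / 6 <= (b1 P + b2 P) * (4 * x + 20 * y) / 6.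
  rewrite ler_pM2r// ler_pM2l ?addr_gt0// (_ : 20 / k * d = 20 * y); last by rewrite yE; ring.
  by rewrite lerD2r (_ : 4 / k ^+ 2 * w = 4 * (w / k ^+ 2)) ?ler_pM2l//; ring.
have T4 : c * (20 / k) / 3 * w = 20 / 3 * (c * x) by rewrite xE; ring.
have cx : 0 < c * x by rewrite mulr_gt0.
have bx : 0 < (b1 P + b2 P) * x by rewrite mulr_gt0// addr_gt0.
have by_ : 0 < (b1 P + b2 P) * y by rewrite mulr_gt0// addr_gt0.
rewrite T4; clearbody w d; lra.
Qed.

Lemma grad_b_sqr_le V (K : tri N) :
  grad_b K V ^+ 2 <= b ^+ 2 * (grad_x K V ^+ 2 + grad_y K V ^+ 2).
Proof.
rewrite /b (bnorm_sqr P) /grad_b.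
by have := sqr_ge0 (b1 P * grad_y K V - b2 P * grad_x K V); lra.
Qed.

(** The price of the quadrature error in a layer: 342 exceeds 16^2 times 4/3, from [slope_step] and
    [local_quadrature], and b^2 / epsilon comes from Young's inequality against diffusion. *)
Let cl : R := 342 * b ^+ 2 / (k ^+ 2 * L ^+ 2 * eps).

Lemma local_total (K : tri N) :
  let w := node0 W K in let d := node0 D K in let S := node_sqr G K in
  let g2 := grad_x K G ^+ 2 + grad_y K G ^+ 2 in
  1 / 2 * (eps * w * g2) + 1 / 4 * (delta K * w * grad_b K G ^+ 2)
  + S * (b / 48 * d + c / 24 * w)
  - (if layer_x K || layer_y K then cl * (w * S) else 0)
  <= local_main K + grad_b K G * local_quad K.
Proof.
have := local_main_ge K; have := local_error K; have := local_quad_sqr K.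
have := slope_step K; have := grad_b_sqr_le G K.
have e0 := admissible_eps_gt0 adm; have de0 := delta_ge0 eps hP K.
have [_ [_ _ Cs0]] := hP.
have sl0 := slope_ge0 K.
have L0 : 0 < L by apply: lt_le_trans L12.
have b0 : 0 < b by exact: bnorm_gt0.
have w0 : 0 < node0 W K by exact: node0_weight_gt0.
have d0 : 0 < node0 D K by exact: node0_deriv_gt0.
set w := node0 W K in w0 *; set d := node0 D K in d0 *; set S := node_sqr G K => /=.
have S0 : 0 <= S by rewrite /S /node_sqr !addr_ge0 ?sqr_ge0.
have dc := @delta_coarse K.
move: (local_main K) (local_quad K) (grad_b K G) dc => lm z bg dc.
set g2 := grad_x K G ^+ 2 + _.
have g20 : 0 <= g2 by rewrite addr_ge0 ?sqr_ge0.
move: (slope K) sl0 => sl sl0 Hb Hs Hz He Hm.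
have [A AE] : exists A, A = sl ^+ 2 / w by eexists.
rewrite -AE in He Hm.
have A0 : 0 <= A by rewrite AE divr_ge0 ?sqr_ge0 ?ltW.
have HS := ler_wpM2l S0 He.
case: ifPn => [_|/norP[nx ny]].
  (* In a layer the quadrature error is charged to a quarter of the weighted diffusion. *)
  have om0 : 0 < eps * w / b ^+ 2 by rewrite divr_gt0 ?mulr_gt0 ?exprn_gt0.
  have Y := young_weighted bg z om0.
  have Y1 : eps * w / b ^+ 2 / 4 * bg ^+ 2 <= 1 / 4 * (eps * w * g2).
    have -> : 1 / 4 * (eps * w * g2) = eps * w / b ^+ 2 / 4 * (b ^+ 2 * g2).
      by field; rewrite gt_eqF.
    by rewrite ler_pM2l; [exact: Hb|exact: divr_gt0].
  have Y2 : z ^+ 2 / (eps * w / b ^+ 2) <= cl * (w * S).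
    rewrite ler_pdivrMr//.
    have -> : cl * (w * S) * (eps * w / b ^+ 2) = 342 * w ^+ 2 / (k ^+ 2 * L ^+ 2) * S.
      by rewrite /cl; field; rewrite !gt_eqF.
    apply: le_trans Hz _.
    have : (2 / N%:R * sl) ^+ 2 <= (16 / (k * L) * w) ^+ 2.
      rewrite ler_pXn2r// nnegrE; first by rewrite mulr_ge0// ltW// divr_gt0.
      by rewrite ltW// mulr_gt0 ?divr_gt0 ?mulr_gt0.
    have [q qE] : exists q, q = w ^+ 2 / (k ^+ 2 * L ^+ 2) by eexists.
    rewrite (_ : (16 / (k * L) * w) ^+ 2 = 256 * q); last first.
      by rewrite qE; field; rewrite !gt_eqF.
    have q0 : 0 <= q by rewrite qE ltW// divr_gt0 ?mulr_gt0 ?exprn_gt0.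
    rewrite -[342 * w ^+ 2 / _]mulrA -qE => rq.
    have f1 := ler_wpM2r S0 rq; have f2 := mulr_ge0 q0 S0.
    move: ((2 / N%:R * sl) ^+ 2) f1 => r; lra.
  have ex : 0 <= S * (16 / (3 * Cs * N%:R) * A).
    by rewrite mulr_ge0// mulr_ge0// ltW// divr_gt0// !mulr_gt0.
  have ey : 0 <= delta K * w * bg ^+ 2 by rewrite mulr_ge0 ?sqr_ge0// mulr_ge0// ltW.
  by clearbody w d S g2; lra.
have dK := dc nx ny.
(* In the coarse region it is charged to a quarter of the weighted stabilization; what remains is
   the 16 / (3 Cs N) share set aside in [local_error]. *)
have om0 : 0 < delta K * w by rewrite dK !mulr_gt0 ?invr_gt0.
have Y := young_weighted bg z om0.
have Y2 : z ^+ 2 / (delta K * w) <= S * (16 / (3 * Cs * N%:R) * A).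
  rewrite ler_pdivrMr// AE dK.
  have -> : S * (16 / (3 * Cs * N%:R) * (sl ^+ 2 / w)) * (Cs / N%:R * w)
    = 4 / 3 * (2 / N%:R * sl) ^+ 2 * S by field; rewrite !gt_eqF.
  exact: Hz.
have ey : 0 <= eps * w * g2 by rewrite mulr_ge0// ltW// mulr_gt0.
by rewrite subr0; clearbody w d S g2; lra.
Qed.

Definition weighted_energy : R := \sum_(K : tri N) area K *
  (eps * node0 W K * (grad_x K G ^+ 2 + grad_y K G ^+ 2)
   + (node0 D K + node0 W K) * node_sqr G K
   + delta K * node0 W K * grad_b K G ^+ 2).

(** [cl] is of order 1 / (epsilon ln^2 N) and the row inequalities give lambda^2, of order epsilon^2
    ln^2 N. Their product is a multiple of epsilon, made small by k. *)
Lemma layer_absorbed :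
  \sum_(K : tri N) area K * (if layer_x K || layer_y K
     then cl * (node0 W K * node_sqr G K) else 0) <=
  \sum_(K : tri N) area K *
     (1 / 4 * (eps * node0 W K * (grad_x K G ^+ 2 + grad_y K G ^+ 2))).
Proof.
have e0 := admissible_eps_gt0 adm.
have L0 : 0 < L by apply: lt_le_trans L12.
have [_ [be1 be2 _]] := hP.
have a0 (K : tri N) : 0 < area K by exact: area_gt0.
have w0 (K : tri N) : 0 < node0 W K by exact: node0_weight_gt0.
have S0 (K : tri N) : 0 <= node_sqr G K by rewrite /node_sqr !addr_ge0 ?sqr_ge0.
have b0 : 0 < b by exact: bnorm_gt0.
have cl0 : 0 <= cl by rewrite ltW// /cl divr_gt0 ?mulr_gt0 ?exprn_gt0.
have hx := layer_x_bound xs hP adm k24 kb1 G0.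
have hy := layer_y_bound xs hP adm k24 kb2 G0.
set X := \sum_(K : tri N | layer_x K) _ in hx; set X' := \sum_(K : tri N | layer_x K) _ in hx.
set Y := \sum_(K : tri N | layer_y K) _ in hy; set Y' := \sum_(K : tri N | layer_y K) _ in hy.
pose E := \sum_(K : tri N) area K * (node0 W K * (grad_x K G ^+ 2 + grad_y K G ^+ 2)).
have XE : X' <= E.
  rewrite /X' big_mkcond /=; apply: ler_sum => K _; case: ifP => _.
    by rewrite ler_pM2l// ler_pM2l// lerDl sqr_ge0.
  by rewrite mulr_ge0 ?(ltW (a0 K))// mulr_ge0 ?addr_ge0 ?sqr_ge0// ltW.
have YE : Y' <= E.
  rewrite /Y' big_mkcond /=; apply: ler_sum => K _; case: ifP => _.
    by rewrite ler_pM2l// ler_pM2l// lerDr sqr_ge0.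
  by rewrite mulr_ge0 ?(ltW (a0 K))// mulr_ge0 ?addr_ge0 ?sqr_ge0// ltW.
have E0 : 0 <= E.
  apply: sumr_ge0 => K _.
  by rewrite mulr_ge0 ?(ltW (a0 K))// mulr_ge0 ?addr_ge0 ?sqr_ge0// ltW.
apply: (@le_trans _ _ (cl * (X + Y))).
  have Xc : cl * X = \sum_(K : tri N)
      if layer_x K then cl * (area K * (node0 W K * node_sqr G K)) else 0.
    by rewrite mulr_sumr big_mkcond.
  have Yc : cl * Y = \sum_(K : tri N)
      if layer_y K then cl * (area K * (node0 W K * node_sqr G K)) else 0.
    by rewrite mulr_sumr big_mkcond.
  rewrite mulrDr Xc Yc -big_split /=.
  apply: ler_sum => K _.
  have t0 : 0 <= cl * (area K * (node0 W K * node_sqr G K)).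
    by rewrite mulr_ge0// mulr_ge0 ?(ltW (a0 K))// mulr_ge0// ltW.
  by case: (layer_x K); case: (layer_y K) => /=; lra.
have -> : \sum_(K : tri N) area K *
     (1 / 4 * (eps * node0 W K * (grad_x K G ^+ 2 + grad_y K G ^+ 2))) = 1 / 4 * eps * E.
  by rewrite /E mulr_sumr; apply: eq_bigr => K _; ring.
have [_ [lxE lyE]] := adm.
have hX : X <= 48 * lambda_x P N eps ^+ 2 * E.
  by apply: le_trans hx _; rewrite ler_wpM2l// mulr_ge0 ?sqr_ge0.
have hY : Y <= 48 * lambda_y P N eps ^+ 2 * E.
  by apply: le_trans hy _; rewrite ler_wpM2l// mulr_ge0 ?sqr_ge0.
rewrite lxE lyE -/L in hX hY.
have kl1 := kl; set be := (beta1 P)^-1 ^+ 2 + (beta2 P)^-1 ^+ 2 in kl1.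
(* 300 is 48 times (5/2)^2. *)
have XY : X + Y <= 300 * eps ^+ 2 * L ^+ 2 * be * E by rewrite /be; lra.
apply: le_trans (ler_wpM2l cl0 XY) _.
have -> : cl * (300 * eps ^+ 2 * L ^+ 2 * be * E) = (342 * 300 * b ^+ 2 * be) / k ^+ 2 * (eps * E).
  by rewrite /cl; field; rewrite !gt_eqF.
rewrite -[1 / 4 * eps * E]mulrA ler_wpM2r//; first by rewrite mulr_ge0// ltW.
(* The number 641 in [kl] is such that 641^2 exceeds 4 times 342 times 300. *)
rewrite ltW// ltr_pdivrMr ?exprn_gt0//.
have kk : k < k ^+ 2 by rewrite expr2 ltr_pMr//; move: k24; lra.
have be0 : 0 <= b ^+ 2 * be by rewrite mulr_ge0 ?addr_ge0 ?sqr_ge0.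
by move: kl1 kk be0; clearbody be; lra.
Qed.

Lemma weighted_coercivity (c1 : R) : 0 <= c1 -> c1 <= 1 / 4 -> c1 <= b / 48 -> c1 <= c / 24 ->
  c1 * weighted_energy <= mesh_aSD P N eps I G.
Proof.
move=> c10 c11 c12 c13; rewrite mesh_aSD_split.
have e0 := admissible_eps_gt0 adm.
have LA := layer_absorbed.
apply: (@le_trans _ _ (\sum_(K : tri N) area K *
   (1 / 2 * (eps * node0 W K * (grad_x K G ^+ 2 + grad_y K G ^+ 2))
   + 1 / 4 * (delta K * node0 W K * grad_b K G ^+ 2)
   + node_sqr G K * (b / 48 * node0 D K + c / 24 * node0 W K)
   - (if layer_x K || layer_y K then cl * (node0 W K * node_sqr G K) else 0)))); last first.
  apply: ler_sum => K _; rewrite ler_pM2l ?(area_gt0 hP adm)//.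
  exact: local_total.
under [leRHS]eq_bigr do rewrite mulrBr; rewrite sumrB.
rewrite lerBrDr; apply: le_trans (lerD (lexx _) LA) _.
rewrite /weighted_energy mulr_sumr -big_split /=; apply: ler_sum => K _.
rewrite mulrCA -mulrDr ler_pM2l ?(area_gt0 hP adm)//.
have w0 : 0 < node0 W K by exact: node0_weight_gt0.
have d0 : 0 < node0 D K by exact: node0_deriv_gt0.
have S0 : 0 <= node_sqr G K by rewrite /node_sqr !addr_ge0 ?sqr_ge0.
have dw0 : 0 <= delta K * node0 W K * grad_b K G ^+ 2.
  by rewrite mulr_ge0 ?sqr_ge0// mulr_ge0 ?(delta_ge0 eps hP)// ltW.
have ew0 : 0 <= eps * node0 W K * (grad_x K G ^+ 2 + grad_y K G ^+ 2).
  by rewrite mulr_ge0 ?addr_ge0 ?sqr_ge0// ltW// mulr_gt0.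
move: (delta K * _ * _) (eps * _ * _) dw0 ew0 => X Y X0 Y0.
have f1 := ler_wpM2r X0 c11; have f2 := ler_wpM2r Y0 c11.
have f3 := ler_wpM2r (mulr_ge0 (ltW d0) S0) c12.
have f4 := ler_wpM2r (mulr_ge0 (ltW w0) S0) c13.
lra.
Qed.

End weighted_coercivity.

(** * The value at the mesh node *)

Section point_value.
Context (R : realType) (P : sd_data R) (N : nat) (eps k : R) (xs : R * R).
Hypotheses (hP : sd_data_pos P) (adm : admissible P N eps) (k24 : 24 <= k).
Local Notation W := (nodal P N eps (weight_at P N k xs)).
Local Notation D := (nodal P N eps (weight_deriv_at P N k xs)).
Local Notation area := (area P eps).
Local Notation grad_x := (grad_x P eps).
Local Notation grad_y := (grad_y P eps).
Local Notation grad_b := (grad_b P eps).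
Local Notation delta := (delta P eps).
Local Notation hx := (hx P N eps).
Local Notation hy := (hy P N eps).
Variable G : nat -> nat -> R.
Hypothesis G0 : boundary_zero N G.

Let k0 : 0 < k. Proof. by move: k24; lra. Qed.
Let N2 := admissible_ge2 adm.
Let evN := admissible_even adm.
Let N0 := natr_gt0 adm.
Let L := ln N%:R : R.
Let L0 : 0 < L := ln_mesh_gt0 adm.
Let e0 := admissible_eps_gt0 adm.
Let lx0 : 0 < lambda_x P N eps. Proof. by case/andP: (lambda_x_itv hP adm). Qed.
Let lx1 : lambda_x P N eps <= 1 / 2. Proof. by case/andP: (lambda_x_itv hP adm). Qed.
Let ly0 : 0 < lambda_y P N eps. Proof. by case/andP: (lambda_y_itv hP adm). Qed.
Let ly1 : lambda_y P N eps <= 1 / 2. Proof. by case/andP: (lambda_y_itv hP adm). Qed.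

Definition energy_density (K : tri N) : R := area K *
  (eps * node0 W K * (grad_x K G ^+ 2 + grad_y K G ^+ 2)
   + (node0 D K + node0 W K) * node_sqr G K
   + delta K * node0 W K * grad_b K G ^+ 2).

Let w0 (K : tri N) : 0 < node0 W K. Proof. exact: node0_weight_gt0. Qed.
Let d0 (K : tri N) : 0 < node0 D K. Proof. exact: node0_deriv_gt0. Qed.
Let a0 (K : tri N) : 0 < area K. Proof. exact: area_gt0. Qed.
Let S0 (K : tri N) : 0 <= node_sqr G K.
Proof. by rewrite /node_sqr !addr_ge0 ?sqr_ge0. Qed.

Lemma energy_density_terms (K : tri N) :
  [/\ 0 <= area K * (eps * node0 W K * (grad_x K G ^+ 2 + grad_y K G ^+ 2)),
      0 <= area K * (node0 D K * node_sqr G K) &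
      0 <= area K * (node0 W K * node_sqr G K)] /\
  0 <= area K * (delta K * node0 W K * grad_b K G ^+ 2).
Proof.
have aw := ltW (a0 K); have ww := ltW (w0 K); have dd := ltW (d0 K).
have de := delta_ge0 eps hP K; have ee := ltW e0.
split; [split|]; apply: mulr_ge0 => //; apply: mulr_ge0 => //.
- exact: mulr_ge0.
- by rewrite addr_ge0 ?sqr_ge0.
- exact: mulr_ge0.
- exact: sqr_ge0.
Qed.

Lemma energy_density_ge0 (K : tri N) : 0 <= energy_density K.
Proof. by have [[? ? ?] ?] := energy_density_terms K; rewrite /energy_density; lra. Qed.

Lemma energy_density_le (K : tri N) :
  energy_density K <= weighted_energy P N eps k xs G.
Proof.
rewrite /weighted_energy (bigD1 K)//= lerDl; apply: sumr_ge0 => M _.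
exact: energy_density_ge0.
Qed.

Lemma node_value_coarse (i j : nat) : (0 < i <= N./2)%N -> (0 < j <= N./2)%N ->
  xs = (mesh_x P N eps i, mesh_y P N eps j) ->
  G i j ^+ 2 <= 4 * k * N%:R * L * weighted_energy P N eps k xs G.
Proof.
case: i => // i /andP[_ iN]; case: j => // j /andP[_ jN] xsE.
have iN' : (i < N)%N := leq_trans iN (half_leqn N).
have jN' : (j < N)%N := leq_trans jN (half_leqn N).
pose K : tri N := (Ordinal iN', Ordinal jN', true).
have hxi : 1 / N%:R <= hx i by exact: mesh_pt_step_coarse.
have hyj : 1 / N%:R <= hy j by exact: mesh_pt_step_coarse.
have aK : 1 / (2 * N%:R ^+ 2) <= area K.
  have -> : 1 / (2 * N%:R ^+ 2) = 1 / N%:R * (1 / N%:R) / 2 :> R.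
    by field; rewrite gt_eqF.
  by rewrite /area /= ler_pM2r//; apply: ler_pM => //; rewrite divr_ge0.
have dK : node0 D K = N%:R / (2 * k * L).
  rewrite node0_nodal (_ : corner P eps K = xs); last by rewrite xsE.
  rewrite /weight_deriv_at /along /across subrr /dot /= !mul0r !addr0 !mul0r.
  rewrite /weight_deriv /transverse oppr0 expR0 (sigma_betaV adm k24) -/L.
  by field; rewrite !gt_eqF.
have SK : G i.+1 j.+1 ^+ 2 <= node_sqr G K.
  by rewrite /node_sqr /= -addrA lerDl addr_ge0 ?sqr_ge0.
have [[t1 t2 t3] t4] := energy_density_terms K.
have hQ : area K * (node0 D K * node_sqr G K) <= weighted_energy P N eps k xs G.
  by apply: le_trans (energy_density_le K); rewrite /energy_density; lra.
have kNL : 0 < 4 * k * N%:R * L by rewrite !mulr_gt0.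
rewrite -ler_pdivrMl//; apply: le_trans hQ.
have -> : (4 * k * N%:R * L)^-1 * G i.+1 j.+1 ^+ 2 =
  1 / (2 * N%:R ^+ 2) * (N%:R / (2 * k * L) * G i.+1 j.+1 ^+ 2).
  by field; rewrite !gt_eqF.
rewrite -dK; apply: ler_pM.
- by rewrite ltW// divr_gt0// mulr_gt0// exprn_gt0.
- by rewrite mulr_ge0 ?sqr_ge0// ltW.
- exact: aK.
- by rewrite ler_pM2l.
Qed.

(** Each step towards x = 1 lies on the lower side of a triangle of height at least 1/N, and
    diffusion with weight at least 1/2 pays for it: the ratio is 8 N lambda / epsilon = (20 / beta1)
    N ln N. The height bound rests on j < N/2, so the corner region is excluded. *)
Lemma node_value_layer_x (i j : nat) : (N./2 <= i <= N)%N -> (j < N./2)%N ->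
  G i j ^+ 2 <= 20 / beta1 P * N%:R * L * weighted_energy P N eps k xs G.
Proof.
move=> /andP[ni iN] jn.
have jN : (j < N)%N := leq_trans jn (half_leqn N).
have [_ [be1 _ _]] := hP.
have cst0 : 0 < 20 / beta1 P * N%:R * L by rewrite mulr_gt0// mulr_gt0// divr_gt0.
have h1 := sqr_le_sum_steps (a := G ^~ j) (G0.1 j).2 ni iN.
apply: le_trans h1 _.
have hyj : 1 / N%:R <= hy j by exact: mesh_pt_step_coarse.
pose K (m : 'I_N) : tri N := (m, Ordinal jN, false).
have step (m : 'I_N) : (N./2 <= m)%N -> N%:R * (G m.+1 j - G m j) ^+ 2 <=
    20 / beta1 P * N%:R * L * energy_density (K m).
  move=> nm; have [[t1 t2 t3] t4] := energy_density_terms (K m).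
  have hm : hx m = 2 * lambda_x P N eps / N%:R by apply: mesh_pt_step_fine; rewrite // nm /=.
  have gE : G m.+1 j - G m j = hx m * grad_x (K m) G.
    by rewrite /grad_x /= mulrC mulfVK// gt_eqF// (hx_gt0 hP adm).
  have wK : 1 / 2 <= node0 W (K m) by rewrite node0_nodal weight_ge.
  apply: (@le_trans _ _ (20 / beta1 P * N%:R * L * (area (K m) *
      (eps * (1 / 2) * grad_x (K m) G ^+ 2)))); last first.
    rewrite (ler_pM2l cst0).
    apply: (@le_trans _ _ (area (K m) * (eps * node0 W (K m) *
       (grad_x (K m) G ^+ 2 + grad_y (K m) G ^+ 2)))); last first.
      by rewrite /energy_density; lra.
    rewrite ler_pM2l//; apply: ler_pM; rewrite ?sqr_ge0//.
    - by rewrite mulr_ge0// ltW.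
    - by rewrite ler_pM2l.
    - by rewrite lerDl sqr_ge0.
  have lE : lambda_x P N eps = 5 / 2 * eps * (beta1 P)^-1 * L by case: adm => _ [].
  have aK : hx m * (1 / N%:R) / 2 <= area (K m).
    by rewrite /area /= ler_pM2r// ler_pM2l// (hx_gt0 hP adm).
  rewrite gE exprMn.
  apply: (@le_trans _ _ (20 / beta1 P * N%:R * L * (hx m * (1 / N%:R) / 2 *
      (eps * (1 / 2) * grad_x (K m) G ^+ 2)))); last first.
    rewrite (ler_pM2l cst0) ler_wpM2r//.
    by rewrite mulr_ge0 ?sqr_ge0// mulr_ge0 ?ltW.
  rewrite hm lE le_eqVlt; apply/orP; left; apply/eqP.
  by field; rewrite !gt_eqF.
rewrite mulr_sumr.
apply: (@le_trans _ _ (\sum_(m < N | (N./2 <= m)%N) 20 / beta1 P * N%:R * L * energy_density (K m))).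
  by apply: ler_sum => m nm; exact: step.
rewrite -mulr_sumr (ler_pM2l cst0).
rewrite -[leRHS]/(\sum_(M : tri N) energy_density M) sum_tri big_mkcond /=.
apply: ler_sum => m _; rewrite (bigD1 (Ordinal jN))//= -/(K m).
have E1 : 0 <= energy_density (K m) by exact: energy_density_ge0.
have E2 := energy_density_ge0 (m, Ordinal jN, true).
apply: (@le_trans _ _ (energy_density (K m))); first by case: ifP.
rewrite -addrA lerDl addr_ge0//; apply: sumr_ge0 => M _.
by rewrite addr_ge0 ?energy_density_ge0.
Qed.

Lemma node_value_layer_y (i j : nat) : (i < N./2)%N -> (N./2 <= j <= N)%N ->
  G i j ^+ 2 <= 20 / beta2 P * N%:R * L * weighted_energy P N eps k xs G.
Proof.
move=> jn /andP[ni iN].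
have jN : (i < N)%N := leq_trans jn (half_leqn N).
have [_ [_ be1 _]] := hP.
have cst0 : 0 < 20 / beta2 P * N%:R * L by rewrite mulr_gt0// mulr_gt0// divr_gt0.
have h1 := sqr_le_sum_steps (a := G i) (G0.2 i).2 ni iN.
apply: le_trans h1 _.
have hyj : 1 / N%:R <= hx i by exact: mesh_pt_step_coarse.
pose K (m : 'I_N) : tri N := (Ordinal jN, m, false).
have step (m : 'I_N) : (N./2 <= m)%N -> N%:R * (G i m.+1 - G i m) ^+ 2 <=
    20 / beta2 P * N%:R * L * energy_density (K m).
  move=> nm; have [[t1 t2 t3] t4] := energy_density_terms (K m).
  have hm : hy m = 2 * lambda_y P N eps / N%:R by apply: mesh_pt_step_fine; rewrite // nm /=.
  have gE : G i m.+1 - G i m = hy m * grad_y (K m) G.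
    by rewrite /grad_y /= mulrC mulfVK// gt_eqF// (hy_gt0 hP adm).
  have wK : 1 / 2 <= node0 W (K m) by rewrite node0_nodal weight_ge.
  apply: (@le_trans _ _ (20 / beta2 P * N%:R * L * (area (K m) *
      (eps * (1 / 2) * grad_y (K m) G ^+ 2)))); last first.
    rewrite (ler_pM2l cst0).
    apply: (@le_trans _ _ (area (K m) * (eps * node0 W (K m) *
       (grad_x (K m) G ^+ 2 + grad_y (K m) G ^+ 2)))); last first.
      by rewrite /energy_density; lra.
    rewrite ler_pM2l//; apply: ler_pM; rewrite ?sqr_ge0//.
    - by rewrite mulr_ge0// ltW.
    - by rewrite ler_pM2l.
    - by rewrite lerDr sqr_ge0.
  have lE : lambda_y P N eps = 5 / 2 * eps * (beta2 P)^-1 * L by case: adm => _ [].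
  have aK : 1 / N%:R * hy m / 2 <= area (K m).
    by rewrite /area /= ler_pM2r// ler_pM2r// (hy_gt0 hP adm).
  rewrite gE exprMn.
  apply: (@le_trans _ _ (20 / beta2 P * N%:R * L * (1 / N%:R * hy m / 2 *
      (eps * (1 / 2) * grad_y (K m) G ^+ 2)))); last first.
    rewrite (ler_pM2l cst0) ler_wpM2r//.
    by rewrite mulr_ge0 ?sqr_ge0// mulr_ge0 ?ltW.
  rewrite hm lE le_eqVlt; apply/orP; left; apply/eqP.
  by field; rewrite !gt_eqF.
rewrite mulr_sumr.
apply: (@le_trans _ _ (\sum_(m < N | (N./2 <= m)%N) 20 / beta2 P * N%:R * L * energy_density (K m))).
  by apply: ler_sum => m nm; exact: step.
rewrite -mulr_sumr (ler_pM2l cst0).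
rewrite -[leRHS]/(\sum_(M : tri N) energy_density M) sum_tri [leRHS](bigD1 (Ordinal jN))//=.
have E1 (M : tri N) : 0 <= energy_density M by exact: energy_density_ge0.
rewrite [leLHS]big_mkcond /=.
apply: (@le_trans _ _ (\sum_(m < N) (energy_density (Ordinal jN, m, false)
   + energy_density (Ordinal jN, m, true)))).
  apply: ler_sum => m _; rewrite -/(K m).
  by case: ifP => _; [rewrite lerDl|rewrite addr_ge0].
rewrite lerDl; apply: sumr_ge0 => M _; apply: sumr_ge0 => m _.
by rewrite addr_ge0.
Qed.

Lemma node_value_bound (i j : nat) : (0 < i <= N)%N -> (0 < j <= N)%N ->
  xs = (mesh_x P N eps i, mesh_y P N eps j) ->
  ~~ ((N./2 <= i)%N && (N./2 <= j)%N) ->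
  G i j ^+ 2 <= (4 * k + 20 / beta1 P + 20 / beta2 P) * N%:R * L
     * weighted_energy P N eps k xs G.
Proof.
move=> /andP[i0 iN] /andP[j0 jN] xsE.
have [_ [be1 be2 _]] := hP.
set E := weighted_energy _ _ _ _ _ _; move=> ij.
have E0 : 0 <= E.
  by rewrite /E; apply: sumr_ge0 => K _; exact: energy_density_ge0.
have NE : 0 <= N%:R * L * E by rewrite mulr_ge0// ltW// mulr_gt0.
have t1 : 0 <= 4 * k * (N%:R * L * E) by rewrite mulr_ge0// ltW// mulr_gt0.
have t2 : 0 <= 20 / beta1 P * (N%:R * L * E) by rewrite mulr_ge0// ltW// divr_gt0.
have t3 : 0 <= 20 / beta2 P * (N%:R * L * E) by rewrite mulr_ge0// ltW// divr_gt0.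
have [ni|ni] := leqP i N./2; have [nj|nj] := leqP j N./2.
- have := @node_value_coarse i j; rewrite i0 ni j0 nj => /(_ isT isT xsE).
  by rewrite -/E; lra.
- have ni' : (i < N./2)%N.
    by move: ij; rewrite (ltnW nj) andbT -ltnNge.
  have := @node_value_layer_y i j ni'; rewrite (ltnW nj) jN => /(_ isT).
  by rewrite -/E; lra.
- have nj' : (j < N./2)%N.
    by move: ij; rewrite (ltnW ni) /= -ltnNge.
  have := @node_value_layer_x i j; rewrite (ltnW ni) iN => /(_ isT nj').
  by rewrite -/E; lra.
- by move: ij; rewrite (ltnW ni) (ltnW nj).
Qed.

End point_value.

(** * The weighted norm between the unweighted norm and the energy *)

Section weighted_norm_integrals.
Context (R : realType) (P : sd_data R) (N : nat) (eps k : R) (xs : R * R).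
Hypotheses (hP : sd_data_pos P) (adm : admissible P N eps) (k24 : 24 <= k).
Variable v : R * R -> R.
Hypothesis vV : VN P N eps v.
Local Notation G := (nodal P N eps v).
Local Notation W := (nodal P N eps (weight_at P N k xs)).
Local Notation D := (nodal P N eps (weight_deriv_at P N k xs)).
Local Notation mu2 := (plane_measure R).
Local Notation area := (area P eps).
Local Notation grad_x := (grad_x P eps).
Local Notation grad_y := (grad_y P eps).
Local Notation grad_b := (grad_b P eps).
Local Notation delta := (delta P eps).
Local Notation tr := (triangle P eps).
Let b := bnorm P.
Let b0 : 0 < b := bnorm_gt0 hP.
Let k0 : 0 < k. Proof. by move: k24; lra. Qed.
Let N2 := admissible_ge2 adm.

Definition grad_along (K : tri N) : R := b1 P / bnorm P * grad_x K G + b2 P / bnorm P * grad_y K G.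
Definition grad_across (K : tri N) : R := - b2 P / bnorm P * grad_x K G + b1 P / bnorm P * grad_y K G.

Let bW := (square_bounded_weight xs hP N2 k0).1.
Let bD := (square_bounded_weight xs hP N2 k0).2.

Definition int_weight (K : tri N) : R := \int[mu2]_(p in tr K) weight_at P N k xs p.
Definition int_weight_sqr (K : tri N) : R :=
  \int[mu2]_(p in tr K) (weight_at P N k xs p * node_interp P eps K G p ^+ 2).
Definition int_deriv_sqr (K : tri N) : R :=
  \int[mu2]_(p in tr K) (weight_deriv_at P N k xs p * node_interp P eps K G p ^+ 2).

Lemma square_boundedX (f : R * R -> R) : square_bounded f -> square_bounded (fun p => f p ^+ 2).
Proof. by move=> bf; apply: (@square_boundedM R f f). Qed.

Let bI (K : tri N) : square_bounded (node_interp P eps K G).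
Proof. exact: square_bounded_node_interp. Qed.

Let int_cstM (K : tri N) (f : R * R -> R) (a : R) : square_bounded f ->
  \int[mu2]_(p in tr K) (f p * a) = a * \int[mu2]_(p in tr K) f p.
Proof.
move=> bf; rewrite [RHS]mulrC.
apply: RintegralZr; first exact: (measurable_triangle hP adm).
exact: triangle_integrable.
Qed.

Lemma weighted_grad_integral (u : R * R -> R) (g : tri N -> R) :
  (forall K p, ~ mesh_skeleton P N eps p -> nbhs p (tr K) -> u p = g K) ->
  L2norm (@Omega R) (fun p => (Num.sqrt (omega P N k xs p))^-1 * u p) ^+ 2
    = \sum_(K : tri N) g K ^+ 2 * int_weight K.
Proof.
move=> ug; rewrite sqr_L2norm /L2ip.
rewrite (@integral_Omega_triangles R P N eps hP adm _
  (fun K p => weight_at P N k xs p * g K ^+ 2)).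
- by apply: eq_bigr => K _; rewrite int_cstM.
- by move=> K; apply: square_boundedM => //; exact: square_bounded_cst.
- move=> K p np /(triangle_nbhs hP adm np) Kp; rewrite (ug K)//.
  by rewrite -expr2 exprMn sqr_sqrt_omegaV.
Qed.

Lemma weighted_grad_triangle (K : tri N) (u : R * R -> R) (g : R) :
  (forall p, ~ mesh_skeleton P N eps p -> nbhs p (tr K) -> u p = g) ->
  L2norm (tr K) (fun p => (Num.sqrt (omega P N k xs p))^-1 * u p) ^+ 2
    = g ^+ 2 * int_weight K.
Proof.
move=> ug; rewrite sqr_L2norm /L2ip -int_cstM//.
apply: integral_triangle_ae => // p np Kp.
rewrite ug//; last exact: triangle_nbhs.
by rewrite -expr2 exprMn sqr_sqrt_omegaV.
Qed.

Lemma VN_ddir_beta (K : tri N) p : nbhs p (tr K) -> ddir (beta_dir P) v p = grad_along K.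
Proof. by move=> Kp; rewrite /ddir (VN_dx hP adm vV Kp) (VN_dy hP adm vV Kp). Qed.

Lemma VN_ddir_eta (K : tri N) p : nbhs p (tr K) -> ddir (eta_dir P) v p = grad_across K.
Proof. by move=> Kp; rewrite /ddir (VN_dx hP adm vV Kp) (VN_dy hP adm vV Kp). Qed.

Lemma weighted_value_integral :
  L2norm (@Omega R) (fun p => (Num.sqrt (omega P N k xs p))^-1 * v p) ^+ 2
    = \sum_(K : tri N) int_weight_sqr K.
Proof.
rewrite sqr_L2norm /L2ip; apply: integral_Omega_triangles => //.
- by move=> K; apply: square_boundedM => //; exact: square_boundedX.
- move=> K p np Kp; rewrite (VN_interp hP adm vV Kp).
  by rewrite -expr2 exprMn sqr_sqrt_omegaV.
Qed.

Lemma weighted_deriv_integral :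
  L2norm (@Omega R) (fun p => Num.sqrt
     (ddir (beta_dir P) (fun p => (omega P N k xs p)^-1) p) * v p) ^+ 2
    = \sum_(K : tri N) int_deriv_sqr K.
Proof.
rewrite sqr_L2norm /L2ip; apply: integral_Omega_triangles => //.
- by move=> K; apply: square_boundedM => //; exact: square_boundedX.
- move=> K p np Kp; rewrite (VN_interp hP adm vV Kp) -expr2 exprMn.
  rewrite (ddir_omegaV _ _ hP N2 k0) sqr_sqrtr// ltW//.
  exact: weight_deriv_at_gt0.
Qed.

Lemma weighted_norm_sqr : weighted_norm P N eps k xs v ^+ 2 =
  \sum_(K : tri N) (eps * (grad_along K ^+ 2 + grad_across K ^+ 2) * int_weight K
    + b / 2 * int_deriv_sqr K + creact P * int_weight_sqr K
    + b ^+ 2 * delta K * (grad_along K ^+ 2 * int_weight K)).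
Proof.
have e0 := admissible_eps_gt0 adm; have [[_ _ c0] _] := hP.
rewrite /weighted_norm sqr_sqrtr; last first.
  have de0 (K : tri N) := delta_ge0 eps hP K.
  have ee := ltW e0; have cc := ltW c0; have bb : 0 <= bnorm P / 2 by rewrite divr_ge0// ltW.
  do 4! (apply: addr_ge0; last by [exact: mulr_ge0 (sqr_ge0 _) |
     apply: mulr_ge0 => //; exact: sqr_ge0 |
     apply: sumr_ge0 => K _; apply: mulr_ge0; [apply: mulr_ge0 => //|]; exact: sqr_ge0]).
  by apply: mulr_ge0 => //; exact: sqr_ge0.
have E1 : L2norm (@Omega R) (fun p => (Num.sqrt (omega P N k xs p))^-1 * ddir (beta_dir P) v p) ^+ 2
    = \sum_(K : tri N) grad_along K ^+ 2 * int_weight K.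
  by apply: weighted_grad_integral => K p _; exact: VN_ddir_beta.
have E2 : L2norm (@Omega R) (fun p => (Num.sqrt (omega P N k xs p))^-1 * ddir (eta_dir P) v p) ^+ 2
    = \sum_(K : tri N) grad_across K ^+ 2 * int_weight K.
  by apply: weighted_grad_integral => K p _; exact: VN_ddir_eta.
have E5 (K : tri N) : L2norm (tr K) (fun p => (Num.sqrt (omega P N k xs p))^-1 *
    ddir (beta_dir P) v p) ^+ 2 = grad_along K ^+ 2 * int_weight K.
  by apply: weighted_grad_triangle => p _; exact: VN_ddir_beta.
transitivity (eps * (\sum_(K : tri N) grad_along K ^+ 2 * int_weight K)
  + eps * (\sum_(K : tri N) grad_across K ^+ 2 * int_weight K)
  + b / 2 * (\sum_(K : tri N) int_deriv_sqr K)
  + creact P * (\sum_(K : tri N) int_weight_sqr K)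
  + \sum_(K : tri N) b ^+ 2 * delta K * (grad_along K ^+ 2 * int_weight K)).
  congr (_ * _ + _ * _ + _ * _ + _ * _ + _); [exact: E1|exact: E2|
    exact: weighted_deriv_integral|exact: weighted_value_integral|].
  by apply: eq_bigr => K _; congr (_ * _); exact: E5.
rewrite !mulr_sumr -!big_split /=; apply: eq_bigr => K _.
by ring.
Qed.

Lemma grad_frame (K : tri N) :
  grad_along K ^+ 2 + grad_across K ^+ 2 = grad_x K G ^+ 2 + grad_y K G ^+ 2.
Proof.
transitivity ((b1 P ^+ 2 + b2 P ^+ 2) / b ^+ 2 * (grad_x K G ^+ 2 + grad_y K G ^+ 2)).
  by rewrite /grad_along /grad_across -/b; field; rewrite gt_eqF.
by rewrite -(bnorm_sqr P) -/b mulfV ?mul1r// expf_neq0// gt_eqF.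
Qed.

Lemma grad_along_b (K : tri N) : b ^+ 2 * grad_along K ^+ 2 = grad_b K G ^+ 2.
Proof. by rewrite /grad_along /grad_b -/b; field; rewrite gt_eqF. Qed.

(** Convexity of the square in barycentric coordinates; the deficit is displayed as a combination of
    squared differences with nonnegative coefficients. *)
Lemma node_interp_sqr_le (K : tri N) p : tr K p ->
  node_interp P eps K G p ^+ 2 <= node_sqr G K.
Proof.
rewrite (triangleE hP)// /right_triangle /node_interp /vert_interp /node_sqr /=.
move: (_ / step_x P eps K) (_ / step_y P eps K) => s t [s0 t0 st].
move: (node0 G K) (node1 G K) (node2 G K) => u0 u1 u2.
have r0 : 0 <= 1 - s - t by lra.
have := mulr_ge0 (mulr_ge0 r0 s0) (sqr_ge0 (u0 - u1)).
have := mulr_ge0 (mulr_ge0 r0 t0) (sqr_ge0 (u0 - u2)).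
have := mulr_ge0 (mulr_ge0 s0 t0) (sqr_ge0 (u1 - u2)).
have p0 : (1 - s - t) * u0 ^+ 2 <= u0 ^+ 2 by rewrite ler_piMl ?sqr_ge0//; lra.
have p1 : s * u1 ^+ 2 <= u1 ^+ 2 by rewrite ler_piMl ?sqr_ge0//; lra.
have p2 : t * u2 ^+ 2 <= u2 ^+ 2 by rewrite ler_piMl ?sqr_ge0//; lra.
move=> q1 q2 q3.
have -> : (u0 + (u1 - u0) * s + (u2 - u0) * t) ^+ 2 =
  (1 - s - t) * u0 ^+ 2 + s * u1 ^+ 2 + t * u2 ^+ 2 -
  ((1 - s - t) * s * (u0 - u1) ^+ 2 + (1 - s - t) * t * (u0 - u2) ^+ 2
    + s * t * (u1 - u2) ^+ 2) by ring.
lra.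
Qed.

Let vert (K : tri N) : tr K (corner P eps K). Proof. by have [] := triangle_vertices hP adm K. Qed.

Lemma int_weight_bounds (K : tri N) :
  1 / 2 * area K <= int_weight K <= area K * (2 * node0 W K).
Proof.
rewrite -(mulrC (area K)) -!(integral_triangle_cst hP adm).
apply/andP; split; apply: (le_integral_triangle hP adm) => //;
  try exact: square_bounded_cst.
- by move=> p _; exact: weight_ge.
- by move=> p Kp; rewrite node0_nodal; have [] := weight_at_triangle xs hP adm k24 (vert K) Kp.
Qed.

Lemma int_weight_sqr_bounds (K : tri N) :
  1 / 2 * area K * node_form K G G <= int_weight_sqr K
    <= area K * (2 * node0 W K * node_sqr G K).
Proof.
apply/andP; split.
  have := integral_triangle_mul hP adm K (node0 G K) (node1 G K) (node2 G K)
     (node0 G K) (node1 G K) (node2 G K).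
  rewrite -/(node_form K G G) -/(node_interp P eps K G) -[_ * _ * _]mulrA => <-.
  rewrite -int_cstM; last exact: square_boundedM.
  apply: (le_integral_triangle hP adm).
  - by apply: square_boundedM; [exact: square_boundedM|exact: square_bounded_cst].
  - by apply: square_boundedM => //; exact: square_boundedX.
  - move=> p _; rewrite -expr2 mulrC ler_wpM2r ?sqr_ge0//.
    exact: weight_ge.
rewrite -(integral_triangle_cst hP adm).
apply: (le_integral_triangle hP adm).
- by apply: square_boundedM => //; exact: square_boundedX.
- exact: square_bounded_cst.
- move=> p Kp; apply: ler_pM; rewrite ?sqr_ge0//.
  + by rewrite ltW// weight_gt0.
  + by rewrite node0_nodal; have [] := weight_at_triangle xs hP adm k24 (vert K) Kp.
  + exact: node_interp_sqr_le.
Qed.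

Lemma int_deriv_sqr_bounds (K : tri N) :
  0 <= int_deriv_sqr K <= area K * (2 * node0 D K * node_sqr G K).
Proof.
apply/andP; split.
  apply: Rintegral_ge0 => p _; rewrite mulr_ge0 ?sqr_ge0// ltW//.
  exact: weight_deriv_at_gt0.
rewrite -(integral_triangle_cst hP adm).
apply: (le_integral_triangle hP adm).
- by apply: square_boundedM => //; exact: square_boundedX.
- exact: square_bounded_cst.
- move=> p Kp; apply: ler_pM; rewrite ?sqr_ge0//.
  + by rewrite ltW// weight_deriv_at_gt0.
  + by rewrite node0_nodal; have [_] := weight_at_triangle xs hP adm k24 (vert K) Kp.
  + exact: node_interp_sqr_le.
Qed.

(** The weight is at least 1/2 everywhere. The L^2 term decides the constant: 8 times 1/4 for the
    reaction coefficient times 1/2 for the weight is 1. *)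
Lemma SDnorm_le_weighted : 1 / 4 <= creact P ->
  mesh_norm2 P N eps G <= 8 * weighted_norm P N eps k xs v ^+ 2.
Proof.
move=> c4; rewrite weighted_norm_sqr mulr_sumr; apply: ler_sum => K _.
have e0 := admissible_eps_gt0 adm; have de0 := delta_ge0 eps hP K.
have a0 := area_gt0 hP adm K.
have /andP[w1 _] := int_weight_bounds K.
have /andP[w2 _] := int_weight_sqr_bounds K.
have /andP[w3 _] := int_deriv_sqr_bounds K.
have f0 := node_form_ge0 K G.
rewrite grad_frame -grad_along_b.
have g0 : 0 <= eps * (grad_x K G ^+ 2 + grad_y K G ^+ 2).
  by rewrite mulr_ge0 ?addr_ge0 ?sqr_ge0// ltW.
have h0 : 0 <= b ^+ 2 * delta K * grad_along K ^+ 2.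
  by rewrite mulr_ge0 ?sqr_ge0// mulr_ge0 ?sqr_ge0.
have T1 := ler_wpM2l g0 w1; have T2 := ler_wpM2l h0 w1.
have af := mulr_ge0 (ltW a0) f0.
have T3 : 1 / 4 * (1 / 2 * area K * node_form K G G) <= creact P * int_weight_sqr K.
  apply: ler_pM => //; rewrite -mulrA mulr_ge0//.
have T4 := mulr_ge0 (ltW b0) w3.
have ag := mulr_ge0 (ltW a0) g0; have ah := mulr_ge0 (ltW a0) h0.
lra.
Qed.

Lemma weighted_norm_le : weighted_norm P N eps k xs v ^+ 2 <=
  (2 + 2 * b + 2 * creact P) * weighted_energy P N eps k xs G.
Proof.
rewrite weighted_norm_sqr /weighted_energy mulr_sumr; apply: ler_sum => K _.
have e0 := admissible_eps_gt0 adm; have de0 := delta_ge0 eps hP K.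
have a0 := area_gt0 hP adm K; have [[_ _ c0] _] := hP.
have /andP[_ w1] := int_weight_bounds K.
have /andP[_ w2] := int_weight_sqr_bounds K.
have /andP[_ w3] := int_deriv_sqr_bounds K.
rewrite grad_frame -(grad_along_b K).
have w0 : 0 < node0 W K by exact: node0_weight_gt0.
have d0 : 0 < node0 D K by exact: node0_deriv_gt0.
have S0 : 0 <= node_sqr G K by rewrite /node_sqr !addr_ge0 ?sqr_ge0.
have g0 : 0 <= eps * (grad_x K G ^+ 2 + grad_y K G ^+ 2).
  by rewrite mulr_ge0 ?addr_ge0 ?sqr_ge0// ltW.
have h0 : 0 <= b ^+ 2 * delta K * grad_along K ^+ 2.
  by rewrite mulr_ge0 ?sqr_ge0// mulr_ge0 ?sqr_ge0.
have T1 := ler_wpM2l g0 w1; have T2 := ler_wpM2l h0 w1.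
have T3 := ler_wpM2l (ltW c0) w2; have T4 := ler_wpM2l (ltW b0) w3.
have aw := mulr_ge0 (ltW a0) (ltW w0); have ad := mulr_ge0 (ltW a0) (ltW d0).
have p1 := mulr_ge0 aw g0; have p2 := mulr_ge0 aw h0.
have p3 := mulr_ge0 aw S0; have p4 := mulr_ge0 ad S0.
have q1 := mulr_ge0 (ltW b0) p1; have q2 := mulr_ge0 (ltW b0) p2.
have q3 := mulr_ge0 (ltW b0) p3; have q4 := mulr_ge0 (ltW b0) p4.
have r1 := mulr_ge0 (ltW c0) p1; have r2 := mulr_ge0 (ltW c0) p2.
have r3 := mulr_ge0 (ltW c0) p3; have r4 := mulr_ge0 (ltW c0) p4.
clearbody b0 b; lra.
Qed.

End weighted_norm_integrals.

(** * Nodal arrays as finite element functions *)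

Section nodal_arrays.
Context (R : realType) (P : sd_data R) (N : nat) (eps : R).
Hypotheses (hP : sd_data_pos P) (adm : admissible P N eps).

(** Subtraction of naturals is truncated, so the mesh points saturate at 1. Nodal arrays then vanish
    at every index from N on, and can be identified as functions on all pairs of naturals. *)
Lemma mesh_pt_beyond (lam : R) (i : nat) : (N <= i)%N -> mesh_pt lam N i = 1.
Proof.
move=> Ni; have N2 := admissible_ge2 adm.
rewrite /mesh_pt ifF; last first.
  apply/negbTE; rewrite -ltnNge; apply: leq_trans Ni.
  by rewrite ltn_half_double -addnn -{1}[N]addn0 ltn_add2l; exact: leq_trans N2.
by move: Ni; rewrite -subn_eq0 => /eqP ->; rewrite mulr0 !mul0r subr0.
Qed.

Lemma nodal_out (v : R * R -> R) (i j : nat) : (forall p, ~ Omega p -> v p = 0) ->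
  [|| i == 0, j == 0, (N <= i) | (N <= j)]%N -> nodal P N eps v i j = 0.
Proof.
move=> v0 ij; apply: v0 => -[/=]; rewrite !in_itv /= => /andP[x0 x1] /andP[y0 y1].
case/or4P: ij => [/eqP i0|/eqP j0|Ni|Nj].
- by move: x0; rewrite i0 /mesh_x mesh_pt0 ltxx.
- by move: y0; rewrite j0 /mesh_y mesh_pt0 ltxx.
- by move: x1; rewrite /mesh_x mesh_pt_beyond// ltxx.
- by move: y1; rewrite /mesh_y mesh_pt_beyond// ltxx.
Qed.

Lemma VN_boundary_zero (v : R * R -> R) : VN P N eps v -> boundary_zero N (nodal P N eps v).
Proof.
move=> [_ v0 _]; split => i; split; apply: nodal_out => //;
  by rewrite ?eqxx ?leqnn ?orbT.
Qed.

Lemma exists_interpolant (V : nat -> nat -> R) :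
  (forall i j, [|| i == 0, j == 0, (N <= i) | (N <= j)]%N -> V i j = 0) ->
  exists2 v, VN P N eps v & nodal P N eps v = V.
Proof.
move=> V0.
have a1 j : V 0%N j = 0 by apply: V0.
have a2 j : V N j = 0 by apply: V0; rewrite leqnn !orbT.
have a3 i : V i 0%N = 0 by apply: V0; rewrite !orbT.
have a4 i : V i N = 0 by apply: V0; rewrite leqnn !orbT.
have vV := VN_interpolant hP adm a1 a2 a3 a4.
eexists; first exact: vV.
apply/funext => i; apply/funext => j.
have [ij|/norP[i0 /norP[j0 /norP[Ni Nj]]]] := boolP [|| i == 0, j == 0, (N <= i) | (N <= j)]%N.
  by rewrite V0// nodal_out//; case: vV.
by apply: nodal_interpolant => //; rewrite leqNgt; apply/negP => /ltnW; exact/negP.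
Qed.

End nodal_arrays.

(** * A lower bound for the reaction coefficient *)

Section reaction_bound.
Context (R : realType) (P : sd_data R).
Hypotheses (hP : sd_data_pos P) (hco : SDcoercive P).

(** With epsilon = 1 / (N q) and q above both 5 ln N / beta, the logarithmic term realizes both
    minima in the transition parameters. *)
Lemma fine_eps (N : nat) : (2 <= N)%N -> ~~ odd N -> exists eps : R, admissible P N eps.
Proof.
move=> N2 evN; have [_ [be1 be2 _]] := hP.
have L0 : 0 < ln N%:R :> R by apply: lt_le_trans (ln_natr_ge R N2).
have N0 : 0 < N%:R :> R by apply: lt_le_trans (natr_ge2 R N2).
set L := ln N%:R in L0 *.
have t1 : 0 < 5 * L / beta1 P by rewrite divr_gt0 ?mulr_gt0.
have t2 : 0 < 5 * L / beta2 P by rewrite divr_gt0 ?mulr_gt0.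
pose q := 1 + 5 * L / beta1 P + 5 * L / beta2 P.
have q1 : 1 <= q by rewrite /q; lra.
have q0 : 0 < q by lra.
have N1 : 1 <= N%:R :> R by apply: le_trans (natr_ge2 R N2); lra.
have Nq : 0 < N%:R * q by rewrite mulr_gt0.
have qN : q <= N%:R * q by rewrite ler_peMl// ltW.
exists (N%:R * q)^-1; split; first split => //.
- by rewrite invr_gt0.
- by rewrite lef_pV2 ?posrE// ler_peMr// ltW.
have aux be : 0 < be -> 5 * L / be <= q ->
    transition be N (N%:R * q)^-1 = 5 / 2 * (N%:R * q)^-1 * be^-1 * L.
  move=> be0 h; apply/min_idPr.
  have -> : 5 / 2 * (N%:R * q)^-1 * be^-1 * L = 1 / 2 * ((5 * L / be) / (N%:R * q)).
    by field; rewrite !gt_eqF.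
  rewrite ler_piMr// ler_pdivrMr// mul1r.
  exact: le_trans qN.
by split; apply: aux => //; rewrite /q; lra.
Qed.

Section bump.
Variable n : nat.
Hypothesis n2 : (2 <= n)%N.

(** A discrete parabola over the first half of the indices, where the mesh is coarse; the product of
    two of them has gradients bounded independently of [n] and epsilon. *)
Definition bump (i : nat) : R :=
  if (i < n)%N then i%:R * (n%:R - i%:R) / n%:R ^+ 2 else 0.

Let n0 : 0 < n%:R :> R. Proof. by rewrite ltr0n; exact: leq_trans n2. Qed.

Lemma bump_itv i : 0 <= bump i <= 1.
Proof.
rewrite /bump; case: ifP => [il|_]; last by rewrite lexx ler01.
have i0 : 0 <= i%:R :> R by [].
have i1 : i%:R <= n%:R :> R by rewrite ler_nat ltnW.
apply/andP; split; first by rewrite divr_ge0 ?mulr_ge0 ?subr_ge0 ?sqr_ge0.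
rewrite ler_pdivrMr ?exprn_gt0// mul1r expr2; apply: ler_pM => //.
  by rewrite subr_ge0.
by rewrite gerBl.
Qed.

Lemma bump_formula i : (i <= n)%N -> bump i = i%:R * (n%:R - i%:R) / n%:R ^+ 2.
Proof.
rewrite leq_eqVlt => /predU1P[->|il]; last by rewrite /bump il.
by rewrite /bump ltnn subrr mulr0 mul0r.
Qed.

Lemma bump_step i : `|bump i.+1 - bump i| <= n%:R^-1.
Proof.
have [il|il] := ltnP i n; last first.
  by rewrite /bump !ltnNge il (leq_trans il)// subrr normr0 invr_ge0 ltW.
rewrite !bump_formula ?(ltnW il)//.
have i0 : 0 <= i%:R :> R by [].
have i1 : i.+1%:R <= n%:R :> R by rewrite ler_nat.
rewrite -natr1 in i1 *.
have -> : (i%:R + 1) * (n%:R - (i%:R + 1)) / n%:R ^+ 2 - i%:R * (n%:R - i%:R) / n%:R ^+ 2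
  = (n%:R - 2 * i%:R - 1) / n%:R * n%:R^-1 :> R by field; rewrite gt_eqF.
rewrite normrM [X in _ * X]gtr0_norm ?invr_gt0// ler_piMl ?invr_ge0 ?(ltW n0)//.
by rewrite normrM normfV [X in _ / X]gtr0_norm// ler_pdivrMr// mul1r ler_norml; apply/andP; split; lra.
Qed.

Lemma bump_sum : n%:R / 12 <= \sum_(0 <= i < n) bump i.
Proof.
have H m : (m <= n)%N -> \sum_(0 <= i < m) bump i =
   (n%:R * (m%:R * (m%:R - 1)) / 2 - (m%:R - 1) * m%:R * (2 * m%:R - 1) / 6) / n%:R ^+ 2.
  elim: m => [|m IH] mn; first by rewrite big_geq// !(mul0r, mulr0) subr0 mul0r.
  rewrite big_nat_recr//= IH ?(ltnW mn)// bump_formula ?(ltnW mn)// -natr1.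
  by field; rewrite gt_eqF.
rewrite H//.
have n2' : 2 <= n%:R :> R by rewrite ler_nat.
have -> : (n%:R * (n%:R * (n%:R - 1)) / 2 - (n%:R - 1) * n%:R * (2 * n%:R - 1) / 6) / n%:R ^+ 2
  = (n%:R ^+ 2 - 1) / n%:R / 6 :> R by field; rewrite gt_eqF.
rewrite ler_pdivlMr// ler_pdivlMr//.
by move: (n%:R : R) n2' => x x2; nra.
Qed.

Lemma bump_sqr_sum : n%:R / 144 <= \sum_(0 <= i < n) bump i ^+ 2.
Proof.
have h := sqr_sum_le n bump; have s := bump_sum.
have : (n%:R / 12) ^+ 2 <= n%:R * \sum_(0 <= i < n) bump i ^+ 2.
  apply: le_trans h; rewrite ler_pXn2r// nnegrE; first by rewrite divr_ge0.
  by apply: le_trans s; rewrite divr_ge0.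
have -> : (n%:R / 12) ^+ 2 = n%:R * (n%:R / 144) :> R by field.
by rewrite ler_pM2l.
Qed.

Let N := (2 * n)%N.
Variable eps : R.
Hypothesis adm : admissible P N eps.
Local Notation area := (area P eps).
Local Notation grad_x := (grad_x P eps).
Local Notation grad_y := (grad_y P eps).
Local Notation grad_b := (grad_b P eps).
Local Notation delta := (delta P eps).

Let V (i j : nat) : R := bump i * bump j.

Let Nn : N%:R = 2 * n%:R :> R. Proof. by rewrite natrM. Qed.
Let Nhalf : N./2 = n. Proof. by rewrite /N mul2n doubleK. Qed.

Lemma bump_zero i j : [|| i == 0, j == 0, (N <= i) | (N <= j)]%N -> V i j = 0.
Proof.
have z0 : bump 0 = 0 by rewrite bump_formula// mul0r mul0r.
have zN m : (N <= m)%N -> bump m = 0.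
  move=> Nm; rewrite /bump ltnNge (leq_trans _ Nm)//.
  by rewrite /N mul2n -addnn leq_addr.
by rewrite /V => /or4P[/eqP ->|/eqP ->|/zN ->|/zN ->]; rewrite ?z0 ?mul0r ?mulr0.
Qed.

Lemma bump_difference (h : R) i : ((i < n)%N -> 1 / N%:R <= h) -> 0 < h ->
  ((bump i.+1 - bump i) / h) ^+ 2 <= 4.
Proof.
move=> hi h0; have [il|il] := ltnP i n; last first.
  by rewrite /bump !ltnNge il (leq_trans il)// subrr mul0r expr0n.
rewrite (_ : 4 = 2 ^+ 2); last by ring.
apply: sqr_le_of_norm; rewrite normrM normfV [X in _ / X]gtr0_norm// ler_pdivrMr//.
apply: le_trans (bump_step i) _; have := hi il; rewrite Nn.
have -> : 1 / (2 * n%:R) = n%:R^-1 / 2 :> R by field; rewrite gt_eqF.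
by lra.
Qed.

Lemma mulr_sqr_le (x y c : R) : 0 <= x <= 1 -> y ^+ 2 <= c -> (x * y) ^+ 2 <= c.
Proof.
move=> /andP[x0 x1] yc; apply: le_trans yc.
by rewrite exprMn ler_piMl ?sqr_ge0// exprn_ile1.
Qed.

Lemma bump_gradient (K : tri N) : grad_x K V ^+ 2 <= 4 /\ grad_y K V ^+ 2 <= 4.
Proof.
have [/andP[lx0 lx1] /andP[ly0 ly1]] := (lambda_x_itv hP adm, lambda_y_itv hP adm).
have N2 := admissible_ge2 adm; have evN := admissible_even adm.
case: K => [[i j] t].
have hx0 := hx_gt0 hP adm (ltn_ord i); have hy0 := hy_gt0 hP adm (ltn_ord j).
have ax : ((bump i.+1 - bump i) / hx P N eps i) ^+ 2 <= 4.
  by apply: bump_difference => // il; apply: mesh_pt_step_coarse; rewrite ?Nhalf.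
have ay : ((bump j.+1 - bump j) / hy P N eps j) ^+ 2 <= 4.
  by apply: bump_difference => // il; apply: mesh_pt_step_coarse; rewrite ?Nhalf.
split.
  have -> : grad_x (i, j, t) V = bump (t + j)%N * ((bump i.+1 - bump i) / hx P N eps i).
    by case: t; rewrite /grad_x /V /=; field; rewrite gt_eqF.
  exact: mulr_sqr_le (bump_itv _) ax.
have -> : grad_y (i, j, t) V = bump (t + i)%N * ((bump j.+1 - bump j) / hy P N eps j).
  by case: t; rewrite /grad_y /V /=; field; rewrite gt_eqF.
exact: mulr_sqr_le (bump_itv _) ay.
Qed.

Lemma bump_avg (K : tri N) : node_avg K V ^+ 2 <= 1.
Proof.
have B i j : 0 <= V i j <= 1.
  have /andP[x0 x1] := bump_itv i; have /andP[y0 y1] := bump_itv j.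
  by rewrite /V mulr_ge0//= mulr_ile1.
case: K => [[i j] t]; rewrite /node_avg /=.
have /andP[p0 p1] := B (t + i)%N (t + j)%N; have /andP[q0 q1] := B (~~ t + i)%N (t + j)%N.
have /andP[r0 r1] := B (t + i)%N (~~ t + j)%N.
by rewrite exprn_ile1//; lra.
Qed.

(** Convection is skew and drops out on the diagonal, so coercivity compares half of the L^2 mass
    with [creact P] times it, up to diffusion and stabilization terms. *)
Lemma bump_coercive : (1 / 2 - creact P) *
    (\sum_(K : tri N) area K * node_form K V V) <=
  \sum_(K : tri N) area K * (1 / 2 * eps * (grad_x K V ^+ 2 + grad_y K V ^+ 2)
    + 1 / 2 * (delta K * grad_b K V ^+ 2)
    + delta K * creact P * (node_avg K V * grad_b K V)).
Proof.
have [v vV nV] := exists_interpolant hP adm bump_zero.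
have := hco adm vV.
rewrite (SDnorm_nodal hP adm vV) (a_SD_nodal hP adm vV vV) nV => H.
have bz : boundary_zero N V by rewrite -nV; exact: (VN_boundary_zero adm vV).
have skew : \sum_(K : tri N) area K * (grad_b K V * node_avg K V) = 0.
  have := sum_grad_b_antisym hP adm V bz; set s := \sum_(K : tri N) _ => sE.
  by lra.
rewrite -subr_ge0; apply: le_trans (_ : _ <= mesh_aSD P N eps V V - 1 / 2 * mesh_norm2 P N eps V) _.
  by rewrite subr_ge0.
rewrite -[leLHS]subr0 -{1}skew /mesh_aSD /mesh_norm2 !mulr_sumr -!sumrB.
apply: ler_sum => K _; rewrite le_eqVlt; apply/orP; left; apply/eqP.
by field.
Qed.

Lemma area_bounds (K : tri N) : area K <= 2 / N%:R ^+ 2.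
Proof.
have := step_x_le hP adm K; have := step_y_le hP adm K => h1 h2.
have := ler_pM (normr_ge0 _) (normr_ge0 _) h2 h1.
rewrite (area_step hP adm).
have -> : 2 / N%:R * (2 / N%:R) = 2 * (2 / N%:R ^+ 2) :> R.
  by field; rewrite Nn gt_eqF// mulr_gt0.
by rewrite ler_pM2l.
Qed.

Lemma sum_area_le : \sum_(K : tri N) area K <= 4.
Proof.
apply: (@le_trans _ _ (\sum_(K : tri N) 2 / N%:R ^+ 2)).
  by apply: ler_sum => K _; exact: area_bounds.
rewrite sumr_const !card_prod !card_ord card_bool -[leLHS]mulr_natl.
have N0 : N%:R != 0 :> R by rewrite Nn gt_eqF// mulr_gt0.
have -> : (N * N * 2)%N%:R = N%:R * N%:R * 2 :> R by rewrite !(natrM _ (N * N)) (natrM _ N).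
move: (N%:R : R) N0 => x x0.
by rewrite le_eqVlt; apply/orP; left; apply/eqP; field.
Qed.

(** Only the lower triangles of coarse cells are kept: area at least 1 / (8 n^2), mass at least 1/12
    of one squared vertex value, and sums of squares at least n / 144 in each direction. *)
Lemma bump_mass : (96 * 144 ^+ 2)^-1 <= \sum_(K : tri N) area K * node_form K V V.
Proof.
have [/andP[lx0 lx1] /andP[ly0 ly1]] := (lambda_x_itv hP adm, lambda_y_itv hP adm).
have N2 := admissible_ge2 adm; have evN := admissible_even adm.
have nN : (n <= N)%N by rewrite /N mul2n -addnn leq_addr.
rewrite sum_tri.
pose q i j := (8 * n%:R ^+ 2)^-1 * (bump i ^+ 2 * bump j ^+ 2 / 12).
have pos (K : tri N) : 0 <= area K * node_form K V V.
  by rewrite mulr_ge0 ?node_form_ge0// ltW// (area_gt0 hP adm).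
have q0 i j : 0 <= q i j.
  apply: mulr_ge0; first by rewrite invr_ge0 mulr_ge0 ?sqr_ge0.
  by apply: divr_ge0 => //; apply: mulr_ge0; exact: sqr_ge0.
have bz m : ~~ (m < n)%N -> bump m = 0 by move=> h; rewrite /bump (negbTE h).
apply: (@le_trans _ _ (\sum_(i < N) \sum_(j < N) q i j)); last first.
  apply: ler_sum => i _; apply: ler_sum => j _.
  apply: (@le_trans _ _ (area (i, j, false) * node_form (i, j, false) V V)); last first.
    by rewrite lerDl.
  have [il|il] := boolP (i < n)%N; last first.
    by rewrite /q bz// expr0n !mul0r mulr0.
  have [jl|jl] := boolP (j < n)%N; last first.
    by rewrite /q (bz j)// expr0n !mulr0 mul0r mulr0.
  have hxi : 1 / N%:R <= hx P N eps i by apply: mesh_pt_step_coarse; rewrite ?Nhalf.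
  have hyj : 1 / N%:R <= hy P N eps j by apply: mesh_pt_step_coarse; rewrite ?Nhalf.
  apply: ler_pM.
  - by rewrite invr_ge0 mulr_ge0 ?sqr_ge0.
  - by apply: divr_ge0 => //; apply: mulr_ge0; exact: sqr_ge0.
  - have -> : (8 * n%:R ^+ 2)^-1 = 1 / N%:R * (1 / N%:R) / 2 :> R.
      by rewrite Nn; field; rewrite gt_eqF.
    by rewrite /area ler_pM2r//; apply: ler_pM => //; rewrite divr_ge0.
  - apply: le_trans (node_form_ge _ _); rewrite ler_pM2r//.
    by rewrite /= -addrA -exprMn lerDl addr_ge0 ?sqr_ge0.
have -> : \sum_(i < N) \sum_(j < N) q i j =
  (96 * n%:R ^+ 2)^-1 * ((\sum_(i < N) bump i ^+ 2) * \sum_(j < N) bump j ^+ 2).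
  rewrite mulr_suml mulr_sumr; apply: eq_bigr => i _.
  rewrite [X in _ * X]mulr_sumr mulr_sumr; apply: eq_bigr => j _.
  by rewrite /q; field; rewrite gt_eqF.
have S : n%:R / 144 <= \sum_(i < N) bump i ^+ 2.
  apply: le_trans bump_sqr_sum _.
  rewrite -(big_mkord xpredT (fun i => bump i ^+ 2)) [leRHS](big_cat_nat (n := n))//=.
  by rewrite lerDl; apply: sumr_ge0 => i _; exact: sqr_ge0.
have s0 : 0 <= n%:R / 144 :> R by rewrite divr_ge0.
have := ler_pM s0 s0 S S.
have c0 : 0 < (96 * n%:R ^+ 2)^-1 :> R by rewrite invr_gt0 mulr_gt0 ?exprn_gt0.
rewrite -(ler_pM2l c0); apply: le_trans.
by rewrite le_eqVlt; apply/orP; left; apply/eqP; field; rewrite gt_eqF.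
Qed.

Let b := bnorm P.

(** Every term contains epsilon or [delta], hence a factor 1/n against bounded gradients; the
    leading 4 is the crude bound on the total area. *)
Lemma bump_smallness : \sum_(K : tri N) area K * (1 / 2 * eps * (grad_x K V ^+ 2 + grad_y K V ^+ 2)
    + 1 / 2 * (delta K * grad_b K V ^+ 2)
    + delta K * creact P * (node_avg K V * grad_b K V)) <=
  4 * ((4 + Cstar P * (4 * b ^+ 2 + creact P * (1 + 8 * b ^+ 2))) / n%:R).
Proof.
set M := 4 + _.
have [[_ _ c0] [_ _ Cs0]] := hP.
have bb : 0 <= b ^+ 2 by exact: sqr_ge0.
have M0 : 0 <= M.
  rewrite addr_ge0// mulr_ge0 ?(ltW Cs0)// addr_ge0//; first by rewrite mulr_ge0.
  by rewrite mulr_ge0 ?(ltW c0)// addr_ge0// mulr_ge0.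
apply: (@le_trans _ _ (\sum_(K : tri N) area K * (M / n%:R))); last first.
  by rewrite -mulr_suml ler_wpM2r ?sum_area_le// divr_ge0.
apply: ler_sum => K _; rewrite ler_pM2l ?(area_gt0 hP adm)//.
have [gx gy] := bump_gradient K; have av := bump_avg K.
have gb := grad_b_sqr_le P eps V K; rewrite -/b in gb.
have gb8 : grad_b K V ^+ 2 <= 8 * b ^+ 2.
  by apply: le_trans gb _; rewrite [leRHS]mulrC ler_wpM2l//; lra.
have nN : N%:R^-1 <= n%:R^-1 :> R.
  have N0 : 0 < N%:R :> R by rewrite Nn mulr_gt0.
  rewrite lef_pV2 ?posrE//.
  have := n0; have := Nn; move: (N%:R : R) (n%:R : R) => x y; lra.
have e1 : eps <= n%:R^-1 by exact: le_trans (admissible_eps_le adm) nN.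
have e0 := admissible_eps_gt0 adm.
have de0 := delta_ge0 eps hP K.
have de1 : delta K <= Cstar P * n%:R^-1.
  rewrite /Defs.delta; case: ifP => _; last by rewrite mulr_ge0 ?invr_ge0 ?(ltW Cs0) ?(ltW n0).
  by rewrite ler_wpM2l// ltW.
have t1 : 1 / 2 * eps * (grad_x K V ^+ 2 + grad_y K V ^+ 2) <= 4 / n%:R.
  apply: (@le_trans _ _ (1 / 2 * n%:R^-1 * 8)); last by lra.
  apply: ler_pM; rewrite ?addr_ge0 ?sqr_ge0//; [by rewrite mulr_ge0// ltW| |lra].
  by rewrite ler_pM2l.
have t2 : 1 / 2 * (grad_b K V ^+ 2) + creact P * (node_avg K V * grad_b K V) <=
    4 * b ^+ 2 + creact P * (1 + 8 * b ^+ 2).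
  have : node_avg K V * grad_b K V <= 1 + 8 * b ^+ 2.
    by have := sqr_ge0 (node_avg K V - grad_b K V); have := sqr_ge0 (node_avg K V);
       have := sqr_ge0 (grad_b K V); lra.
  by rewrite -(ler_pM2l c0); lra.
have r0 : 0 <= 4 * b ^+ 2 + creact P * (1 + 8 * b ^+ 2).
  by apply: addr_ge0; [|apply: mulr_ge0 (ltW c0) _; apply: addr_ge0 => //]; apply: mulr_ge0.
have t3 : delta K * (1 / 2 * (grad_b K V ^+ 2) + creact P * (node_avg K V * grad_b K V)) <=
    Cstar P * n%:R^-1 * (4 * b ^+ 2 + creact P * (1 + 8 * b ^+ 2)).
  apply: le_trans (ler_wpM2l de0 t2) _.
  by rewrite ler_wpM2r.
rewrite /M mulrDl; lra.
Qed.

End bump.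

(** If [creact P] were below 1/4, a quarter of the bump mass, which is at least 1/m for every n,
    would be at most 4 M / n; any n above 16 M m contradicts this. *)
Lemma creact_ge : 1 / 4 <= creact P.
Proof.
rewrite leNgt; apply/negP => c4.
have [[_ _ c0] [_ _ Cs0]] := hP.
pose M := 4 + Cstar P * (4 * bnorm P ^+ 2 + creact P * (1 + 8 * bnorm P ^+ 2)).
have bb : 0 <= bnorm P ^+ 2 by exact: sqr_ge0.
have M0 : 0 <= M.
  rewrite addr_ge0// mulr_ge0 ?(ltW Cs0)// addr_ge0//; first by rewrite mulr_ge0.
  by rewrite mulr_ge0 ?(ltW c0)// addr_ge0// mulr_ge0.
pose m : R := 96 * 144 ^+ 2.
have m0 : 0 < m by rewrite mulr_gt0 ?exprn_gt0.
have x0 : 0 <= 16 * M * m by rewrite mulr_ge0 ?mulr_ge0// ltW.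
pose n := (Num.bound (16 * M * m)).+2.
have nb : 16 * M * m < n%:R.
  apply: (lt_le_trans (archi_boundP x0)); rewrite ler_nat /n.
  exact: (leq_trans (leqnSn _) (leqnSn _)).
have n2 : (2 <= n)%N by [].
have n0 : 0 < n%:R :> R by rewrite ltr0n.
have [eps adm] : exists eps : R, admissible P (2 * n)%N eps.
  by apply: fine_eps; [rewrite mul2n -addnn; exact: leq_trans (leq_addr _ _)|rewrite mul2n odd_double].
have h1 := bump_coercive adm.
have h2 := bump_smallness n2 adm.
have h3 := bump_mass n2 adm.
have h4 := le_trans h1 h2; rewrite -/M in h4; rewrite -/m in h3.
set S := \sum_(K : tri (2 * n)%N) _ in h3 h4.
have : 1 / 4 * m^-1 <= 4 * (M / n%:R).
  apply: le_trans h4; apply: ler_pM => //; first by rewrite invr_ge0 ltW.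
  by lra.
rewrite leNgt => /negP; apply.
rewrite mulrA ltr_pdivrMr// mulrAC ltr_pdivlMr//.
by lra.
Qed.

End reaction_bound.

(** * Crude comparison of energies for bounded N *)

Section few_cells.
Context (R : realType) (P : sd_data R) (N : nat) (eps k : R) (xs : R * R).
Hypotheses (hP : sd_data_pos P) (adm : admissible P N eps) (k24 : 24 <= k).
Hypotheses (xs1 : 0 <= xs.1 <= 1) (xs2 : 0 <= xs.2 <= 1).
Local Notation W := (nodal P N eps (weight_at P N k xs)).
Local Notation D := (nodal P N eps (weight_deriv_at P N k xs)).

Let k0 : 0 < k. Proof. by move: k24; lra. Qed.
Let N2 := admissible_ge2 adm.
Let N0 := natr_gt0 adm.

Lemma sigma_betaV_le_natr : (sigma_beta N k)^-1 <= N%:R / 3.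
Proof.
apply: le_trans (sigma_betaV_le adm k24) _; rewrite ler_pdivrMr//.
by have := N0; have := ler_wpM2l (ltW N0) k24; lra.
Qed.

(** The weight is 1 at [xs], points of the square are at most 2 apart in the l1 distance, and 1 /
    sigma_beta + 1 / sigma_eta <= N/3 + N/6. *)
Lemma node_weight_le_expR (K : tri N) : node0 W K <= expR N%:R.
Proof.
have [/triangle_unit_square h _ _] := triangle_vertices hP adm K.
have [c1 c2] := h hP adm; have -> : node0 W K = weight_at P N k xs (corner P eps K).
  by case: K {h c1 c2} => [[i j] t].
move: (corner P eps K) c1 c2 => q /andP[q1 q1'] /andP[q2 q2'].
have [+ _] := weight_at_quasi xs hP N2 k0 xs q; rewrite weight_at_self mulr1.
move=> /le_trans; apply; rewrite ler_expR.
have se : (sigma_eta N k)^-1 <= N%:R / 6.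
  rewrite (sigma_etaV adm k24) ler_pdivrMr//.
  apply: le_trans (sqrt_natr_le adm) _.
  by have := N0; have := ler_wpM2l (ltW N0) k24; lra.
have sb := sigma_betaV_le_natr.
have s0 : 0 < (sigma_beta N k)^-1 by rewrite invr_gt0 sigma_beta_gt0.
have s1 : 0 < (sigma_eta N k)^-1 by rewrite invr_gt0 sigma_eta_gt0.
have d1 : `|q.1 - xs.1| <= 1.
  by rewrite ler_norml; case/andP: xs1 => ? ?; apply/andP; split; lra.
have d2 : `|q.2 - xs.2| <= 1.
  by rewrite ler_norml; case/andP: xs2 => ? ?; apply/andP; split; lra.
apply: (@le_trans _ _ (2 * (N%:R / 2))); last by lra.
apply: ler_pM; rewrite ?addr_ge0 ?normr_ge0 ?(ltW s0) ?(ltW s1)//; first by lra.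
by lra.
Qed.

Lemma energy_le_mesh_norm2 (V : nat -> nat -> R) :
  weighted_energy P N eps k xs V <=
  12 * (1 + N%:R) * expR N%:R * mesh_norm2 P N eps V.
Proof.
rewrite /weighted_energy /mesh_norm2 mulr_sumr; apply: ler_sum => K _.
rewrite [leRHS]mulrCA ler_pM2l ?(area_gt0 hP adm)//.
have w1 := node_weight_le_expR K; set w := node0 W K in w1 *; set d := node0 D K.
have w0 : 0 < w by rewrite /w; case: (K) => [[i j] t]; exact: weight_gt0.
have d1 : d <= N%:R * w.
  apply: (@le_trans _ _ (w / sigma_beta N k)).
    by rewrite /w /d; case: (K) => [[i j] t]; exact: weight_deriv_at_le.
  rewrite mulrC ler_pM2r//; apply: le_trans sigma_betaV_le_natr _.
  by have := N0; lra.
have nf := node_form_ge K V; have nf0 := node_form_ge0 K V.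
have de := delta_ge0 eps hP K; have e0 := admissible_eps_gt0 adm.
set e := expR N%:R in w1 *; have E0 : 0 < e by exact: expR_gt0.
have g0 : 0 <= eps * (grad_x P eps K V ^+ 2 + grad_y P eps K V ^+ 2).
  by apply: mulr_ge0 (ltW e0) _; apply: addr_ge0; exact: sqr_ge0.
have b0 : 0 <= delta P eps K * grad_b P eps K V ^+ 2.
  by apply: mulr_ge0 => //; exact: sqr_ge0.
have Ne : e <= 12 * (1 + N%:R) * e.
  by rewrite ler_peMl ?(ltW E0)//; have := N0; lra.
have t1 : w * (eps * (grad_x P eps K V ^+ 2 + grad_y P eps K V ^+ 2)) <=
    12 * (1 + N%:R) * e * (eps * (grad_x P eps K V ^+ 2 + grad_y P eps K V ^+ 2)).
  by rewrite ler_wpM2r// (le_trans w1).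
have t3 : w * (delta P eps K * grad_b P eps K V ^+ 2) <=
    12 * (1 + N%:R) * e * (delta P eps K * grad_b P eps K V ^+ 2).
  by rewrite ler_wpM2r// (le_trans w1).
have t2 : (d + w) * node_sqr V K <= 12 * (1 + N%:R) * e * node_form K V V.
  have s0 : 0 <= node_sqr V K by rewrite !addr_ge0 ?sqr_ge0.
  have s1 : node_sqr V K <= 12 * node_form K V V by rewrite /node_sqr; lra.
  apply: (@le_trans _ _ ((1 + N%:R) * e * node_sqr V K)).
    rewrite ler_wpM2r//; apply: (@le_trans _ _ ((1 + N%:R) * w)); first by lra.
    by rewrite ler_pM2l// ltr_wpDr// ler0n.
  have -> : 12 * (1 + N%:R) * e * node_form K V V =
      (1 + N%:R) * e * (12 * node_form K V V) :> R by ring.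
  by rewrite ler_wpM2l// mulr_ge0 ?(ltW E0)// addr_ge0// ler0n.
lra.
Qed.

End few_cells.

Lemma mesh_pt_ge_transition (R : realType) (N : nat) (lam : R) (i : nat) :
  (2 <= N)%N -> ~~ odd N -> 0 < lam <= 1 / 2 -> (N./2 <= i <= N)%N ->
  1 - lam <= mesh_pt lam N i <= 1.
Proof.
move=> N2 evN /andP[l0 l1] /andP[Ni iN].
rewrite -{1}(mesh_pt_half N2 evN l0 l1) mesh_pt_le//=.
by rewrite -[leRHS](mesh_ptN N2 evN l0 l1) mesh_pt_le.
Qed.

(** * The discrete Green's function *)

Section green_bound.
Context (R : realType) (P : sd_data R) (N : nat) (eps k : R) (i j : nat).
Hypotheses (hP : sd_data_pos P) (adm : admissible P N eps) (k24 : 24 <= k).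
Let xs := (mesh_x P N eps i, mesh_y P N eps j).
Hypotheses (xsO : Omega xs) (xsL : ~ Omega_xy P N eps xs).
Variable G : R * R -> R.
Hypothesis greenG : discrete_green P N eps xs G.
Local Notation g := (nodal P N eps G).
Local Notation E := (weighted_energy P N eps k xs g).

Let VG : VN P N eps G. Proof. by case: greenG. Qed.
Let bzG := VN_boundary_zero adm VG.

(** The weighted array is realized by a function of V^N, whose value at [xs] is G(xs) because the
    weight is 1 there. *)
Lemma green_large_mesh (c1 : R) :
  30 / beta1 P <= k -> 30 / beta2 P <= k ->
  48 * (8 * kappa P + (b1 P + b2 P) + 7 * creact P) <= creact P * k ->
  48 * (64 * kappa P + 4 * (b1 P + b2 P)) <= bnorm P * k ->
  641 ^+ 2 * bnorm P ^+ 2 * ((beta1 P)^-1 ^+ 2 + (beta2 P)^-1 ^+ 2) <= k ->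
  64 * creact P * Cstar P <= N%:R ->
  0 <= c1 -> c1 <= 1 / 4 -> c1 <= bnorm P / 48 -> c1 <= creact P / 24 ->
  c1 * E <= G xs.
Proof.
move=> kb1 kb2 kc kd kl Nl c10 c1a c1b c1c.
have := weighted_coercivity xs hP adm k24 kb1 kb2 kc kd kl Nl bzG c10 c1a c1b c1c.
have [|v vV nv] := @exists_interpolant _ _ _ _ hP adm
    (fun i j => nodal P N eps (weight_at P N k xs) i j * g i j).
  have [_ G0 _] := VG.
  by move=> i' j' ij; rewrite [g i' j'](nodal_out adm G0 ij) mulr0.
move=> /le_trans; apply; rewrite -nv -(a_SD_nodal hP adm vV VG).
have [_ ->//] := greenG.
have -> : v xs = nodal P N eps v i j by [].
by rewrite nv /nodal -/xs weight_at_self mul1r.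
Qed.

Lemma Omega_unit_square : (0 <= xs.1 <= 1) /\ (0 <= xs.2 <= 1).
Proof.
have := xsO; case=> /=; rewrite !in_itv /= => /andP[/ltW -> /ltW ->].
by move=> /andP[/ltW -> /ltW ->].
Qed.

(** G itself is the test function: coercivity gives |||G|||^2 <= 2 G(xs). *)
Lemma green_small_mesh (m : R) : SDcoercive P -> N%:R <= m ->
  E <= 24 * (1 + m) * expR m * G xs.
Proof.
move=> hco Nm; have [x1 x2] := Omega_unit_square.
apply: le_trans (energy_le_mesh_norm2 hP adm k24 x1 x2 _) _.
have := hco _ _ adm _ VG; rewrite (SDnorm_nodal hP adm VG).
have [_ ->//] := greenG; move=> h.
have s0 := mesh_norm2_ge0 hP adm g; set s := mesh_norm2 P N eps g in h s0 *.
have N0 := natr_gt0 adm.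
apply: (@le_trans _ _ (12 * (1 + m) * expR m * s)).
  rewrite ler_wpM2r//; apply: ler_pM; rewrite ?expR_ge0 ?ler_expR//; lra.
have -> : 24 * (1 + m) * expR m * G xs = 12 * (1 + m) * expR m * (2 * G xs) by ring.
apply: ler_wpM2l; last by lra.
by rewrite mulr_ge0 ?expR_ge0// mulr_ge0//; lra.
Qed.

Lemma green_node_bound : (i <= N)%N -> (j <= N)%N ->
  G xs ^+ 2 <= (4 * k + 20 / beta1 P + 20 / beta2 P) * N%:R * ln N%:R * E.
Proof.
move=> iN jN; have [N2 evN] := (admissible_ge2 adm, admissible_even adm).
have [] := xsO; rewrite /xs /= !in_itv /= => /andP[x0 _] /andP[y0 _].
have i0 : (0 < i)%N.
  by rewrite lt0n; apply/eqP => i0; move: x0; rewrite i0 /mesh_x mesh_pt0 ltxx.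
have j0 : (0 < j)%N.
  by rewrite lt0n; apply/eqP => j0; move: y0; rewrite j0 /mesh_y mesh_pt0 ltxx.
apply: (node_value_bound hP adm k24 bzG _ _ (erefl xs)).
- by rewrite i0.
- by rewrite j0.
(* A node with both indices at least N/2 would lie in [Omega_xy]. *)
apply/negP => /andP[hi hj]; apply: xsL; split; rewrite /= in_itv /=.
  by apply: mesh_pt_ge_transition; rewrite ?hi// (lambda_x_itv hP adm).
by apply: mesh_pt_ge_transition; rewrite ?hj// (lambda_y_itv hP adm).
Qed.

End green_bound.

(** Squaring the first bound and inserting the second gives x^2 <= A^2 Q x, and a nonzero x can be
    cancelled. *)
Lemma linear_quadratic_bound (R : realType) (A Q x y : R) : 0 <= A -> 0 <= Q -> 0 <= x ->
  x <= A * y -> y ^+ 2 <= Q * x -> x <= A ^+ 2 * Q.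
Proof.
move=> A0 Q0 x0 xy yx; have [->|xn0] := eqVneq x 0.
  by rewrite mulr_ge0 ?sqr_ge0.
have xp : 0 < x by rewrite lt_def xn0.
rewrite -(ler_pM2r xp) -mulrA; apply: (@le_trans _ _ (A ^+ 2 * y ^+ 2)).
  by rewrite -exprMn -expr2 ler_sqr ?nnegrE// (le_trans x0).
by rewrite ler_wpM2l ?sqr_ge0.
Qed.

Theorem theorem1 (R : realType) (P : sd_data R)
    (hP : sd_data_pos P) (hcoer : SDcoercive P) :
  exists k0 : R, 1 < k0 /\
  forall k : R, k0 <= k ->
  exists C : R, 0 < C /\
  forall (N : nat) (eps : R), admissible P N eps ->
  forall xstar : R * R, mesh_node P N eps xstar ->
    Omega xstar -> ~ Omega_xy P N eps xstar ->
  forall G : R * R -> R, discrete_green P N eps xstar G ->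
    SDnorm P N eps G <= Num.sqrt 8 * weighted_norm P N eps k xstar G /\
    Num.sqrt 8 * weighted_norm P N eps k xstar G
      <= C * Num.sqrt N%:R * Num.sqrt (ln N%:R).
Proof.
have c4 := creact_ge hP hcoer.
have [[b1p b2p c0] [be1 be2 Cs0]] := hP.
have b0 := bnorm_gt0 hP.
have kap0 : 0 < kappa P.
  have s0 : 0 <= Cstar P * bnorm P ^+ 2 by rewrite mulr_ge0 ?sqr_ge0 ?(ltW Cs0).
  have s1 : 0 < 16 / (3 * Cstar P) by rewrite divr_gt0// mulr_gt0.
  by rewrite /kappa; lra.
pose a1 := 30 / beta1 P.
pose a2 := 30 / beta2 P.
pose a3 := 48 * (8 * kappa P + (b1 P + b2 P) + 7 * creact P) / creact P.
pose a4 := 48 * (64 * kappa P + 4 * (b1 P + b2 P)) / bnorm P.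
pose a5 := 641 ^+ 2 * bnorm P ^+ 2 * ((beta1 P)^-1 ^+ 2 + (beta2 P)^-1 ^+ 2).
have a1p : 0 < a1 by rewrite divr_gt0.
have a2p : 0 < a2 by rewrite divr_gt0.
have a3p : 0 < a3 by rewrite divr_gt0//; lra.
have a4p : 0 < a4 by rewrite divr_gt0//; lra.
have a5p : 0 <= a5.
  by apply: mulr_ge0; [apply: mulr_ge0; exact: sqr_ge0|apply: addr_ge0; exact: sqr_ge0].
(* Each summand is one lower bound required of k; 24 is the one that keeps the weight within a
   factor 2 on a triangle. *)
exists (24 + a1 + a2 + a3 + a4 + a5); split; first by lra.
move=> k kk.
have k24 : 24 <= k by lra.
have kb1 : 30 / beta1 P <= k by rewrite -/a1; lra.
have kb2 : 30 / beta2 P <= k by rewrite -/a2; lra.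
have kc : 48 * (8 * kappa P + (b1 P + b2 P) + 7 * creact P) <= creact P * k.
  by rewrite [leRHS]mulrC -ler_pdivrMr// -/a3; lra.
have kd : 48 * (64 * kappa P + 4 * (b1 P + b2 P)) <= bnorm P * k.
  by rewrite [leRHS]mulrC -ler_pdivrMr// -/a4; lra.
have kl : 641 ^+ 2 * bnorm P ^+ 2 * ((beta1 P)^-1 ^+ 2 + (beta2 P)^-1 ^+ 2) <= k.
  by rewrite -/a5; lra.
pose c1 := Num.min (1 / 4) (Num.min (bnorm P / 48) (creact P / 24)).
have c1p : 0 < c1 by rewrite !lt_min !divr_gt0.
have c1a : c1 <= 1 / 4 by rewrite ge_min lexx.
have c1b : c1 <= bnorm P / 48 by rewrite !ge_min lexx orbT.
have c1c : c1 <= creact P / 24 by rewrite !ge_min lexx !orbT.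
(* The threshold between the two regimes: from [m] on, [creact P] times [delta] is at most 1/64;
   below it, N is bounded by the data. *)
pose m := 64 * creact P * Cstar P.
have m0 : 0 < m by rewrite !mulr_gt0.
pose A := c1^-1 + 24 * (1 + m) * expR m.
have A1 : 0 < c1^-1 by rewrite invr_gt0.
have A2 : 0 < 24 * (1 + m) * expR m by rewrite !mulr_gt0 ?expR_gt0//; lra.
have A0 : 0 < A by rewrite /A; lra.
pose q := 4 * k + 20 / beta1 P + 20 / beta2 P.
have q0 : 0 < q.
  have d1 : 0 < 20 / beta1 P by rewrite divr_gt0.
  have d2 : 0 < 20 / beta2 P by rewrite divr_gt0.
  by rewrite /q; lra.
pose B := 2 + 2 * bnorm P + 2 * creact P.
have B0 : 0 < B by rewrite /B; lra.
pose M := 8 * (B * (A ^+ 2 * q)).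
have M0 : 0 < M by rewrite mulr_gt0// mulr_gt0// mulr_gt0// exprn_gt0.
exists (Num.sqrt M); split; first by rewrite sqrtr_gt0.
move=> N eps adm xstar [i [j [iN jN ->]]] xO xL G GG.
have VG : VN P N eps G by case: GG.
set xs := (mesh_x P N eps i, mesh_y P N eps j) in xO xL GG *.
have n1 := SDnorm_le_weighted xs hP adm k24 VG c4.
have n2 := weighted_norm_le xs hP adm k24 VG.
have w0 : 0 <= weighted_norm P N eps k xs G by rewrite /weighted_norm sqrtr_ge0.
have s0 : 0 <= SDnorm P N eps G by rewrite /SDnorm sqrtr_ge0.
rewrite -(SDnorm_nodal hP adm VG) in n1.
split.
  rewrite -ler_sqr ?nnegrE//; last by rewrite mulr_ge0 ?sqrtr_ge0.
  by rewrite exprMn [Num.sqrt 8 ^+ 2]sqr_sqrtr.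
set E := weighted_energy _ _ _ _ _ _ in n2.
have E0 : 0 <= E.
  by have := le_trans (sqr_ge0 _) n2; rewrite pmulr_rge0.
have N0 := natr_gt0 adm.
have L0 : 0 < ln N%:R :> R by apply: lt_le_trans (ln_natr_ge R (admissible_ge2 adm)).
have gq := green_node_bound hP adm k24 xO xL GG iN jN.
rewrite -/xs -/E -/q in gq.
(* [A] adds the constants of the two regimes. Enlarging a constant requires G(xs) >= 0, which
   follows from E >= 0 in either regime. *)
have EA : E <= A * G xs.
  have y1 : 0 <= G xs -> E <= c1^-1 * G xs \/ E <= 24 * (1 + m) * expR m * G xs ->
      E <= A * G xs.
    by move=> y0 []/le_trans; apply; rewrite ler_wpM2r// ?lerDl ?lerDr ltW.
  have [Nm|/ltW Nm] := leP m N%:R.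
    have h := green_large_mesh hP adm k24 GG kb1 kb2 kc kd kl Nm (ltW c1p) c1a c1b c1c.
    rewrite -/xs -/E in h.
    apply: y1; first by apply: le_trans h; rewrite mulr_ge0// ltW.
    by left; rewrite mulrC ler_pdivlMr// mulrC.
  have h := green_small_mesh hP adm k24 xO GG hcoer Nm.
  rewrite -/xs -/E in h.
  apply: y1; last by right.
  by have := le_trans E0 h; rewrite pmulr_rge0.
have Q0 : 0 <= q * N%:R * ln N%:R by rewrite !mulr_ge0// ltW.
have EQ := linear_quadratic_bound (ltW A0) Q0 E0 EA gq.
rewrite -ler_sqr ?nnegrE//; first last.
  by apply: mulr_ge0; rewrite ?sqrtr_ge0.
rewrite !exprMn [Num.sqrt 8 ^+ 2]sqr_sqrtr// [Num.sqrt M ^+ 2]sqr_sqrtr ?(ltW M0)//.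
rewrite [Num.sqrt N%:R ^+ 2]sqr_sqrtr// [Num.sqrt (ln _) ^+ 2]sqr_sqrtr ?(ltW L0)//.
rewrite /M -!mulrA ler_pM2l//; apply: le_trans n2 _.
rewrite -/B ler_pM2l//; apply: le_trans EQ _.
by rewrite !mulrA.
Qed.
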